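(* Let $f(z)=\sum_{n\ge0} a_n z^{-n}\in\mathbb{C}[[z^{-1}]]$ be a Gevrey-1 formal series with Borel transform $\widetilde f(\zeta)=\sum_{n\ge1} \frac{a_n\zeta^{n-1}}{(n-1)!}$. Let $\lambda>0$ and assume that $\widetilde f$ extends holomorphically to $\Delta_\lambda$ and that there exist $A>0$, $B>0$ with $|\widetilde f(\zeta)|\le A e^{B|\zeta|}$ for all $\zeta\in\Delta_\lambda$. Put $a_n^{(\lambda)}=\lambda^{n-1}a_n$ and, for $n\ge0$, $$b_n^{(\lambda)}=\frac{1}{n!}\sum_{k=1}^{n+1}(-1)^{n-k+1}\mathfrak{s}(n,k-1)\,a_k^{(\lambda)}.$$ Then: (i) the factorial series $a_0+\lambda\sum_{n=0}^{+\infty}\frac{\Gamma(\lambda z)\Gamma(n+1)b_n^{(\lambda)}}{\Gamma(\lambda z+n+1)}$ converges absolutely for $\Re(z)>\max(B,1/\lambda)$, and its sum equals $\mathrm{S}_0 f(z)$ there; (ii) for every integer $N\ge0$ and every $z$ with $\Re(z)>B$, $$\Big|\mathrm{S}_0f(z)-\Big(a_0+\lambda\sum_{n=0}^{N}\frac{\Gamma(\lambda z)\Gamma(n+1)b_n^{(\lambda)}}{\Gamma(\lambda z+n+1)}\Big)\Big|\le R_{fact}(\lambda,A,B,N,z),$$ where $$R_{fact}(\lambda,A,B,N,z)=\frac{A}{(\lambda B)^{\lambda B}}\,\frac{(N+\lambda B+1)^{N+\lambda B+1}}{(N+1)^N}\left|\frac{\Gamma(\lambda z)\Gamma(N+1)}{\Gamma(\lambda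 z+N+1)(\Re(z)-B)}\right|.$$
   Context: $\Delta$ denotes the image of the open disc $D(1,1)=\{s:|s-1|<1\}$ under $s\mapsto-\ln s$ (principal logarithm), and $\Delta_\lambda=\{\lambda\zeta:\zeta\in\Delta\}$. A series $\sum a_n z^{-n}$ is Gevrey-1 if $|a_n|\le CK^n n!$ for some constants. The Borel sum is $\mathrm{S}_0 f(z)=a_0+\int_0^{+\infty}\widetilde f(\zeta)e^{-z\zeta}\,d\zeta$ ($\Re z>B$). Stirling numbers of the first kind: $\prod_{k=0}^{n-1}(x-k)=\sum_{k=0}^n\mathfrak{s}(n,k)x^k$. *)

(* Defs.v *)
From Stdlib Require Import Reals ZArith List.
From Coquelicot Require Import Coquelicot.
Open Scope R_scope.

Definition Cexp (z : C) : C :=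
  (exp (Re z) * cos (Im z), exp (Re z) * sin (Im z)).

Definition Carg (s : C) : R :=
  let x := Re s in let y := Im s in
  if Rlt_dec 0 x then atan (y / x)
  else if Rlt_dec x 0 then
         (if Rle_dec 0 y then atan (y / x) + PI else atan (y / x) - PI)
  else if Rlt_dec 0 y then PI / 2
  else if Rlt_dec y 0 then - (PI / 2) else 0.

Definition Clog (s : C) : C := (ln (Cmod s), Carg s).

Definition Delta (zeta : C) : Prop :=
  exists s : C, Cmod (s - 1)%C < 1 /\ zeta = Copp (Clog s).

Definition Delta_lam (lam : R) (zeta : C) : Prop :=
  exists xi : C, Delta xi /\ zeta = (RtoC lam * xi)%C.

Definition Gevrey1 (a : nat -> C) : Prop :=
  exists Cc K : R, forall n : nat, Cmod (a n) <= Cc * K ^ n * INR (fact n).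

(** Borel transform: tilde f (zeta) = sum_{n>=1} a_n zeta^(n-1)/(n-1)!  (reindexed) *)
Definition borel_term (a : nat -> C) (zeta : C) (n : nat) : C :=
  (a (S n) * Cpow zeta n / RtoC (INR (fact n)))%C.

(** Euler's Gamma function  Gamma(w) = int_0^oo t^(w-1) e^(-t) dt,
    (improper Riemann integral; used only for Re w > 0, where it converges). *)
Definition Cgamma (w : C) : C :=
  @RInt_gen C_R_CompleteNormedModule
    (fun t : R => (Cexp ((w - 1) * RtoC (ln t)) * RtoC (exp (- t)))%C)
    (at_right 0) (Rbar_locally p_infty).

(** Stirling numbers of the first kind (signed), as the coefficients of
    prod_{k=0}^{n-1} (x - k) = sum_k s(n,k) x^k.  Polynomials are coefficient
    lists (lowest degree first). *)
Fixpoint padd (p q : list Z) : list Z :=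
  match p, q with
  | nil, _ => q
  | _, nil => p
  | x :: p', y :: q' => (x + y)%Z :: padd p' q'
  end.

Definition mul_X_minus (c : Z) (p : list Z) : list Z :=
  padd (0%Z :: p) (map (fun x => (- c * x)%Z) p).

Fixpoint falling_poly (n : nat) : list Z :=
  match n with
  | O => 1%Z :: nil
  | S m => mul_X_minus (Z.of_nat m) (falling_poly m)
  end.

Definition stirling1 (n k : nat) : Z := nth k (falling_poly n) 0%Z.

Example stirling1_3 : map (stirling1 3) (seq 0 4) = (0 :: 2 :: -3 :: 1 :: nil)%Z.
Proof. reflexivity. Qed.
Example stirling1_4 : map (stirling1 4) (seq 0 5) = (0 :: -6 :: 11 :: -6 :: 1 :: nil)%Z.
Proof. reflexivity. Qed.

Fixpoint csum (f : nat -> C) (N : nat) : C :=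
  match N with
  | O => f O
  | S m => (csum f m + f (S m))%C
  end.

(** b_n^(lambda) = 1/n! sum_{k=1}^{n+1} (-1)^(n-k+1) s(n,k-1) lambda^(k-1) a_k ,
    reindexed with j = k-1 in 0..n: (-1)^(n-j) s(n,j) lambda^j a_(j+1) *)
Definition b_lam (lam : R) (a : nat -> C) (n : nat) : C :=
  (/ RtoC (INR (fact n)) *
   csum (fun j => RtoC ((-1) ^ (n - j) * IZR (stirling1 n j) * lam ^ j) * a (S j)) n)%C.

Definition fact_term (lam : R) (a : nat -> C) (z : C) (n : nat) : C :=
  (RtoC lam * (Cgamma (RtoC lam * z) * Cgamma (RtoC (INR (S n))) * b_lam lam a n)
     / Cgamma (RtoC lam * z + RtoC (INR (S n))))%C.

Definition laplace_integrand (F : C -> C) (z : C) (t : R) : C :=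
  (F (RtoC t) * Cexp (- (z * RtoC t)))%C.

Definition borel_sum (a : nat -> C) (F : C -> C) (z : C) : C :=
  (a O + @RInt_gen C_R_CompleteNormedModule (laplace_integrand F z)
                    (at_point 0) (Rbar_locally p_infty))%C.

Definition R_fact (lam A B : R) (N : nat) (z : C) : R :=
  A / Rpower (lam * B) (lam * B)
  * (Rpower (INR N + lam * B + 1) (INR N + lam * B + 1) / (INR N + 1) ^ N)
  * Cmod (Cgamma (RtoC lam * z) * Cgamma (RtoC (INR (S N)))
          / (Cgamma (RtoC lam * z + RtoC (INR (S N))) * RtoC (Re z - B)))%C.

(* Main.v *)
(* Put [s = exp (- t / lam)] and let [phi (s) = F (- lam ln s)] be the pull-back of [F] to the disc
   [D(1,1)]. The functions [E_n (t) = s^n phi^(n) (s)] satisfy [E_0 = F] and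
   [E_(n+1) = - lam E_n' - n E_n]. Hence [E_n (0)] is the Stirling sum of Taylor coefficients of [F]
   that defines [b_n] up to sign and factorial, and, by parts, the Laplace transforms [L_n] of the
   [E_n] satisfy [L_(n+1) = lam E_n (0) - (lam z + n) L_n]. Divided by [(lam z)_(n+1)] these
   relations telescope to the factorial series, with remainder
   [(-1)^(N+1) L_(N+1) / (lam z)_(N+1)].

   The [E_n] are bounded by Cauchy's estimates for [phi] on the circle of centre [s] and radius
   [al s]. Bounding [phi] by its supremum, with [al = n / (n + lam B)], gives (ii). For (i) the mean
   of [phi] over the circle is smaller: it gives [|E_n (t)| <= M (c)_n e^(B t)] for each
   [c > max (1, lam B)]. Taking [c < x = lam Re z], the terms of the series are dominated by
   [(c)_n / (x)_(n+1)], a telescoping series, and the remainders by [(c)_n / (x)_n], which tends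
   to 0. *)

Require Import Defs.
From Stdlib Require Import Reals Lra Lia ZArith List ClassicalEpsilon.
From Coquelicot Require Import Coquelicot.
Open Scope R_scope.

(** * Calculus of complex functions *)

Notation is_derive_RC := (@is_derive R_AbsRing C_R_NormedModule).
Notation is_derive_C := (@is_derive C_AbsRing C_NormedModule).
Notation ex_derive_C := (@ex_derive C_AbsRing C_NormedModule).
Notation continuous_RC := (@continuous R_UniformSpace C_R_NormedModule).
Notation continuous_C := (@continuous (AbsRing_UniformSpace C_AbsRing) C_NormedModule).
Notation is_RInt_C := (@is_RInt C_R_NormedModule).
Notation ex_RInt_C := (@ex_RInt C_R_NormedModule).
Notation RInt_C := (@RInt C_R_CompleteNormedModule).

Lemma Re_le_Cmod (z : C) : Re z <= Cmod z.
Proof. eapply Rle_trans; [apply Rle_abs | apply re_le_Cmod]. Qed.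

Lemma Re_Im_decomposition (z : C) : (RtoC (Re z) * 1 + RtoC (Im z) * Ci)%C = z.
Proof. apply injective_projections; simpl; unfold Re, Im; ring. Qed.

Lemma Cmod_le_Rabs_plus (z : C) : Cmod z <= Rabs (Re z) + Rabs (Im z).
Proof.
  rewrite <- (Re_Im_decomposition z) at 1.
  eapply Rle_trans; [apply Cmod_triangle|].
  rewrite !Cmod_mult, Cmod_Ci, Cmod_1, !Cmod_R. lra.
Qed.

Lemma Cmod_minus_sym (x y : C) : Cmod (x - y)%C = Cmod (y - x)%C.
Proof. rewrite <- Cmod_opp. f_equal. ring. Qed.

Lemma Cmod_triangle_rev (x y : C) : Cmod x - Cmod y <= Cmod (x + y)%C.
Proof.
  pose proof (Cmod_triangle (x + y) (- y)) as H. rewrite Cmod_opp in H.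
  replace (x + y + - y)%C with x in H by ring. lra.
Qed.

Lemma Re_pos_neq_0 (z : C) : 0 < Re z -> z <> 0.
Proof. intros H E. rewrite E in H. simpl in H. lra. Qed.

Lemma Cmod_eq_Re_rotation (u : C) : exists w : C, Cmod w = 1 /\ Re (w * u)%C = Cmod u.
Proof.
  destruct (Ceq_dec u 0) as [->|Hu].
  - exists (RtoC 1). split; [apply Cmod_1|]. now rewrite Cmult_0_r, Cmod_0.
  - pose proof (proj1 (Cmod_gt_0 u) Hu) as Hm. exists (Cconj u / RtoC (Cmod u))%C.
    assert (HC : RtoC (Cmod u) <> 0) by (intros E; apply RtoC_inj in E; lra).
    split.
    + rewrite Cmod_div, Cmod_conj, Cmod_R, Rabs_pos_eq by (assumption || lra). field. lra.
    + replace (Cconj u / RtoC (Cmod u) * u)%C with (u * Cconj u / RtoC (Cmod u))%C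
        by (field; assumption).
      rewrite <- Cmod2_conj, <- RtoC_div by lra. simpl. field. lra.
Qed.

Lemma C_R_norm (z : C) : @norm R_AbsRing C_R_NormedModule z = Cmod z.
Proof.
  unfold norm, Cmod; simpl. unfold prod_norm, norm; simpl. unfold abs; simpl.
  now rewrite !Rmult_1_r, <- !Rabs_mult, !(Rabs_pos_eq (_ * _)) by apply Rle_0_sqr.
Qed.

Lemma C_ball_of_Cmod (x y : C) (e : R) :
  Cmod (y - x)%C < e -> @ball C_R_NormedModule x e y.
Proof. apply (C_NormedModule_mixin_compat1 x y e). Qed.

Lemma Cmod_of_C_ball (x y : C) (e : R) :
  @ball C_R_NormedModule x e y -> Cmod (y - x)%C < 2 * e.
Proof.
  intros [Hre Him]. eapply Rle_lt_trans; [apply Cmod_le_Rabs_plus|].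
  assert (Rabs (Re (y - x)%C) < e) by exact Hre.
  assert (Rabs (Im (y - x)%C) < e) by exact Him. lra.
Qed.

Lemma locally_C_intro (z : C) (r : R) (P : C -> Prop) :
  0 < r -> (forall y, Cmod (y - z)%C < r -> P y) ->
  locally (T := AbsRing_UniformSpace C_AbsRing) z P.
Proof. intros Hr H. exists (mkposreal r Hr). exact H. Qed.

Lemma filterlim_C_eps {T : Type} (F : (T -> Prop) -> Prop) {FF : Filter F} (f : T -> C) (l : C) :
  filterlim f F (locally (T := C_R_NormedModule) l) <->
  (forall e, 0 < e -> F (fun x => Cmod (f x - l)%C < e)).
Proof.
  rewrite (@filterlim_locally _ C_R_NormedModule F FF). split.
  - intros H e He. assert (He2 : 0 < e / 2) by lra.
    eapply filter_imp; [|exact (H (mkposreal _ He2))].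
    intros x Hx. apply Cmod_of_C_ball in Hx. simpl in Hx. lra.
  - intros H [e He]. eapply filter_imp; [|exact (H e He)].
    intros x Hx. now apply C_ball_of_Cmod.
Qed.

Lemma is_linear_Re : @is_linear R_AbsRing C_R_NormedModule R_NormedModule Re.
Proof. apply (is_linear_fst (U := R_NormedModule) (V := R_NormedModule)). Qed.

Lemma is_linear_Im : @is_linear R_AbsRing C_R_NormedModule R_NormedModule Im.
Proof. apply (is_linear_snd (U := R_NormedModule) (V := R_NormedModule)). Qed.

Lemma is_linear_Cmult (c : C) :
  @is_linear R_AbsRing C_R_NormedModule C_R_NormedModule (fun x => c * x)%C.
Proof.
  split.
  - intros x y. apply Cmult_plus_distr_l.
  - intros k x. rewrite !scal_R_Cmult, !Cmult_assoc, (Cmult_comm c). reflexivity.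
  - exists (Cmod c + 1). split; [pose proof (Cmod_ge_0 c); lra|].
    intros x. rewrite !C_R_norm, Cmod_mult. pose proof (Cmod_ge_0 x). nra.
Qed.

Lemma is_derive_linear {K : AbsRing} {U V : NormedModule K} (f : K -> U) (L : U -> V) t l :
  is_linear L -> is_derive f t l -> is_derive (fun u => L (f u)) t (L l).
Proof.
  intros HL Hf.
  eapply filterdiff_ext_lin;
    [exact (filterdiff_comp' f L t _ L Hf (filterdiff_linear L HL))|].
  intros y. apply (linear_scal L HL).
Qed.

Lemma is_derive_RC_pair (f : R -> C) t l :
  is_derive_RC f t l <->
  is_derive (fun u => Re (f u)) t (Re l) /\ is_derive (fun u => Im (f u)) t (Im l).
Proof.
  split.
  - intros H. split; [exact (is_derive_linear f _ t l is_linear_Re H)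
                     |exact (is_derive_linear f _ t l is_linear_Im H)].
  - intros [HRe HIm].
    assert (E : forall z : C, plus (scal (Re z) (RtoC 1 : C_R_NormedModule))
                                   (scal (Im z) (Ci : C_R_NormedModule)) = z).
    { intros z. rewrite !scal_R_Cmult. apply Re_Im_decomposition. }
    rewrite <- (E l). eapply is_derive_ext; [intros u; apply E|].
    apply (@is_derive_plus R_AbsRing C_R_NormedModule);
      apply (@is_derive_scal_l R_AbsRing C_R_NormedModule); assumption.
Qed.

Lemma is_derive_RC_unique (f : R -> C) t l l' :
  is_derive_RC f t l -> is_derive_RC f t l' -> l = l'.
Proof.
  rewrite !is_derive_RC_pair. intros [HRe HIm] [HRe' HIm'].
  apply injective_projections.
  - transitivity (Derive (fun u => Re (f u)) t);
      [symmetry|]; apply is_derive_unique; assumption.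
  - transitivity (Derive (fun u => Im (f u)) t);
      [symmetry|]; apply is_derive_unique; assumption.
Qed.

Lemma is_derive_RC_const (c : C) t : is_derive_RC (fun _ => c) t (RtoC 0).
Proof. apply (@is_derive_const R_AbsRing C_R_NormedModule). Qed.

Lemma is_derive_RC_plus f g t lf lg :
  is_derive_RC f t lf -> is_derive_RC g t lg ->
  is_derive_RC (fun u => f u + g u)%C t (lf + lg)%C.
Proof. apply (@is_derive_plus R_AbsRing C_R_NormedModule). Qed.

Lemma is_derive_RC_minus f g t lf lg :
  is_derive_RC f t lf -> is_derive_RC g t lg ->
  is_derive_RC (fun u => f u - g u)%C t (lf - lg)%C.
Proof. apply (@is_derive_minus R_AbsRing C_R_NormedModule). Qed.

Lemma is_derive_RC_mult f g t lf lg :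
  is_derive_RC f t lf -> is_derive_RC g t lg ->
  is_derive_RC (fun u => f u * g u)%C t (lf * g t + f t * lg)%C.
Proof.
  rewrite !is_derive_RC_pair. intros [fRe fIm] [gRe gIm]. split.
  - evar_last.
    + apply (@is_derive_minus R_AbsRing R_NormedModule);
        (apply (@is_derive_mult R_AbsRing); [eassumption..|exact Rmult_comm]).
    + cbn. unfold Re, Im. ring.
  - evar_last.
    + apply (@is_derive_plus R_AbsRing R_NormedModule);
        (apply (@is_derive_mult R_AbsRing); [eassumption..|exact Rmult_comm]).
    + cbn. unfold Re, Im. ring.
Qed.

Lemma is_derive_RC_Cmult (c : C) f t l :
  is_derive_RC f t l -> is_derive_RC (fun u => c * f u)%C t (c * l)%C.
Proof. exact (is_derive_linear f _ t l (is_linear_Cmult c)). Qed.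

Lemma is_derive_RC_RtoC (f : R -> R) t l :
  is_derive f t l -> is_derive_RC (fun u => RtoC (f u)) t (RtoC l).
Proof.
  intros H. apply is_derive_RC_pair. split; [exact H|].
  exact (@is_derive_const R_AbsRing R_NormedModule 0 t).
Qed.

Lemma is_derive_RC_id t : is_derive_RC RtoC t (RtoC 1).
Proof. apply (is_derive_RC_RtoC (fun u => u)), (@is_derive_id R_AbsRing). Qed.

Lemma is_derive_RC_continuous f t l : is_derive_RC f t l -> continuous_RC f t.
Proof. intros H. apply (@ex_derive_continuous R_AbsRing C_R_NormedModule). now exists l. Qed.

Lemma continuous_RC_pair (f : R -> C) t :
  continuous_RC f t <->
  continuous (fun u => Re (f u)) t /\ continuous (fun u => Im (f u)) t.
Proof.
  split.
  - intros H. split; [exact (continuous_comp f Re t H (linear_cont _ _ is_linear_Re))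
                     |exact (continuous_comp f Im t H (linear_cont _ _ is_linear_Im))].
  - intros [HRe HIm].
    apply (continuous_ext (fun u => plus (scal (Re (f u)) (RtoC 1 : C_R_NormedModule))
                                         (scal (Im (f u)) (Ci : C_R_NormedModule)))).
    + intros u. rewrite !scal_R_Cmult. apply Re_Im_decomposition.
    + apply (@continuous_plus R_UniformSpace R_AbsRing C_R_NormedModule);
        apply (@continuous_scal_l R_UniformSpace R_AbsRing C_R_NormedModule); assumption.
Qed.

Lemma continuous_RC_const (c : C) t : continuous_RC (fun _ => c) t.
Proof. apply continuous_const. Qed.

Lemma continuous_RC_minus f g t :
  continuous_RC f t -> continuous_RC g t -> continuous_RC (fun u => f u - g u)%C t.
Proof. apply (@continuous_minus R_UniformSpace R_AbsRing C_R_NormedModule). Qed.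

Lemma continuous_RC_plus f g t :
  continuous_RC f t -> continuous_RC g t -> continuous_RC (fun u => f u + g u)%C t.
Proof. apply (@continuous_plus R_UniformSpace R_AbsRing C_R_NormedModule). Qed.

Lemma continuous_RC_mult f g t :
  continuous_RC f t -> continuous_RC g t -> continuous_RC (fun u => f u * g u)%C t.
Proof.
  rewrite !continuous_RC_pair. intros [fRe fIm] [gRe gIm]. split.
  - apply (@continuous_minus _ R_AbsRing R_NormedModule);
      apply (@continuous_mult _ R_AbsRing); assumption.
  - apply (@continuous_plus _ R_AbsRing R_NormedModule);
      apply (@continuous_mult _ R_AbsRing); assumption.
Qed.

Lemma continuous_RC_bounded (g : R -> C) a b :
  a <= b -> (forall t, a <= t <= b -> continuous_RC g t) ->
  exists M, forall t, a <= t <= b -> Cmod (g t) <= M.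
Proof.
  intros Hab Hg.
  destruct (continuity_ab_maj (fun t => Rabs (Re (g t)) + Rabs (Im (g t))) a b Hab) as [m [Hm _]].
  - intros t Ht. apply continuity_pt_filterlim.
    destruct (proj1 (continuous_RC_pair g t) (Hg t Ht)) as [HRe HIm].
    apply (@continuous_plus R_UniformSpace R_AbsRing R_NormedModule
             (fun t => Rabs (Re (g t))) (fun t => Rabs (Im (g t)))).
    + exact (continuous_comp _ Rabs t HRe (continuous_Rabs _)).
    + exact (continuous_comp _ Rabs t HIm (continuous_Rabs _)).
  - eexists. intros t Ht. eapply Rle_trans; [apply Cmod_le_Rabs_plus|exact (Hm t Ht)].
Qed.

Lemma is_derive_C_eps (f : C -> C) (z l : C) :
  is_derive_C f z l <->
  (forall e, 0 < e -> exists d, 0 < d /\ forall y, Cmod (y - z)%C < d ->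
    Cmod (f y - f z - l * (y - z))%C <= e * Cmod (y - z)%C).
Proof.
  assert (E : forall y, (f y - f z - l * (y - z) = f y - f z - (y - z) * l)%C)
    by (intros; ring).
  split.
  - intros [_ H] e He.
    destruct (H z (fun P HP => HP) (mkposreal e He)) as [d Hd].
    exists d. split; [apply cond_pos|]. intros y Hy. rewrite E. exact (Hd y Hy).
  - intros H. split; [apply is_linear_scal_l|]. intros x Hx [e He].
    assert (Ex : z = x)
      by exact (is_filter_lim_locally_unique (V := AbsRing_NormedModule C_AbsRing) z x Hx).
    subst x. destruct (H e He) as [d [Hd Hdy]].
    apply (locally_C_intro z d); [assumption|]. intros y Hy. simpl.
    specialize (Hdy y Hy). rewrite E in Hdy. exact Hdy.
Qed.

Lemma is_derive_C_filterdiff f z l :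
  is_derive_C f z l ->
  @filterdiff R_AbsRing C_R_NormedModule C_R_NormedModule f
    (locally (T := C_R_NormedModule) z) (fun y => l * y)%C.
Proof.
  rewrite is_derive_C_eps. intros H. split; [apply is_linear_Cmult|].
  intros x Hx [e He].
  assert (Ex : z = x) by exact (is_filter_lim_locally_unique (V := C_R_NormedModule) z x Hx).
  subst x. apply locally_C. destruct (H e He) as [d [Hd Hdy]].
  apply (locally_C_intro z d); [assumption|]. intros y Hy. rewrite !C_R_norm. exact (Hdy y Hy).
Qed.

Lemma is_derive_RC_comp (k : C -> C) g t l dg :
  is_derive_C k (g t) l -> is_derive_RC g t dg ->
  is_derive_RC (fun u => k (g u)) t (l * dg)%C.
Proof.
  intros Hk Hg.
  eapply filterdiff_ext_lin.
  - apply (filterdiff_comp' (U := R_NormedModule) (V := C_R_NormedModule)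
             (W := C_R_NormedModule) g k t _ _ Hg (is_derive_C_filterdiff k (g t) l Hk)).
  - intros y. cbv beta. rewrite !scal_R_Cmult, !Cmult_assoc, (Cmult_comm l). reflexivity.
Qed.

Lemma is_derive_C_continuous f z l : is_derive_C f z l -> continuous_C f z.
Proof. intros H. apply (@ex_derive_continuous C_AbsRing C_NormedModule). now exists l. Qed.

Lemma continuous_RC_comp (k : C -> C) g t :
  continuous_C k (g t) -> continuous_RC g t -> continuous_RC (fun u => k (g u)) t.
Proof.
  intros Hk Hg P HP. apply (Hg (fun y => P (k y))). apply locally_C. exact (Hk P HP).
Qed.

Lemma is_derive_C_ext_ball (f g : C -> C) (z l : C) (r : R) :
  0 < r -> (forall y, Cmod (y - z)%C < r -> f y = g y) -> is_derive_C f z l -> is_derive_C g z l.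
Proof. intros Hr H. apply is_derive_ext_loc, (locally_C_intro z r); assumption. Qed.

Lemma is_derive_C_affine (a b z : C) : is_derive_C (fun y => a + b * y)%C z b.
Proof.
  apply is_derive_C_eps. intros e He. exists 1. split; [lra|]. intros y _.
  replace (a + b * y - (a + b * z) - b * (y - z))%C with (RtoC 0) by ring.
  rewrite Cmod_0. apply Rmult_le_pos; [lra|apply Cmod_ge_0].
Qed.

(* [C_NormedModule] and [C_AbsRing] as a module over itself carry different, though
   equivalent, uniform structures. *)
Lemma is_derive_C_AbsRing (f : C -> C) (z l : C) :
  is_derive_C f z l <-> @is_derive C_AbsRing (AbsRing_NormedModule C_AbsRing) f z l.
Proof. split; intros [_ H]; (split; [apply is_linear_scal_l|exact H]). Qed.

Lemma is_derive_C_mult f g z lf lg :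
  is_derive_C f z lf -> is_derive_C g z lg ->
  is_derive_C (fun y => f y * g y)%C z (lf * g z + f z * lg)%C.
Proof.
  rewrite !is_derive_C_AbsRing. intros Hf Hg.
  exact (@is_derive_mult C_AbsRing f g z lf lg Hf Hg Cmult_comm).
Qed.

Lemma is_derive_C_Cmult (c : C) f z l :
  is_derive_C f z l -> is_derive_C (fun y => c * f y)%C z (c * l)%C.
Proof.
  intros Hf. replace (c * l)%C with (0 * f z + c * l)%C by ring.
  exact (is_derive_C_mult _ f z _ l (@is_derive_const C_AbsRing C_NormedModule c z) Hf).
Qed.

Lemma is_derive_C_comp f g z lf lg :
  is_derive_C f (g z) lf -> is_derive_C g z lg ->
  is_derive_C (fun y => f (g y)) z (lf * lg)%C.
Proof.
  rewrite (is_derive_C_AbsRing g), Cmult_comm.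
  exact (@is_derive_comp C_AbsRing C_NormedModule f g z lf lg).
Qed.

Lemma is_derive_C_quadratic (f : C -> C) (z l : C) (M d : R) :
  0 < d ->
  (forall y, Cmod (y - z)%C < d -> Cmod (f y - f z - l * (y - z))%C <= M * Cmod (y - z)%C ^ 2) ->
  is_derive_C f z l.
Proof.
  intros Hd H. apply is_derive_C_eps. intros e He.
  pose proof (Rabs_pos M) as HM. pose proof (Rle_abs M) as HM'.
  assert (He' : 0 < e / (Rabs M + 1)) by (apply Rdiv_lt_0_compat; lra).
  exists (Rmin d (e / (Rabs M + 1))). split; [now apply Rmin_pos|].
  intros y Hy. pose proof (Rlt_le_trans _ _ _ Hy (Rmin_l _ _)) as Hyd.
  pose proof (Rlt_le_trans _ _ _ Hy (Rmin_r _ _)) as Hye.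
  eapply Rle_trans; [apply (H y Hyd)|].
  pose proof (Cmod_ge_0 (y - z)%C) as P. set (q := Cmod (y - z)%C) in *.
  apply Rle_trans with ((Rabs M + 1) * q * q); [nra|].
  apply Rmult_le_compat_r; [assumption|].
  apply Rlt_div_r in Hye; lra.
Qed.

Lemma is_derive_Cinv (z : C) : z <> 0 -> is_derive_C Cinv z (- / (z * z))%C.
Proof.
  intros Hz. pose proof (proj1 (Cmod_gt_0 z) Hz) as P.
  apply (is_derive_C_quadratic Cinv z _ (2 / Cmod z ^ 3) (Cmod z / 2)); [lra|].
  intros y Hy.
  assert (Y : Cmod z / 2 < Cmod y).
  { pose proof (Cmod_triangle_rev z (y - z)) as T.
    replace (z + (y - z))%C with y in T by ring. lra. }
  assert (Hy0 : y <> 0) by (apply Cmod_gt_0; lra).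
  replace (/ y - / z - - / (z * z) * (y - z))%C with ((y - z) * (y - z) / (z * z) / y)%C
    by (field; split; assumption).
  rewrite !Cmod_div, !Cmod_mult by (try apply Cmult_neq_0; assumption).
  replace (2 / Cmod z ^ 3 * Cmod (y - z)%C ^ 2)
    with (Cmod (y - z)%C * Cmod (y - z)%C / (Cmod z * Cmod z) * / (Cmod z / 2)) by (field; lra).
  apply Rmult_le_compat_l; [|apply Rinv_le_contravar; lra].
  apply Rdiv_le_0_compat; [|nra]. pose proof (Cmod_ge_0 (y - z)%C). nra.
Qed.

Lemma continuous_RC_inv (g : R -> C) t :
  g t <> 0 -> continuous_RC g t -> continuous_RC (fun u => / g u)%C t.
Proof.
  intros H. apply (continuous_RC_comp Cinv g).
  exact (is_derive_C_continuous _ _ _ (is_derive_Cinv _ H)).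
Qed.

Lemma continuous_RC_pow (g : R -> C) t n :
  continuous_RC g t -> continuous_RC (fun u => g u ^ n)%C t.
Proof.
  intros H. induction n as [|n IH]; [apply continuous_RC_const|].
  now apply (continuous_RC_mult g (fun u => g u ^ n)%C).
Qed.

(* Rotate so that the increment is a positive real, then apply the real mean value theorem. *)
Lemma Cmod_increment_le (g dg : R -> C) (H dH : R -> R) (a b : R) :
  a <= b ->
  (forall t, a <= t <= b -> is_derive_RC g t (dg t)) ->
  (forall t, a <= t <= b -> is_derive H t (dH t)) ->
  (forall t, a <= t <= b -> Cmod (dg t) <= dH t) ->
  Cmod (g b - g a)%C <= H b - H a.
Proof.
  intros [Hab|<-] Hg HH Hle.
  2: { replace (g a - g a)%C with (RtoC 0) by ring. rewrite Cmod_0. lra. }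
  destruct (Cmod_eq_Re_rotation (g b - g a)%C) as [w [Hw Hrot]].
  destruct (MVT_cor2 (fun t => H t - Re (w * g t)%C) (fun t => dH t - Re (w * dg t)%C) a b Hab)
    as [c [E Hc]].
  - intros t Ht. apply is_derive_Reals.
    apply (@is_derive_minus R_AbsRing R_NormedModule); [now apply HH|].
    apply (is_derive_linear (fun u => w * g u)%C _ t _ is_linear_Re).
    apply is_derive_RC_Cmult. now apply Hg.
  - assert (Hdc : Re (w * dg c)%C <= dH c).
    { eapply Rle_trans; [apply Re_le_Cmod|]. rewrite Cmod_mult, Hw, Rmult_1_l. apply Hle. lra. }
    rewrite <- Hrot.
    replace (Re (w * (g b - g a))%C) with (Re (w * g b)%C - Re (w * g a)%C) by (simpl; ring).
    assert (0 <= (dH c - Re (w * dg c)%C) * (b - a)) by (apply Rmult_le_pos; lra). lra.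
Qed.

Lemma Cmod_increment_le_Lipschitz g dg a b L u v :
  (forall t, a <= t <= b -> is_derive_RC g t (dg t)) ->
  (forall t, a <= t <= b -> Cmod (dg t) <= L) ->
  a <= u <= b -> a <= v <= b -> Cmod (g v - g u)%C <= L * Rabs (v - u).
Proof.
  intros Hg HL.
  assert (Hle : forall u v, a <= u -> u <= v -> v <= b -> Cmod (g v - g u)%C <= L * v - L * u).
  { intros x y Hx Hxy Hy. apply (Cmod_increment_le g dg (fun t => L * t) (fun _ => L));
      [assumption|..]; intros t Ht; [apply Hg; lra| |apply HL; lra]. auto_derive; [exact I|ring]. }
  intros Hu Hv. destruct (Rle_dec u v) as [Huv|Huv].
  - rewrite Rabs_pos_eq by lra. specialize (Hle u v). lra.
  - rewrite Rabs_left1, Cmod_minus_sym by lra. specialize (Hle v u). lra.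
Qed.

Lemma is_derive_C_of_segments (f df : C -> C) (z : C) (r : R) :
  0 < r -> continuous_C df z ->
  (forall y t, Cmod (y - z)%C < r -> 0 <= t <= 1 ->
     is_derive_RC (fun u => f (z + RtoC u * (y - z)))%C t
       (df (z + RtoC t * (y - z)) * (y - z))%C) ->
  is_derive_C f z (df z).
Proof.
  intros Hr Hdf Hseg. apply is_derive_C_eps. intros e He.
  destruct (proj1 (filterlim_C_eps _ df (df z)) Hdf e He) as [d Hd].
  exists (Rmin r d). split; [apply Rmin_pos; [assumption|apply cond_pos]|].
  intros y Hy. pose proof (Rlt_le_trans _ _ _ Hy (Rmin_l _ _)) as Hyr.
  pose proof (Rlt_le_trans _ _ _ Hy (Rmin_r _ _)) as Hyd. set (v := (y - z)%C) in *.
  pose proof (Cmod_increment_le_Lipschitz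
    (fun t => f (z + RtoC t * v) - df z * (RtoC t * v))%C
    (fun t => df (z + RtoC t * v) * v - df z * v)%C 0 1 (e * Cmod v) 0 1) as H.
  cbv beta in H. rewrite Cmult_0_l, Cmult_1_l, Cmult_0_r, Cplus_0_r in H.
  replace (z + v)%C with y in H by (unfold v; ring).
  replace (f y - df z * v - (f z - 0))%C with (f y - f z - df z * v)%C in H by ring.
  rewrite Rminus_0_r, Rabs_R1, Rmult_1_r in H. apply H; [| |lra|lra].
  - intros t Ht. apply is_derive_RC_minus; [now apply Hseg|].
    apply is_derive_RC_Cmult. evar_last.
    + apply is_derive_RC_mult; [apply is_derive_RC_id|apply is_derive_RC_const].
    + change ((1 * v + RtoC t * 0)%C = v). ring.
  - intros t Ht.
    replace (df (z + RtoC t * v) * v - df z * v)%C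
      with ((df (z + RtoC t * v) - df z) * v)%C by ring.
    rewrite Cmod_mult. apply Rmult_le_compat_r; [apply Cmod_ge_0|]. apply Rlt_le, Hd.
    change (Cmod (z + RtoC t * v - z)%C < d).
    replace (z + RtoC t * v - z)%C with (RtoC t * v)%C by ring.
    rewrite Cmod_mult, Cmod_R, Rabs_pos_eq by lra. pose proof (Cmod_ge_0 v). nra.
Qed.

Lemma Riemann_sum_linear {U V : NormedModule R_AbsRing} (L : U -> V) (f : R -> U) ptd :
  is_linear L -> Riemann_sum (fun t => L (f t)) ptd = L (Riemann_sum f ptd).
Proof.
  intros HL.
  apply (SF_cons_ind (fun s => Riemann_sum (fun t => L (f t)) s = L (Riemann_sum f s))).
  - intros x. symmetry. apply (linear_zero L HL).
  - intros h s IH. rewrite !Riemann_sum_cons, (linear_plus L HL), IH.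
    f_equal. symmetry. apply (linear_scal L HL).
Qed.

Lemma is_RInt_linear {U V : NormedModule R_AbsRing} (L : U -> V) (f : R -> U) a b l :
  is_linear L -> is_RInt f a b l -> is_RInt (fun t => L (f t)) a b (L l).
Proof.
  intros HL Hf. unfold is_RInt.
  eapply filterlim_ext; [|exact (filterlim_comp _ _ _ _ L _ _ _ Hf (linear_cont L l HL))].
  intros ptd. cbv beta. rewrite (Riemann_sum_linear L f ptd HL). apply (linear_scal L HL).
Qed.

Lemma is_RInt_C_Cmult (c : C) f a b l :
  is_RInt_C f a b l -> is_RInt_C (fun t => c * f t)%C a b (c * l)%C.
Proof. exact (is_RInt_linear _ f a b l (is_linear_Cmult c)). Qed.

Lemma is_RInt_C_minus f g a b l m :
  is_RInt_C f a b l -> is_RInt_C g a b m -> is_RInt_C (fun t => f t - g t)%C a b (l - m)%C.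
Proof. apply (@is_RInt_minus C_R_NormedModule). Qed.

Lemma is_RInt_C_const (c : C) a b : is_RInt_C (fun _ => c) a b (RtoC (b - a) * c)%C.
Proof. rewrite <- scal_R_Cmult. apply (@is_RInt_const C_R_NormedModule). Qed.

Lemma ex_RInt_C_continuous f a b :
  (forall t, Rmin a b <= t <= Rmax a b -> continuous_RC f t) -> ex_RInt_C f a b.
Proof. apply (@ex_RInt_continuous C_R_CompleteNormedModule). Qed.

Lemma RInt_C_correct f a b : ex_RInt_C f a b -> is_RInt_C f a b (RInt_C f a b).
Proof. apply (@RInt_correct C_R_CompleteNormedModule). Qed.

Lemma Cmod_is_RInt_le f g a b l m :
  a <= b -> (forall t, a <= t <= b -> Cmod (f t) <= g t) ->
  is_RInt_C f a b l -> is_RInt g a b m -> Cmod l <= m.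
Proof.
  intros Hab H Hl Hm. rewrite <- C_R_norm.
  apply (@norm_RInt_le C_R_NormedModule f g a b l m Hab); [|assumption..].
  intros t Ht. rewrite C_R_norm. now apply H.
Qed.

Lemma Cmod_is_RInt_le_const f M a b l :
  a <= b -> (forall t, a <= t <= b -> Cmod (f t) <= M) ->
  is_RInt_C f a b l -> Cmod l <= (b - a) * M.
Proof.
  intros Hab H Hl. apply (Cmod_is_RInt_le f (fun _ => M) a b l); [assumption..|].
  apply (@is_RInt_const R_NormedModule).
Qed.

(** * Goursat's theorem *)

Lemma is_lim_seq_dyadic (w : R) : is_lim_seq (fun n => w / 2 ^ n) 0.
Proof.
  apply (is_lim_seq_ext (fun n => w * (/ 2) ^ n)).
  - intros n. now rewrite pow_inv.
  - replace (Finite 0) with (Rbar_mult w 0) by (simpl; f_equal; ring).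
    apply is_lim_seq_scal_l, is_lim_seq_geom. rewrite Rabs_pos_eq; lra.
Qed.

Lemma dyadic_nonneg (w : R) (n : nat) : 0 <= w -> 0 <= w / 2 ^ n.
Proof. intros Hw. apply Rdiv_le_0_compat; [assumption|apply pow_lt; lra]. Qed.

Lemma dyadic_half (w : R) (n : nat) : w / 2 ^ S n = w / 2 ^ n / 2.
Proof. simpl. field. apply pow_nonzero; lra. Qed.

Lemma nested_dyadic_intervals (u : nat -> R) (w : R) :
  (forall n, u n <= u (S n) /\ u (S n) + w / 2 ^ S n <= u n + w / 2 ^ n) ->
  exists l, forall n, u n <= l <= u n + w / 2 ^ n.
Proof.
  intros H.
  destruct (ex_lim_seq_adj u (fun n => u n + w / 2 ^ n)) as [[l Hl] [[m Hm] E]].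
  - intros n. apply H.
  - intros n. apply H.
  - apply (is_lim_seq_ext (fun n => w / 2 ^ n)); [intros; ring|apply is_lim_seq_dyadic].
  - rewrite (is_lim_seq_unique _ _ Hl), (is_lim_seq_unique _ _ Hm) in E.
    injection E as <-. exists l. intros n. split.
    + apply (is_lim_seq_incr_compare u l Hl). intros k. apply H.
    + apply (is_lim_seq_decr_compare _ l Hm). intros k. apply H.
Qed.

(* Bisection: a property inherited from the four quarters of a cell and true for all small cells
   around each point holds for the whole rectangle. [P n x y] speaks of the cell of generation [n]
   with lower left corner [(x, y)]. *)
Lemma dyadic_cell_induction (a c w v : R) (P : nat -> R -> R -> Prop) :
  0 <= w -> 0 <= v ->
  (forall n x y,
     P (S n) x y -> P (S n) (x + w / 2 ^ S n) y -> P (S n) x (y + v / 2 ^ S n) ->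
     P (S n) (x + w / 2 ^ S n) (y + v / 2 ^ S n) -> P n x y) ->
  (forall x y, a <= x <= a + w -> c <= y <= c + v ->
     exists N, forall n x' y', (N <= n)%nat ->
       x' <= x <= x' + w / 2 ^ n -> y' <= y <= y' + v / 2 ^ n -> P n x' y') ->
  P O a c.
Proof.
  intros Hw Hv Hquarters Hlocal. apply NNPP. intros Hbad.
  set (sub := fun n (p q : R * R) => ~ P (S n) (fst q) (snd q) /\
    (fst p <= fst q /\ fst q + w / 2 ^ S n <= fst p + w / 2 ^ n) /\
    (snd p <= snd q /\ snd q + v / 2 ^ S n <= snd p + v / 2 ^ n)).
  set (cell := fix cell n := match n with
    | O => (a, c)
    | S m => epsilon (inhabits (a, c)) (sub m (cell m))
    end).
  assert (Hsub : forall n p, ~ P n (fst p) (snd p) -> exists q, sub n p q).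
  { intros n [x y] HP. simpl in HP. pose proof (dyadic_nonneg w n Hw).
    pose proof (dyadic_nonneg v n Hv). unfold sub. cbn [fst snd].
    apply NNPP. intros Hno. apply HP, Hquarters; apply NNPP; intros Hq; apply Hno;
      eexists (_, _); (split; [exact Hq|]); cbn [fst snd]; rewrite !dyadic_half; lra. }
  assert (Hcell : forall n, ~ P n (fst (cell n)) (snd (cell n)) /\ sub n (cell n) (cell (S n))).
  { induction n as [|n [_ [IH _]]]; (split; [assumption|]);
      apply epsilon_spec; now apply Hsub. }
  destruct (nested_dyadic_intervals (fun n => fst (cell n)) w) as [x Hx]; [intros n; apply Hcell|].
  destruct (nested_dyadic_intervals (fun n => snd (cell n)) v) as [y Hy]; [intros n; apply Hcell|].
  destruct (Hlocal x y) as [N HN].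
  - specialize (Hx O). simpl in Hx. lra.
  - specialize (Hy O). simpl in Hy. lra.
  - now apply (proj1 (Hcell N)), HN.
Qed.

Definition rect_integral (X Y : R -> R -> C) (x1 x2 y1 y2 : R) : C :=
  (RInt_C (fun x => X x y1) x1 x2 + RInt_C (fun y => Y x2 y) y1 y2
   - RInt_C (fun x => X x y2) x1 x2 - RInt_C (fun y => Y x1 y) y1 y2)%C.

Lemma RInt_C_Chasles f (x1 x2 x3 : R) :
  x1 <= x2 <= x3 -> ex_RInt_C f x1 x3 ->
  RInt_C f x1 x3 = (RInt_C f x1 x2 + RInt_C f x2 x3)%C.
Proof.
  intros Hx Hf. symmetry. apply (@RInt_Chasles C_R_CompleteNormedModule).
  - exact (@ex_RInt_Chasles_1 C_R_CompleteNormedModule f x1 x2 x3 Hx Hf).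
  - exact (@ex_RInt_Chasles_2 C_R_CompleteNormedModule f x1 x2 x3 Hx Hf).
Qed.

Lemma rect_integral_quarters X Y (x1 x2 x3 y1 y2 y3 : R) :
  x1 <= x2 <= x3 -> y1 <= y2 <= y3 ->
  (forall y, y1 <= y <= y3 -> ex_RInt_C (fun x => X x y) x1 x3) ->
  (forall x, x1 <= x <= x3 -> ex_RInt_C (fun y => Y x y) y1 y3) ->
  rect_integral X Y x1 x3 y1 y3 =
  (rect_integral X Y x1 x2 y1 y2 + rect_integral X Y x2 x3 y1 y2
   + (rect_integral X Y x1 x2 y2 y3 + rect_integral X Y x2 x3 y2 y3))%C.
Proof.
  intros Hx Hy HX HY. unfold rect_integral.
  rewrite (RInt_C_Chasles (fun x => X x y1) x1 x2 x3), (RInt_C_Chasles (fun x => X x y3) x1 x2 x3),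
    (RInt_C_Chasles (fun y => Y x1 y) y1 y2 y3), (RInt_C_Chasles (fun y => Y x3 y) y1 y2 y3)
    by (assumption || (apply HX; lra) || (apply HY; lra)).
  ring.
Qed.

Lemma Cmod_plus4_le (z1 z2 z3 z4 : C) (q : R) :
  Cmod z1 <= q -> Cmod z2 <= q -> Cmod z3 <= q -> Cmod z4 <= q ->
  Cmod (z1 + z2 + (z3 + z4))%C <= 4 * q.
Proof.
  intros. pose proof (Cmod_triangle (z1 + z2) (z3 + z4)).
  pose proof (Cmod_triangle z1 z2). pose proof (Cmod_triangle z3 z4). lra.
Qed.

Lemma Cmod_le_eps_eq_0 (z : C) (K : R) :
  0 <= K -> (forall e, 0 < e -> Cmod z <= e * K) -> z = 0.
Proof.
  intros HK H. apply Cmod_eq_0, Rle_antisym; [|apply Cmod_ge_0].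
  apply le_epsilon. intros e He. rewrite Rplus_0_l.
  assert (He' : 0 < e / (K + 1)) by (apply Rdiv_lt_0_compat; lra).
  eapply Rle_trans; [apply (H _ He')|].
  replace e with (e / (K + 1) * (K + 1)) at 2 by (field; lra).
  apply Rmult_le_compat_l; lra.
Qed.

Section SmallRectangles.

Variables (X Y : R -> R -> C) (a b c d : R).
Hypothesis Hab : a <= b.
Hypothesis Hcd : c <= d.
Hypothesis X_integrable : forall x1 x2 y,
  a <= x1 -> x1 <= x2 -> x2 <= b -> c <= y <= d -> ex_RInt_C (fun x => X x y) x1 x2.
Hypothesis Y_integrable : forall x y1 y2,
  a <= x <= b -> c <= y1 -> y1 <= y2 -> y2 <= d -> ex_RInt_C (fun y => Y x y) y1 y2.
Hypothesis rect_integral_small : forall x y e, a <= x <= b -> c <= y <= d -> 0 < e ->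
  exists r, 0 < r /\ forall x1 x2 y1 y2,
    a <= x1 <= x -> x <= x2 <= b -> c <= y1 <= y -> y <= y2 <= d ->
    (x2 - x1) + (y2 - y1) < r ->
    Cmod (rect_integral X Y x1 x2 y1 y2) <= e * ((x2 - x1) + (y2 - y1)) ^ 2.

Let w := b - a.
Let v := d - c.

Let small_cell (e : R) (n : nat) (x y : R) : Prop :=
  a <= x -> x + w / 2 ^ n <= b -> c <= y -> y + v / 2 ^ n <= d ->
  Cmod (rect_integral X Y x (x + w / 2 ^ n) y (y + v / 2 ^ n)) <= e * (w + v) ^ 2 / 4 ^ n.

Lemma small_cell_quarters e n x y :
  small_cell e (S n) x y -> small_cell e (S n) (x + w / 2 ^ S n) y ->
  small_cell e (S n) x (y + v / 2 ^ S n) ->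
  small_cell e (S n) (x + w / 2 ^ S n) (y + v / 2 ^ S n) -> small_cell e n x y.
Proof.
  intros P1 P2 P3 P4 Hx1 Hx2 Hy1 Hy2. unfold small_cell in *. rewrite !dyadic_half in *.
  pose proof (dyadic_nonneg w n ltac:(unfold w; lra)).
  pose proof (dyadic_nonneg v n ltac:(unfold v; lra)).
  replace (e * (w + v) ^ 2 / 4 ^ n) with (4 * (e * (w + v) ^ 2 / 4 ^ S n))
    by (simpl; field; apply pow_nonzero; lra).
  replace (x + w / 2 ^ n) with (x + w / 2 ^ n / 2 + w / 2 ^ n / 2) by lra.
  replace (y + v / 2 ^ n) with (y + v / 2 ^ n / 2 + v / 2 ^ n / 2) by lra.
  rewrite (rect_integral_quarters X Y x (x + w / 2 ^ n / 2) _ y (y + v / 2 ^ n / 2) _).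
  - apply Cmod_plus4_le; [apply P1|apply P2|apply P3|apply P4]; lra.
  - lra.
  - lra.
  - intros. apply X_integrable; lra.
  - intros. apply Y_integrable; lra.
Qed.

Lemma small_cell_local e x y :
  0 < e -> a <= x <= a + w -> c <= y <= c + v ->
  exists N, forall n x' y', (N <= n)%nat ->
    x' <= x <= x' + w / 2 ^ n -> y' <= y <= y' + v / 2 ^ n -> small_cell e n x' y'.
Proof.
  intros He Hx Hy.
  destruct (rect_integral_small x y e) as [r [Hr Hsmall]]; [unfold w, v in *; lra..|].
  destruct (proj2 (is_lim_seq_spec _ _) (is_lim_seq_dyadic (w + v)) (mkposreal r Hr)) as [N HN].
  exists N. intros n x' y' Hn Hx' Hy' I1 I2 I3 I4.
  specialize (HN n Hn). simpl in HN. rewrite Rminus_0_r in HN.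
  assert (Esum : x' + w / 2 ^ n - x' + (y' + v / 2 ^ n - y') = (w + v) / 2 ^ n)
    by (field; apply pow_nonzero; lra).
  eapply Rle_trans.
  - apply Hsmall; [lra..|]. rewrite Esum. eapply Rle_lt_trans; [apply Rle_abs|exact HN].
  - rewrite Esum. right. replace (4 ^ n) with (2 ^ n * 2 ^ n)
      by (rewrite <- Rpow_mult_distr; f_equal; ring).
    field. apply pow_nonzero; lra.
Qed.

Lemma rect_integral_vanishes : rect_integral X Y a b c d = 0.
Proof.
  apply (Cmod_le_eps_eq_0 _ ((w + v) ^ 2)); [apply pow2_ge_0|]. intros e He.
  assert (H : small_cell e 0 a c).
  { apply (dyadic_cell_induction a c w v); [unfold w; lra|unfold v; lra| |].
    - apply small_cell_quarters.
    - intros x y. now apply small_cell_local. }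
  unfold small_cell in H. simpl in H. rewrite !Rdiv_1_r in H.
  replace (a + w) with b in H by (unfold w; ring).
  replace (c + v) with d in H by (unfold v; ring).
  apply H; lra.
Qed.

End SmallRectangles.

(* The boundary integral of an exact form vanishes. *)
Lemma rect_integral_near_exact X Y (Q : R -> R -> C) (x1 x2 y1 y2 ex ey : R) :
  (forall y, y = y1 \/ y = y2 ->
     Cmod (RInt_C (fun x => X x y) x1 x2 - (Q x2 y - Q x1 y))%C <= ex) ->
  (forall x, x = x1 \/ x = x2 ->
     Cmod (RInt_C (fun y => Y x y) y1 y2 - (Q x y2 - Q x y1))%C <= ey) ->
  Cmod (rect_integral X Y x1 x2 y1 y2) <= 2 * (ex + ey).
Proof.
  intros HX HY. unfold rect_integral.
  pose proof (HX y1 (or_introl eq_refl)) as Bottom. pose proof (HX y2 (or_intror eq_refl)) as Top.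
  pose proof (HY x1 (or_introl eq_refl)) as Left. pose proof (HY x2 (or_intror eq_refl)) as Right.
  set (bottom := RInt_C (fun x => X x y1) x1 x2) in *.
  set (top := RInt_C (fun x => X x y2) x1 x2) in *.
  set (left := RInt_C (fun y => Y x1 y) y1 y2) in *.
  set (right := RInt_C (fun y => Y x2 y) y1 y2) in *.
  replace (bottom + right - top - left)%C with
    ((bottom - (Q x2 y1 - Q x1 y1)) + (right - (Q x2 y2 - Q x2 y1))
     - (top - (Q x2 y2 - Q x1 y2)) - (left - (Q x1 y2 - Q x1 y1)))%C by ring.
  eapply Rle_trans; [apply Cmod_triangle|].
  eapply Rle_trans; [apply Rplus_le_compat_r, Cmod_triangle|].
  eapply Rle_trans; [apply Rplus_le_compat_r, Rplus_le_compat_r, Cmod_triangle|].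
  rewrite !Cmod_opp. lra.
Qed.

(* Along the edge, [k (g t) g'(t)] is compared with the derivative of [q (g t)], where the
   quadratic [q] is a primitive of the linear approximation of [k] at [p]. *)
Lemma edge_integral_approx (k : C -> C) (g dg : R -> C) (a b : R) (p k0 k1 l : C) (e D L : R) :
  a <= b -> 0 <= e ->
  (forall t, a <= t <= b -> is_derive_RC g t (dg t)) ->
  (forall t, a <= t <= b -> continuous_RC dg t) ->
  (forall t, a <= t <= b -> Cmod (dg t) <= L) ->
  (forall t, a <= t <= b -> Cmod (g t - p)%C <= D) ->
  (forall t, a <= t <= b -> Cmod (k (g t) - k0 - k1 * (g t - p))%C <= e * Cmod (g t - p)%C) ->
  is_RInt_C (fun t => k (g t) * dg t)%C a b l ->
  let q (x : C) := (k0 * x + k1 / 2 * ((x - p) * (x - p)))%C in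
  Cmod (l - (q (g b) - q (g a)))%C <= (b - a) * (e * D * L).
Proof.
  intros Hab He Hg Cdg HL HD Hk Hl q.
  assert (Hq : is_RInt_C (fun t => (k0 + k1 * (g t - p)) * dg t)%C a b (q (g b) - q (g a))%C).
  { apply (@is_RInt_derive C_R_CompleteNormedModule (fun t => q (g t)));
      rewrite Rmin_left, Rmax_right by assumption; intros t Ht.
    - assert (Hgp : is_derive_RC (fun u => g u - p)%C t (dg t - 0)%C)
        by (apply is_derive_RC_minus; [now apply Hg|apply is_derive_RC_const]).
      evar_last.
      + apply is_derive_RC_plus; apply is_derive_RC_Cmult; [apply Hg, Ht|].
        apply is_derive_RC_mult; exact Hgp.
      + change ((k0 * dg t + k1 / 2 * ((dg t - 0) * (g t - p) + (g t - p) * (dg t - 0)))%C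
          = ((k0 + k1 * (g t - p)) * dg t)%C).
        field.
    - assert (Cg := is_derive_RC_continuous g t _ (Hg t Ht)).
      apply continuous_RC_mult; [|now apply Cdg].
      apply continuous_RC_plus; [apply continuous_RC_const|].
      apply continuous_RC_mult; [|apply continuous_RC_minus]; try assumption;
        apply continuous_RC_const. }
  apply (Cmod_is_RInt_le_const _ _ a b _ Hab) with (2 := is_RInt_C_minus _ _ _ _ _ _ Hl Hq).
  intros t Ht.
  replace (k (g t) * dg t - (k0 + k1 * (g t - p)) * dg t)%C
    with ((k (g t) - k0 - k1 * (g t - p)) * dg t)%C by ring.
  rewrite Cmod_mult. apply Rmult_le_compat; try apply Cmod_ge_0; [|now apply HL].
  eapply Rle_trans; [now apply Hk|]. apply Rmult_le_compat_l; [assumption|now apply HD].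
Qed.

Section Goursat.

Variables (h hx hy : R -> R -> C) (k : C -> C) (a b c d L : R).
Hypothesis Hab : a <= b.
Hypothesis Hcd : c <= d.
Hypothesis h_derive_x : forall x y, a <= x <= b -> c <= y <= d ->
  is_derive_RC (fun u => h u y) x (hx x y).
Hypothesis h_derive_y : forall x y, a <= x <= b -> c <= y <= d ->
  is_derive_RC (fun u => h x u) y (hy x y).
Hypothesis hx_continuous : forall x y, a <= x <= b -> c <= y <= d ->
  continuous_RC (fun u => hx u y) x.
Hypothesis hy_continuous : forall x y, a <= x <= b -> c <= y <= d ->
  continuous_RC (fun u => hy x u) y.
Hypothesis hx_bound : forall x y, a <= x <= b -> c <= y <= d -> Cmod (hx x y) <= L.
Hypothesis hy_bound : forall x y, a <= x <= b -> c <= y <= d -> Cmod (hy x y) <= L.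
Hypothesis k_holomorphic : forall x y, a <= x <= b -> c <= y <= d -> ex_derive_C k (h x y).

Let X (x y : R) : C := (k (h x y) * hx x y)%C.
Let Y (x y : R) : C := (k (h x y) * hy x y)%C.

Lemma ex_RInt_pullback_x x1 x2 y :
  a <= x1 -> x1 <= x2 -> x2 <= b -> c <= y <= d -> ex_RInt_C (fun x => X x y) x1 x2.
Proof.
  intros H1 H12 H2 Hy. apply ex_RInt_C_continuous.
  rewrite Rmin_left, Rmax_right by assumption. intros x Hx.
  assert (Hx' : a <= x <= b) by lra. destruct (k_holomorphic x y Hx' Hy) as [l Hl].
  apply continuous_RC_mult; [|now apply hx_continuous].
  apply (continuous_RC_comp k (fun u => h u y)).
  - exact (is_derive_C_continuous _ _ _ Hl).
  - exact (is_derive_RC_continuous _ _ _ (h_derive_x x y Hx' Hy)).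
Qed.

Lemma ex_RInt_pullback_y x y1 y2 :
  a <= x <= b -> c <= y1 -> y1 <= y2 -> y2 <= d -> ex_RInt_C (fun y => Y x y) y1 y2.
Proof.
  intros Hx H1 H12 H2. apply ex_RInt_C_continuous.
  rewrite Rmin_left, Rmax_right by assumption. intros y Hy.
  assert (Hy' : c <= y <= d) by lra. destruct (k_holomorphic x y Hx Hy') as [l Hl].
  apply continuous_RC_mult; [|now apply hy_continuous].
  apply (continuous_RC_comp k (fun u => h x u)).
  - exact (is_derive_C_continuous _ _ _ Hl).
  - exact (is_derive_RC_continuous _ _ _ (h_derive_y x y Hx Hy')).
Qed.

Lemma homotopy_Lipschitz x y x' y' :
  a <= x <= b -> c <= y <= d -> a <= x' <= b -> c <= y' <= d ->
  Cmod (h x' y' - h x y)%C <= L * (Rabs (x' - x) + Rabs (y' - y)).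
Proof.
  intros Hx Hy Hx' Hy'.
  replace (h x' y' - h x y)%C with ((h x' y' - h x y') + (h x y' - h x y))%C by ring.
  eapply Rle_trans; [apply Cmod_triangle|]. rewrite Rmult_plus_distr_l. apply Rplus_le_compat.
  - apply (Cmod_increment_le_Lipschitz (fun u => h u y') (fun u => hx u y') a b); try lra;
      intros t Ht; [now apply h_derive_x|now apply hx_bound].
  - apply (Cmod_increment_le_Lipschitz (fun u => h x u) (fun u => hy x u) c d); try lra;
      intros t Ht; [now apply h_derive_y|now apply hy_bound].
Qed.

Lemma pullback_integral_le x1 x2 y1 y2 (p k0 k1 : C) (e D : R) :
  a <= x1 -> x1 <= x2 -> x2 <= b -> c <= y1 -> y1 <= y2 -> y2 <= d -> 0 <= e ->
  (forall x y, x1 <= x <= x2 -> y1 <= y <= y2 -> Cmod (h x y - p)%C <= D) ->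
  (forall x y, x1 <= x <= x2 -> y1 <= y <= y2 ->
     Cmod (k (h x y) - k0 - k1 * (h x y - p))%C <= e * Cmod (h x y - p)%C) ->
  Cmod (rect_integral X Y x1 x2 y1 y2) <= 2 * (e * D * L) * ((x2 - x1) + (y2 - y1)).
Proof.
  intros Hx1 Hx Hx2 Hy1 Hy Hy2 He HD Hk.
  set (q := fun z : C => (k0 * z + k1 / 2 * ((z - p) * (z - p)))%C).
  eapply Rle_trans.
  - apply (rect_integral_near_exact X Y (fun x y => q (h x y)) x1 x2 y1 y2
      ((x2 - x1) * (e * D * L)) ((y2 - y1) * (e * D * L))).
    + intros y Hy'. assert (y1 <= y <= y2) by (destruct Hy' as [-> | ->]; lra).
      apply (edge_integral_approx k (fun x => h x y) (fun x => hx x y)); try lra;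
        try (intros x Hx'; first [apply h_derive_x|apply hx_continuous|apply hx_bound
                                 |apply HD|apply Hk]; lra).
      apply RInt_C_correct, ex_RInt_pullback_x; lra.
    + intros x Hx'. assert (x1 <= x <= x2) by (destruct Hx' as [-> | ->]; lra).
      apply (edge_integral_approx k (fun y => h x y) (fun y => hy x y)); try lra;
        try (intros y Hy'; first [apply h_derive_y|apply hy_continuous|apply hy_bound
                                 |apply HD|apply Hk]; lra).
      apply RInt_C_correct, ex_RInt_pullback_y; lra.
  - right. ring.
Qed.

Lemma pullback_integral_small x y e :
  a <= x <= b -> c <= y <= d -> 0 < e ->
  exists r, 0 < r /\ forall x1 x2 y1 y2,
    a <= x1 <= x -> x <= x2 <= b -> c <= y1 <= y -> y <= y2 <= d ->
    (x2 - x1) + (y2 - y1) < r ->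
    Cmod (rect_integral X Y x1 x2 y1 y2) <= e * ((x2 - x1) + (y2 - y1)) ^ 2.
Proof.
  intros Hx Hy He. destruct (k_holomorphic x y Hx Hy) as [k1 Hk].
  assert (HL : 0 <= L) by (eapply Rle_trans; [apply Cmod_ge_0|exact (hx_bound x y Hx Hy)]).
  set (e' := e / (2 * (L + 1) ^ 2)).
  assert (He' : 0 < e') by (apply Rdiv_lt_0_compat; nra).
  destruct (proj1 (is_derive_C_eps _ _ _) Hk e' He') as [r [Hr Hkr]].
  exists (r / (L + 1)). split; [apply Rdiv_lt_0_compat; lra|].
  intros x1 x2 y1 y2 Hx1 Hx2 Hy1 Hy2 Hsize. apply Rlt_div_r in Hsize; [|lra].
  set (s := (x2 - x1) + (y2 - y1)) in *.
  assert (Hdist : forall u v, x1 <= u <= x2 -> y1 <= v <= y2 -> Cmod (h u v - h x y)%C <= L * s).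
  { intros u v Hu Hv. eapply Rle_trans; [apply homotopy_Lipschitz; lra|].
    apply Rmult_le_compat_l; [assumption|].
    apply Rplus_le_compat; apply Rabs_le; lra. }
  eapply Rle_trans.
  - apply (pullback_integral_le x1 x2 y1 y2 (h x y) (k (h x y)) k1 e' (L * s));
      [lra..|exact Hdist|].
    intros u v Hu Hv. apply Hkr. eapply Rle_lt_trans; [now apply Hdist|]. unfold s in *; nra.
  - fold s. replace e with (2 * (L + 1) ^ 2 * e') by (unfold e'; field; lra).
    replace (2 * (e' * (L * s) * L) * s) with (2 * L ^ 2 * e' * s ^ 2) by ring.
    apply Rmult_le_compat_r; [apply pow2_ge_0|]. apply Rmult_le_compat_r; [lra|]. nra.
Qed.

Theorem goursat : rect_integral X Y a b c d = 0.
Proof.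
  apply rect_integral_vanishes; [assumption..| | |].
  - exact ex_RInt_pullback_x.
  - exact ex_RInt_pullback_y.
  - exact pullback_integral_small.
Qed.

Corollary closed_curve_homotopy :
  (forall x, a <= x <= b -> h x c = h x d /\ hx x c = hx x d) ->
  RInt_C (fun y => k (h a y) * hy a y)%C c d = RInt_C (fun y => k (h b y) * hy b y)%C c d.
Proof.
  intros Hclosed. pose proof goursat as G. unfold rect_integral in G.
  replace (RInt_C (fun x => X x d) a b) with (RInt_C (fun x => X x c) a b) in G.
  - symmetry. apply Ceq_minus. rewrite <- G. unfold Y. ring.
  - apply (@RInt_ext C_R_CompleteNormedModule). rewrite Rmin_left, Rmax_right by assumption.
    intros x Hx. unfold X. now destruct (Hclosed x) as [-> ->]; [lra|].
Qed.

End Goursat.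

(** * Cauchy's formula *)

Definition circ (r t : R) : C := (r * cos t, r * sin t).

Lemma circ_eq (r t : R) : circ r t = (RtoC r * circ 1 t)%C.
Proof. apply injective_projections; simpl; ring. Qed.

Lemma Cmod_circ r t : 0 <= r -> Cmod (circ r t) = r.
Proof.
  intros H. unfold Cmod, circ; cbn [fst snd].
  replace ((r * cos t) ^ 2 + (r * sin t) ^ 2) with (r * r * (Rsqr (sin t) + Rsqr (cos t)))
    by (unfold Rsqr; ring).
  rewrite sin2_cos2, Rmult_1_r. now apply sqrt_square.
Qed.

Lemma circ_neq_0 r t : 0 < r -> circ r t <> 0.
Proof. intros H. apply Cmod_gt_0. rewrite Cmod_circ; lra. Qed.

Lemma circ_2PI r : circ r (2 * PI) = circ r 0.
Proof. unfold circ. now rewrite cos_2PI, sin_2PI, cos_0, sin_0. Qed.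

Lemma is_derive_circ r t : is_derive_RC (circ r) t (Ci * circ r t)%C.
Proof. apply is_derive_RC_pair. split; simpl; auto_derive; try exact I; ring. Qed.

Lemma continuous_circ r t : continuous_RC (circ r) t.
Proof. exact (is_derive_RC_continuous _ _ _ (is_derive_circ r t)). Qed.

Lemma Cmod_circ_sub_ge r c z t : 0 <= r -> r - Cmod (z - c)%C <= Cmod (c + circ r t - z)%C.
Proof.
  intros H. pose proof (Cmod_triangle_rev (circ r t) (c - z)) as K.
  rewrite Cmod_circ, Cmod_minus_sym in K by assumption.
  now replace (circ r t + (c - z))%C with (c + circ r t - z)%C in K by ring.
Qed.

Lemma circ_sub_neq_0 r c z t : Cmod (z - c)%C < r -> (c + circ r t - z)%C <> 0.
Proof.
  intros H. pose proof (Cmod_ge_0 (z - c)%C). apply Cmod_gt_0.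
  pose proof (Cmod_circ_sub_ge r c z t). lra.
Qed.

(* The circle about [c] is contracted to a small circle about [z] through circles whose centre
   moves along the segment from [c] to [z]. *)
Definition moving_circle (c z : C) (r rho s t : R) : C :=
  (z + RtoC s * (c - z) + circ (rho + s * (r - rho)) t)%C.

Section MovingCircle.

Variables (c z : C) (r rho : R).
Hypothesis Hrho : 0 < rho.
Hypothesis Hr : rho + Cmod (z - c)%C <= r.

Lemma moving_circle_radius s : 0 <= s <= 1 -> 0 < rho + s * (r - rho) <= r.
Proof. intros Hs. pose proof (Cmod_ge_0 (z - c)%C). nra. Qed.

Lemma moving_circle_in_disc s t : 0 <= s <= 1 -> Cmod (moving_circle c z r rho s t - c)%C <= r.
Proof.
  intros Hs. pose proof (moving_circle_radius s Hs).
  replace (moving_circle c z r rho s t - c)%C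
    with (RtoC (1 - s) * (z - c) + circ (rho + s * (r - rho)) t)%C
    by (unfold moving_circle; rewrite RtoC_minus; ring).
  eapply Rle_trans; [apply Cmod_triangle|].
  rewrite Cmod_mult, Cmod_R, Rabs_pos_eq, Cmod_circ by lra. nra.
Qed.

Lemma moving_circle_neq s t : 0 <= s <= 1 -> moving_circle c z r rho s t <> z.
Proof.
  intros Hs E. pose proof (moving_circle_radius s Hs).
  pose proof (Cmod_triangle_rev (circ (rho + s * (r - rho)) t) (RtoC s * (c - z))) as T.
  replace (circ (rho + s * (r - rho)) t + RtoC s * (c - z))%C
    with (moving_circle c z r rho s t - z)%C in T by (unfold moving_circle; ring).
  rewrite E, Cmod_mult, Cmod_R, Rabs_pos_eq, Cmod_circ, Cmod_minus_sym in T by lra.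
  replace (z - z)%C with (RtoC 0) in T by ring. rewrite Cmod_0 in T. nra.
Qed.

Lemma circle_homotopy (k : C -> C) :
  (forall y, Cmod (y - c)%C <= r -> y <> z -> ex_derive_C k y) ->
  RInt_C (fun t => k (z + circ rho t) * (Ci * circ rho t))%C 0 (2 * PI)
  = RInt_C (fun t => k (c + circ r t) * (Ci * circ r t))%C 0 (2 * PI).
Proof.
  intros Hk. pose proof PI_RGT_0 as Hpi. pose proof (Cmod_ge_0 (z - c)%C) as Hzc.
  pose proof (closed_curve_homotopy (moving_circle c z r rho)
    (fun s t => (c - z) + circ (r - rho) t)%C
    (fun s t => Ci * circ (rho + s * (r - rho)) t)%C k 0 1 0 (2 * PI) (2 * r)) as H.
  unfold moving_circle in H. rewrite !Rmult_0_l, !Rmult_1_l, !Rplus_0_r in H.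
  replace (rho + (r - rho)) with r in H by ring.
  replace (z + RtoC 0 * (c - z))%C with z in H by ring.
  replace (z + RtoC 1 * (c - z))%C with c in H by ring.
  apply H; clear H; try lra.
  - intros s t Hs _. apply is_derive_RC_pair.
    split; unfold circ; simpl; auto_derive; try exact I; ring.
  - intros s t Hs _. evar_last;
      [apply is_derive_RC_plus; [apply is_derive_RC_const|apply is_derive_circ]|].
    apply Cplus_0_l.
  - intros; apply continuous_RC_const.
  - intros. apply continuous_RC_mult; [apply continuous_RC_const|apply continuous_circ].
  - intros s t Hs _. eapply Rle_trans; [apply Cmod_triangle|].
    rewrite Cmod_minus_sym, Cmod_circ; lra.
  - intros s t Hs _. pose proof (moving_circle_radius s Hs).
    rewrite Cmod_mult, Cmod_Ci, Cmod_circ; lra.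
  - intros s t Hs _. apply Hk; [now apply moving_circle_in_disc|now apply moving_circle_neq].
  - intros s _. now rewrite !circ_2PI.
Qed.

End MovingCircle.

(* [cauchy_integral f c r n z] is [2 pi / n!] times the n-th derivative at [z]; the contour is
   the circle [c + circ r t], with [d zeta = i (circ r t) dt]. *)
Definition cauchy_integral (f : C -> C) (c : C) (r : R) (n : nat) (z : C) : C :=
  RInt_C (fun t => f (c + circ r t) * circ r t * (/ (c + circ r t - z)) ^ S n)%C 0 (2 * PI).

Definition holomorphic_on (U : C -> Prop) (f : C -> C) : Prop :=
  forall z, U z -> ex_derive_C f z.

Lemma continuous_on_circ f c r t :
  0 < r -> holomorphic_on (fun y => Cmod (y - c)%C <= r) f ->
  continuous_RC (fun t => f (c + circ r t))%C t.
Proof.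
  intros Hr Hf. destruct (Hf (c + circ r t)%C) as [l Hl].
  - replace (c + circ r t - c)%C with (circ r t) by ring. rewrite Cmod_circ; lra.
  - apply (continuous_RC_comp f (fun t => c + circ r t)%C).
    + exact (is_derive_C_continuous _ _ _ Hl).
    + apply continuous_RC_plus; [apply continuous_RC_const|apply continuous_circ].
Qed.

Lemma cauchy_integral_correct f c r n z :
  0 < r -> holomorphic_on (fun y => Cmod (y - c)%C <= r) f -> Cmod (z - c)%C < r ->
  is_RInt_C (fun t => f (c + circ r t) * circ r t * (/ (c + circ r t - z)) ^ S n)%C 0 (2 * PI)
    (cauchy_integral f c r n z).
Proof.
  intros Hr Hf Hz. apply RInt_C_correct, ex_RInt_C_continuous. intros t _.
  apply continuous_RC_mult.
  - apply continuous_RC_mult; [now apply continuous_on_circ|apply continuous_circ].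
  - apply continuous_RC_pow, continuous_RC_inv; [now apply circ_sub_neq_0|].
    apply continuous_RC_minus; [|apply continuous_RC_const].
    apply continuous_RC_plus; [apply continuous_RC_const|apply continuous_circ].
Qed.

Lemma ex_derive_C_cauchy_kernel f y z :
  ex_derive_C f y -> y <> z -> ex_derive_C (fun y => f y * / (y - z))%C y.
Proof.
  intros [l Hl] Hyz. eexists. apply is_derive_C_mult; [exact Hl|].
  apply (is_derive_C_comp Cinv (fun u => u - z)%C).
  - now apply is_derive_Cinv, Cminus_eq_contra.
  - apply (is_derive_C_ext_ball (fun u => - z + 1 * u)%C _ _ _ 1);
      [lra|intros; ring|apply is_derive_C_affine].
Qed.

Lemma small_circle_mean f c r z rho :
  0 < rho -> rho + Cmod (z - c)%C <= r -> holomorphic_on (fun y => Cmod (y - c)%C <= r) f ->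
  is_RInt_C (fun t => f (z + circ rho t))%C 0 (2 * PI) (cauchy_integral f c r 0 z).
Proof.
  intros Hrho Hr Hf. pose proof (Cmod_ge_0 (z - c)%C) as Hzc.
  set (k := fun y => (f y * / (y - z))%C).
  assert (Hk : forall y, Cmod (y - c)%C <= r -> y <> z -> ex_derive_C k y)
    by (intros y Hy; apply ex_derive_C_cauchy_kernel, Hf, Hy).
  pose proof (circle_homotopy c z r rho Hrho Hr k Hk) as E.
  assert (Hmean : ex_RInt_C (fun t => f (z + circ rho t))%C 0 (2 * PI)).
  { apply ex_RInt_C_continuous. intros t _. apply continuous_on_circ; [assumption|].
    intros y Hy. apply Hf. replace (y - c)%C with ((y - z) + (z - c))%C by ring.
    eapply Rle_trans; [apply Cmod_triangle|]. lra. }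
  destruct Hmean as [m Hm]. replace (cauchy_integral f c r 0 z) with m; [exact Hm|].
  assert (Esmall : (Ci * m)%C
    = RInt_C (fun t => k (z + circ rho t) * (Ci * circ rho t))%C 0 (2 * PI)).
  { symmetry. apply (@is_RInt_unique C_R_CompleteNormedModule).
    eapply (@is_RInt_ext C_R_NormedModule); [|apply is_RInt_C_Cmult, Hm].
    intros t _. unfold k. replace (z + circ rho t - z)%C with (circ rho t) by ring.
    symmetry. change ((f (z + circ rho t) * / circ rho t * (Ci * circ rho t))%C
      = (Ci * f (z + circ rho t))%C).
    field. now apply circ_neq_0. }
  assert (Elarge : (Ci * cauchy_integral f c r 0 z)%C
    = RInt_C (fun t => k (c + circ r t) * (Ci * circ r t))%C 0 (2 * PI)).
  { symmetry. apply (@is_RInt_unique C_R_CompleteNormedModule).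
    eapply (@is_RInt_ext C_R_NormedModule);
      [|apply is_RInt_C_Cmult, cauchy_integral_correct; (assumption || lra)].
    intros t _. unfold k. rewrite Cpow_1_r.
    change ((Ci * (f (c + circ r t) * circ r t * / (c + circ r t - z)))%C
      = (f (c + circ r t) * / (c + circ r t - z) * (Ci * circ r t))%C). ring. }
  rewrite <- Esmall, <- Elarge in E.
  replace m with (- Ci * (Ci * m))%C by (apply injective_projections; simpl; ring).
  rewrite E. apply injective_projections; simpl; ring.
Qed.

Lemma cauchy_formula f c r z :
  holomorphic_on (fun y => Cmod (y - c)%C <= r) f -> Cmod (z - c)%C < r ->
  cauchy_integral f c r 0 z = (RtoC (2 * PI) * f z)%C.
Proof.
  intros Hf Hz. pose proof PI_RGT_0 as Hpi.
  apply Ceq_minus, (Cmod_le_eps_eq_0 _ (2 * PI)); [lra|]. intros e He.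
  destruct (Hf z (Rlt_le _ _ Hz)) as [l Hl]. apply is_derive_C_continuous in Hl.
  destruct (proj1 (filterlim_C_eps _ f (f z)) Hl e He) as [d Hd].
  set (rho := Rmin (d / 2) (r - Cmod (z - c)%C)). pose proof (cond_pos d) as Hdpos.
  assert (Hrho : 0 < rho) by (apply Rmin_pos; lra).
  assert (Hrd : rho <= d / 2) by apply Rmin_l.
  assert (Hrr : rho <= r - Cmod (z - c)%C) by apply Rmin_r.
  replace (2 * PI) with (2 * PI - 0) by ring. rewrite (Rmult_comm e).
  apply (Cmod_is_RInt_le_const (fun t => f (z + circ rho t) - f z)%C e 0 (2 * PI)); [lra| |].
  - intros t _. apply Rlt_le, Hd.
    change (Cmod (z + circ rho t - z)%C < d).
    replace (z + circ rho t - z)%C with (circ rho t) by ring. rewrite Cmod_circ; lra.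
  - apply is_RInt_C_minus; [apply small_circle_mean; (assumption || lra)|apply is_RInt_C_const].
Qed.

(* With [A = 1 / (zeta - z - h)] and [B = 1 / (zeta - z)] one has [A - B = h A B]. *)
Lemma Cpow_resolvent_expansion (q : R) (m : nat) :
  exists M, forall A B h : C,
    Cmod A <= q -> Cmod B <= q -> (A - B)%C = (h * A * B)%C ->
    Cmod (A ^ m - B ^ m - RtoC (INR m) * h * B ^ S m)%C <= M * Cmod h ^ 2.
Proof.
  induction m as [|m [M IH]].
  - exists 0. intros A B h _ _ _.
    replace (A ^ 0 - B ^ 0 - RtoC (INR 0) * h * B ^ 1)%C with (RtoC 0) by (simpl; ring).
    rewrite Cmod_0. lra.
  - exists (q * M + INR (S m) * q ^ (m + 3)).
    intros A B h HA HB E. specialize (IH A B h HA HB E).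
    replace (A ^ S m - B ^ S m - RtoC (INR (S m)) * h * B ^ S (S m))%C with
      (A * (A ^ m - B ^ m - RtoC (INR m) * h * B ^ S m)
        + RtoC (INR (S m)) * (h * h) * (A * B ^ (m + 2)))%C.
    2: { replace (m + 2)%nat with (S (S m)) by lia. rewrite S_INR, RtoC_plus, !Cpow_S.
         transitivity (A * (A ^ m - B ^ m - RtoC (INR m) * h * (B * B ^ m))
           + (RtoC (INR m) + 1) * h * (h * A * B) * (B * B ^ m))%C; [ring|].
         rewrite <- E.
         transitivity (A * A ^ m + (h * A * B - A) * B ^ m
           - (RtoC (INR m) + 1) * h * (B * (B * B ^ m)))%C; [ring|].
         rewrite <- E. ring. }
    eapply Rle_trans; [apply Cmod_triangle|].
    rewrite !Cmod_mult, Cmod_pow, Cmod_R, (Rabs_pos_eq (INR (S m))) by apply pos_INR.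
    rewrite Rmult_plus_distr_r. apply Rplus_le_compat.
    + rewrite Rmult_assoc. apply Rmult_le_compat; try apply Cmod_ge_0; assumption.
    + pose proof (Cmod_ge_0 h).
      replace (INR (S m) * q ^ (m + 3) * Cmod h ^ 2)
        with (INR (S m) * (Cmod h * Cmod h) * q ^ S (m + 2))
        by (replace (m + 3)%nat with (S (m + 2)) by lia; ring).
      apply Rmult_le_compat_l; [apply Rmult_le_pos; [apply pos_INR|nra]|].
      rewrite <- tech_pow_Rmult.
      apply Rmult_le_compat; try apply Cmod_ge_0; [apply pow_le, Cmod_ge_0|assumption|].
      apply pow_incr. split; [apply Cmod_ge_0|assumption].
Qed.

Section ResolventIntegral.

Variables (g zeta : R -> C) (a b : R).
Hypothesis Hab : a <= b.
Hypothesis g_continuous : forall t, a <= t <= b -> continuous_RC g t.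
Hypothesis zeta_continuous : forall t, a <= t <= b -> continuous_RC zeta t.

Lemma ex_RInt_resolvent_pow z m :
  (forall t, a <= t <= b -> zeta t <> z) -> ex_RInt_C (fun t => g t * (/ (zeta t - z)) ^ m)%C a b.
Proof.
  intros Hz. apply ex_RInt_C_continuous. rewrite Rmin_left, Rmax_right by assumption. intros t Ht.
  apply continuous_RC_mult; [now apply g_continuous|].
  apply continuous_RC_pow, continuous_RC_inv; [now apply Cminus_eq_contra, Hz|].
  apply continuous_RC_minus; [now apply zeta_continuous|apply continuous_RC_const].
Qed.

Lemma is_derive_resolvent_integral (z : C) (m : nat) (d : R) :
  0 < d -> (forall t, a <= t <= b -> d <= Cmod (zeta t - z)%C) ->
  is_derive_C (fun y => RInt_C (fun t => g t * (/ (zeta t - y)) ^ m)%C a b) z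
    (RtoC (INR m) * RInt_C (fun t => g t * (/ (zeta t - z)) ^ S m)%C a b)%C.
Proof.
  intros Hd Hdist.
  destruct (continuous_RC_bounded g a b Hab g_continuous) as [G HG].
  assert (Hd2 : 0 < d / 2) by lra.
  destruct (Cpow_resolvent_expansion (/ (d / 2)) m) as [M HM].
  assert (Hnear : forall y t, Cmod (y - z)%C < d / 2 -> a <= t <= b ->
    d / 2 <= Cmod (zeta t - y)%C).
  { intros y t Hy Ht. specialize (Hdist t Ht).
    pose proof (Cmod_triangle_rev (zeta t - z) (z - y)) as T. rewrite (Cmod_minus_sym z y) in T.
    replace (zeta t - z + (z - y))%C with (zeta t - y)%C in T by ring. lra. }
  assert (Hneq : forall y t, Cmod (y - z)%C < d / 2 -> a <= t <= b -> zeta t <> y).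
  { intros y t Hy Ht E. specialize (Hnear y t Hy Ht). rewrite E in Hnear.
    replace (y - y)%C with (RtoC 0) in Hnear by ring. rewrite Cmod_0 in Hnear. lra. }
  assert (Hz : Cmod (z - z)%C < d / 2)
    by (replace (z - z)%C with (RtoC 0) by ring; now rewrite Cmod_0).
  apply (is_derive_C_quadratic _ _ _ ((b - a) * (G * M)) (d / 2) Hd2). intros y Hy.
  assert (Hint : forall x n, Cmod (x - z)%C < d / 2 -> is_RInt_C _ a b _)
    by (intros x n Hx; apply RInt_C_correct, (ex_RInt_resolvent_pow x n); intros t; now apply Hneq).
  pose proof (is_RInt_C_minus _ _ _ _ _ _
    (is_RInt_C_minus _ _ _ _ _ _ (Hint y m Hy) (Hint z m Hz))
    (is_RInt_C_Cmult (RtoC (INR m) * (y - z))%C _ _ _ _ (Hint z (S m) Hz))) as Hdiff.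
  match goal with |- Cmod (?u - ?v - RtoC (INR m) * ?w * (y - z))%C <= _ =>
    replace (u - v - RtoC (INR m) * w * (y - z))%C
      with (u - v - RtoC (INR m) * (y - z) * w)%C by ring end.
  rewrite !Rmult_assoc.
  apply (Cmod_is_RInt_le_const _ _ a b _ Hab) with (2 := Hdiff). intros t Ht.
  replace (g t * (/ (zeta t - y)) ^ m - g t * (/ (zeta t - z)) ^ m
     - RtoC (INR m) * (y - z) * (g t * (/ (zeta t - z)) ^ S m))%C
    with (g t * ((/ (zeta t - y)) ^ m - (/ (zeta t - z)) ^ m
     - RtoC (INR m) * (y - z) * (/ (zeta t - z)) ^ S m))%C by ring.
  rewrite Cmod_mult. apply Rmult_le_compat; try apply Cmod_ge_0; [now apply HG|].
  assert (Hy0 : (zeta t - y)%C <> 0) by now apply Cminus_eq_contra, Hneq.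
  assert (Hz0 : (zeta t - z)%C <> 0) by now apply Cminus_eq_contra, Hneq.
  apply HM;
    [rewrite Cmod_inv by assumption; apply Rinv_le_contravar; [|apply Hnear]; assumption..|].
  field. split; assumption.
Qed.

End ResolventIntegral.

Fixpoint C_derive_n (n : nat) (f : C -> C) : C -> C :=
  match n with O => f | S m => C_derive (C_derive_n m f) end.

Section CauchyDerivatives.

Variables (f : C -> C) (c : C) (r : R).
Hypothesis Hr : 0 < r.
Hypothesis Hf : holomorphic_on (fun y => Cmod (y - c)%C <= r) f.

Lemma is_derive_cauchy_integral n z :
  Cmod (z - c)%C < r ->
  is_derive_C (cauchy_integral f c r n) z (RtoC (INR (S n)) * cauchy_integral f c r (S n) z)%C.
Proof.
  intros Hz. pose proof PI_RGT_0.
  apply (is_derive_resolvent_integral (fun t => f (c + circ r t) * circ r t)%C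
           (fun t => c + circ r t)%C 0 (2 * PI)) with (r - Cmod (z - c)%C); try lra.
  - intros t _. apply continuous_RC_mult; [now apply continuous_on_circ|apply continuous_circ].
  - intros t _. apply continuous_RC_plus; [apply continuous_RC_const|apply continuous_circ].
  - intros t _. apply Cmod_circ_sub_ge. lra.
Qed.

Lemma cauchy_formula_derive_n n z :
  Cmod (z - c)%C < r ->
  C_derive_n n f z = (RtoC (INR (fact n) / (2 * PI)) * cauchy_integral f c r n z)%C.
Proof.
  pose proof PI_RGT_0 as Hpi. revert z. induction n as [|n IH]; intros z Hz.
  - rewrite cauchy_formula, Cmult_assoc, <- RtoC_mult by assumption.
    replace (INR (fact 0) / (2 * PI) * (2 * PI)) with 1 by (simpl; field; lra).
    simpl. ring.
  - apply is_C_derive_unique.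
    apply (is_derive_C_ext_ball
      (fun y => RtoC (INR (fact n) / (2 * PI)) * cauchy_integral f c r n y)%C
      _ _ _ (r - Cmod (z - c)%C)); [lra| |].
    + intros y Hy. symmetry. apply IH.
      replace (y - c)%C with ((y - z) + (z - c))%C by ring.
      eapply Rle_lt_trans; [apply Cmod_triangle|]. lra.
    + evar_last; [apply is_derive_C_Cmult, is_derive_cauchy_integral, Hz|].
      change ((RtoC (INR (fact n) / (2 * PI))
          * (RtoC (INR (S n)) * cauchy_integral f c r (S n) z))%C
        = (RtoC (INR (fact (S n)) / (2 * PI)) * cauchy_integral f c r (S n) z)%C).
      rewrite Cmult_assoc, <- RtoC_mult, fact_simpl, mult_INR. do 2 f_equal. field. lra.
Qed.

Lemma ex_derive_C_derive_n n z : Cmod (z - c)%C < r -> ex_derive_C (C_derive_n n f) z.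
Proof.
  intros Hz. eexists.
  apply (is_derive_C_ext_ball
    (fun y => RtoC (INR (fact n) / (2 * PI)) * cauchy_integral f c r n y)%C
    _ _ _ (r - Cmod (z - c)%C)); [lra| |apply is_derive_C_Cmult, is_derive_cauchy_integral, Hz].
  intros y Hy. symmetry. apply cauchy_formula_derive_n.
  replace (y - c)%C with ((y - z) + (z - c))%C by ring.
  eapply Rle_lt_trans; [apply Cmod_triangle|]. lra.
Qed.

Lemma cauchy_estimate n (g : R -> R) (m : R) :
  (forall t, 0 <= t <= 2 * PI -> Cmod (f (c + circ r t)) <= g t) -> is_RInt g 0 (2 * PI) m ->
  Cmod (C_derive_n n f c) <= INR (fact n) / (2 * PI) * (m / r ^ n).
Proof.
  intros Hg Hm. pose proof PI_RGT_0 as Hpi. pose proof (INR_fact_lt_0 n) as Hn.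
  assert (Hc : Cmod (c - c)%C < r) by (replace (c - c)%C with (RtoC 0) by ring; now rewrite Cmod_0).
  rewrite cauchy_formula_derive_n, Cmod_mult, Cmod_R, Rabs_pos_eq
    by (assumption || (apply Rlt_le, Rdiv_lt_0_compat; lra)).
  apply Rmult_le_compat_l; [apply Rlt_le, Rdiv_lt_0_compat; lra|].
  pose proof (pow_lt r n Hr) as Hrn.
  apply (Cmod_is_RInt_le _ (fun t => scal (/ r ^ n) (g t)) 0 (2 * PI) _ _) with
    (3 := cauchy_integral_correct f c r n c Hr Hf Hc); [lra| |].
  - intros t Ht. replace (c + circ r t - c)%C with (circ r t) by ring.
    rewrite !Cmod_mult, Cmod_pow, Cmod_inv, Cmod_circ by (lra || now apply circ_neq_0).
    rewrite pow_inv, <- tech_pow_Rmult. change (scal (/ r ^ n) (g t)) with (/ r ^ n * g t).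
    apply Rle_trans with (g t * / r ^ n); [|right; ring].
    rewrite Rmult_assoc. replace (r * / (r * r ^ n)) with (/ r ^ n) by (field; lra).
    apply Rmult_le_compat_r; [apply Rlt_le, Rinv_0_lt_compat, Hrn|now apply Hg].
  - unfold Rdiv. rewrite (Rmult_comm m). apply (@is_RInt_scal R_NormedModule), Hm.
Qed.

End CauchyDerivatives.

Lemma is_derive_C_derive_n f c r n z :
  holomorphic_on (fun y => Cmod (y - c)%C < r) f -> Cmod (z - c)%C < r ->
  is_derive_C (C_derive_n n f) z (C_derive_n (S n) f z).
Proof.
  intros Hf Hz. pose proof (Cmod_ge_0 (z - c)%C).
  apply C_derive_correct; [exact 0|].
  apply (ex_derive_C_derive_n f c ((r + Cmod (z - c)%C) / 2)); [lra| |lra].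
  intros y Hy. apply Hf. lra.
Qed.

(** * The logarithm on the right half-plane *)

Lemma Carg_right (s : C) : 0 < Re s -> Carg s = atan (Im s / Re s).
Proof. intros H. unfold Carg. now destruct (Rlt_dec 0 (Re s)). Qed.

Lemma Clog_right (s : C) :
  0 < Re s -> Clog s = (ln (Re s ^ 2 + Im s ^ 2) / 2, atan (Im s / Re s)) :> C.
Proof.
  intros H. unfold Clog. rewrite Carg_right by assumption. f_equal.
  rewrite <- Cmod2_alt, <- Rpower_pow by now apply Cmod_gt_0, Re_pos_neq_0.
  unfold Rpower. rewrite ln_exp. simpl. field.
Qed.

Lemma is_derive_Clog_line (s h : C) (t : R) :
  0 < Re (s + RtoC t * h)%C ->
  is_derive_RC (fun u => Clog (s + RtoC u * h)%C) t (/ (s + RtoC t * h) * h)%C.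
Proof.
  intros Ht. destruct s as [x y], h as [a b].
  assert (Ht' : 0 < x + t * a) by (simpl in Ht; lra).
  eapply (is_derive_ext_loc (V := C_R_NormedModule)
    (fun u : R => (ln ((x + u * a) ^ 2 + (y + u * b) ^ 2) / 2, atan ((y + u * b) / (x + u * a))))).
  - assert (L : locally t (fun u => 0 < x + u * a)).
    { assert (K : continuous (fun u => x + u * a) t).
      { apply (@ex_derive_continuous R_AbsRing R_NormedModule). auto_derive. exact I. }
      exact (K (fun v => 0 < v) (open_gt 0 _ Ht')). }
    eapply filter_imp; [|exact L]. intros u Hu.
    assert (ERe : Re ((x, y) + RtoC u * (a, b))%C = x + u * a) by (simpl; ring).
    assert (EIm : Im ((x, y) + RtoC u * (a, b))%C = y + u * b) by (simpl; ring).
    rewrite Clog_right, ERe, EIm by now rewrite ERe. reflexivity.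
  - assert (P : 0 < (x + t * a) ^ 2 + (y + t * b) ^ 2).
    { pose proof (pow_lt _ 2 Ht'). pose proof (pow2_ge_0 (y + t * b)). lra. }
    simpl in P. apply is_derive_RC_pair. split; simpl.
    + auto_derive; [lra|]. field. lra.
    + auto_derive; [lra|]. field. repeat split; lra.
Qed.

Lemma Re_segment_pos (s h : C) (t : R) :
  Cmod h < Re s -> 0 <= t <= 1 -> 0 < Re (s + RtoC t * h)%C.
Proof.
  intros Hh Ht. pose proof (re_le_Cmod h) as K. apply Rabs_le_between in K.
  destruct s, h; simpl in *. nra.
Qed.

Lemma is_derive_Clog (s : C) : 0 < Re s -> is_derive_C Clog s (/ s)%C.
Proof.
  intros Hs. apply (is_derive_C_of_segments Clog Cinv s (Re s) Hs).
  - exact (is_derive_C_continuous _ _ _ (is_derive_Cinv s (Re_pos_neq_0 s Hs))).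
  - intros y t Hy Ht. now apply is_derive_Clog_line, Re_segment_pos.
Qed.

Lemma Clog_1 : Clog 1 = 0.
Proof.
  rewrite Clog_right by (simpl; lra). simpl.
  replace (1 * (1 * 1) + 0 * (0 * 1)) with 1 by ring. rewrite ln_1.
  replace (0 / 1) with 0 by field. rewrite atan_0. unfold Rdiv. now rewrite Rmult_0_l.
Qed.

Lemma Cmod_Clog_1p_le (v : C) : Cmod v < 1 -> Cmod (Clog (1 + v)%C) <= - ln (1 - Cmod v).
Proof.
  intros Hv. pose proof (Cmod_ge_0 v) as Pv.
  assert (Hpos : forall t, 0 <= t <= 1 -> 0 < 1 - t * Cmod v) by (intros; nra).
  assert (Hre : forall t, 0 <= t <= 1 -> 0 < Re (1 + RtoC t * v)%C)
    by (intros; now apply Re_segment_pos).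
  pose proof (Cmod_increment_le (fun t => Clog (1 + RtoC t * v)%C)
    (fun t => / (1 + RtoC t * v) * v)%C (fun t => - ln (1 - t * Cmod v))
    (fun t => / (1 - t * Cmod v) * Cmod v) 0 1) as H.
  cbv beta in H. rewrite Cmult_0_l, Cmult_1_l, Cplus_0_r, Clog_1, Rmult_0_l, Rmult_1_l in H.
  rewrite Rminus_0_r, ln_1, Ropp_0, Rminus_0_r in H.
  replace (Clog (1 + v) - 0)%C with (Clog (1 + v)%C) in H by ring.
  apply H; clear H; [lra|..]; intros t Ht; specialize (Hpos t Ht); specialize (Hre t Ht).
  - now apply is_derive_Clog_line.
  - auto_derive; [lra|field; lra].
  - rewrite Cmod_mult, Cmod_inv by now apply Re_pos_neq_0.
    apply Rmult_le_compat_r; [assumption|]. apply Rinv_le_contravar; [assumption|].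
    pose proof (Cmod_triangle_rev 1 (RtoC t * v)) as T.
    rewrite Cmod_1, Cmod_mult, Cmod_R, Rabs_pos_eq in T by lra. exact T.
Qed.

Lemma Clog_scal (s : R) (u : C) :
  0 < s -> 0 < Re u -> Clog (RtoC s * u)%C = (RtoC (ln s) + Clog u)%C.
Proof.
  intros Hs Hu. assert (Hm : 0 < Cmod u) by (apply Cmod_gt_0, Re_pos_neq_0, Hu).
  unfold Clog. rewrite Cmod_mult, Cmod_R, Rabs_pos_eq, ln_mult by lra.
  rewrite !Carg_right, re_scal_l, im_scal_l
    by (assumption || (rewrite re_scal_l; now apply Rmult_lt_0_compat)).
  replace (s * Im u / (s * Re u)) with (Im u / Re u) by (field; lra).
  apply injective_projections; simpl; ring.
Qed.

Lemma Clog_RtoC (s : R) : 0 < s -> Clog (RtoC s) = RtoC (ln s).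
Proof.
  intros Hs. replace (RtoC s) with (RtoC s * 1)%C by ring.
  rewrite Clog_scal, Clog_1 by (simpl; lra). ring.
Qed.

(** * Rising factorials *)

Lemma exp_le_mono x y : x <= y -> exp x <= exp y.
Proof. intros [H| ->]; [left; now apply exp_increasing|right; reflexivity]. Qed.

Lemma exp_pow x n : exp x ^ n = exp (INR n * x).
Proof. rewrite <- Rpower_pow by apply exp_pos. unfold Rpower. now rewrite ln_exp. Qed.

Lemma ln_le_sub_1 y : 0 < y -> ln y <= y - 1.
Proof. intros Hy. pose proof (exp_ineq1_le (ln y)) as H. rewrite exp_ln in H by assumption. lra. Qed.

Lemma ln_ge_1_sub_inv y : 0 < y -> 1 - / y <= ln y.
Proof.
  intros Hy. pose proof (ln_le_sub_1 (/ y) (Rinv_0_lt_compat y Hy)) as H.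
  rewrite ln_Rinv in H by assumption. lra.
Qed.

Lemma Rpower_pos x y : 0 < Rpower x y.
Proof. apply exp_pos. Qed.

Lemma Rpower_1_l y : Rpower 1 y = 1.
Proof. unfold Rpower. now rewrite ln_1, Rmult_0_r, exp_0. Qed.

Lemma filterlim_Rpower_at_right_0 d :
  0 < d -> filterlim (fun t => Rpower t d) (at_right 0) (locally 0).
Proof.
  intros Hd. apply filterlim_locally. intros [e He].
  exists (mkposreal (Rpower e (/ d)) (Rpower_pos _ _)). intros t Ht Ht0.
  change (Rabs (t - 0) < Rpower e (/ d)) in Ht. rewrite Rminus_0_r, Rabs_pos_eq in Ht by lra.
  change (Rabs (Rpower t d - 0) < e). rewrite Rminus_0_r, Rabs_pos_eq by apply Rlt_le, Rpower_pos.
  replace e with (Rpower (Rpower e (/ d)) d).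
  - apply Rlt_Rpower_l; lra.
  - rewrite Rpower_mult, Rinv_l, Rpower_1 by lra. reflexivity.
Qed.

Fixpoint Rrising (x : R) (n : nat) : R :=
  match n with O => 1 | S m => Rrising x m * (x + INR m) end.

Lemma Rrising_pos x n : 0 < x -> 0 < Rrising x n.
Proof.
  intros Hx. induction n as [|n IH]; simpl; [lra|].
  pose proof (pos_INR n). apply Rmult_lt_0_compat; lra.
Qed.

Lemma Rrising_1 n : Rrising 1 n = INR (fact n).
Proof.
  induction n as [|n IH]; [reflexivity|].
  rewrite fact_simpl, mult_INR, S_INR. simpl. rewrite IH. ring.
Qed.

Lemma one_sub_ratio_le_Rpower m d : 0 < m -> 0 <= d -> (m - d) / m <= Rpower (m / (m + 1)) d.
Proof.
  intros Hm Hd.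
  assert (Hln : - / m <= ln (m / (m + 1))).
  { eapply Rle_trans; [|apply ln_ge_1_sub_inv, Rdiv_lt_0_compat; lra]. right. field. lra. }
  apply Rle_trans with (exp (- (d / m))).
  - pose proof (exp_ineq1_le (- (d / m))) as H. eapply Rle_trans; [|exact H]. right. field. lra.
  - apply exp_le_mono. replace (- (d / m)) with (d * - / m) by (field; lra).
    now apply Rmult_le_compat_l.
Qed.

Lemma Rrising_ratio_le c x n :
  0 < c <= x -> Rrising c n / Rrising x n <= Rpower (x / (x + INR n)) (x - c).
Proof.
  intros Hc. induction n as [|n IH].
  - simpl. rewrite Rplus_0_r, !Rdiv_diag, Rpower_1_l by lra. lra.
  - pose proof (pos_INR n) as Hn. pose proof (Rrising_pos x n ltac:(lra)) as Px.
    pose proof (Rrising_pos c n ltac:(lra)) as Pc.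
    rewrite S_INR. cbn [Rrising]. set (m := x + INR n). assert (Hm : 0 < m) by (unfold m; lra).
    replace (Rrising c n * (c + INR n) / (Rrising x n * m))
      with (Rrising c n / Rrising x n * ((m - (x - c)) / m))
      by (unfold m; field; unfold m in Hm; lra).
    replace (x / (x + (INR n + 1))) with (x / m * (m / (m + 1)))
      by (unfold m; field; unfold m in Hm; lra).
    rewrite <- Rpower_mult_distr by (apply Rdiv_lt_0_compat; lra).
    apply Rmult_le_compat; [apply Rdiv_le_0_compat; lra| |exact IH|];
      [|apply one_sub_ratio_le_Rpower; lra].
    apply Rdiv_le_0_compat; unfold m; lra.
Qed.

Lemma is_lim_seq_Rrising_ratio c x :
  0 < c < x -> is_lim_seq (fun n => Rrising c n / Rrising x n) 0.
Proof.
  intros Hc.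
  apply (is_lim_seq_le_le (fun _ => 0) _ (fun n => Rpower (x / (x + INR n)) (x - c))).
  - intros n. split; [|apply Rrising_ratio_le; lra].
    apply Rlt_le, Rdiv_lt_0_compat; apply Rrising_pos; lra.
  - apply is_lim_seq_const.
  - apply (filterlim_comp _ _ _ (fun n => x / (x + INR n))
      (fun t => Rpower t (x - c)) _ (at_right 0));
      [|apply filterlim_Rpower_at_right_0; lra].
    intros P [d Hd].
    assert (L : is_lim_seq (fun n => x / (x + INR n)) 0).
    { replace (Finite 0) with (Rbar_mult x 0) by (simpl; f_equal; ring).
      apply is_lim_seq_scal_l. apply (is_lim_seq_inv _ p_infty); [|discriminate].
      apply (is_lim_seq_plus _ _ x p_infty);
        [apply is_lim_seq_const|apply is_lim_seq_INR|reflexivity]. }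
    destruct (proj2 (is_lim_seq_spec _ _) L d) as [N HN]. exists N. intros n Hn. apply Hd.
    + exact (HN n Hn).
    + pose proof (pos_INR n). apply Rdiv_lt_0_compat; lra.
Qed.

Lemma Rrising_ratio_telescope c x n :
  0 < x -> Rrising c n / Rrising x n - Rrising c (S n) / Rrising x (S n)
           = (x - c) * (Rrising c n / Rrising x (S n)).
Proof.
  intros Hx. pose proof (Rrising_pos x n Hx). pose proof (pos_INR n). simpl. field. lra.
Qed.

Lemma is_series_telescope (u : nat -> R) (l : R) :
  is_lim_seq u l -> is_series (fun n => u n - u (S n)) (u O - l).
Proof.
  intros Hu.
  change (is_lim_seq (sum_n (fun n => u n - u (S n))) (u O - l)).
  apply (is_lim_seq_ext (fun n => u O - u (S n))).
  - induction n as [|n IH]; [now rewrite sum_O|].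
    rewrite sum_Sn, <- IH. unfold plus. simpl. ring.
  - apply is_lim_seq_minus'; [apply is_lim_seq_const|now apply (is_lim_seq_incr_1 u)].
Qed.

Lemma ex_series_Rrising_ratio c x :
  0 < c < x -> ex_series (fun n => Rrising c n / Rrising x (S n)).
Proof.
  intros Hc.
  apply (ex_series_ext (fun n => scal (/ (x - c))
    (Rrising c n / Rrising x n - Rrising c (S n) / Rrising x (S n)))).
  - intros n. rewrite Rrising_ratio_telescope by lra.
    change (/ (x - c) * ((x - c) * (Rrising c n / Rrising x (S n)))
      = Rrising c n / Rrising x (S n)).
    rewrite <- Rmult_assoc, Rinv_l by lra. ring.
  - apply (@ex_series_scal R_AbsRing R_NormedModule). eexists.
    apply (is_series_telescope (fun n => Rrising c n / Rrising x n)).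
    now apply is_lim_seq_Rrising_ratio.
Qed.

(** * Improper integrals *)

Lemma minus_plus_plus {G : AbelianGroup} (a b c : G) : minus (plus a (plus b c)) b = plus a c.
Proof.
  unfold minus.
  now rewrite (plus_comm b c), (plus_assoc a), <- (plus_assoc (plus a c)), plus_opp_r, plus_zero_r.
Qed.

Section ImproperIntegrals.

Context {V : CompleteNormedModule R_AbsRing}.
Variables Fa Fb : (R -> Prop) -> Prop.
Context {PFa : ProperFilter Fa} {PFb : ProperFilter Fb}.
Variable D : R -> Prop.
Hypothesis D_convex : forall x y t, D x -> D y -> x <= t <= y -> D t.
Hypothesis Fa_D : Fa D.
Hypothesis Fb_D : Fb D.

Lemma D_contains_segment x y t : D x -> D y -> Rmin x y <= t <= Rmax x y -> D t.
Proof.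
  intros Hx Hy. unfold Rmin, Rmax. destruct (Rle_dec x y); intros Ht.
  - now apply (D_convex x y).
  - now apply (D_convex y x).
Qed.

Lemma filter_prod_segment :
  filter_prod Fa Fb
    (fun ab => forall t, Rmin (fst ab) (snd ab) <= t <= Rmax (fst ab) (snd ab) -> D t).
Proof.
  apply Filter_prod with D D; [assumption..|]. intros x y Hx Hy t. now apply D_contains_segment.
Qed.

Lemma is_RInt_gen_derive (F f : R -> V) (la lb : V) :
  (forall t, D t -> is_derive F t (f t)) -> (forall t, D t -> continuous f t) ->
  filterlim F Fa (locally la) -> filterlim F Fb (locally lb) ->
  is_RInt_gen f Fa Fb (minus lb la).
Proof.
  intros HF Hf Ha Hb P HP.
  assert (Hlim : filterlim (fun ab => minus (F (snd ab)) (F (fst ab))) (filter_prod Fa Fb)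
                   (locally (minus lb la))).
  { refine (filterlim_comp_2 (fun ab => F (snd ab)) (fun ab => opp (F (fst ab))) plus
      _ _ (filterlim_plus lb (opp la))).
    - exact (filterlim_comp _ _ _ snd F _ Fb _ filterlim_snd Hb).
    - refine (filterlim_comp _ _ _ (fun ab => F (fst ab)) opp _ _ _ _ (filterlim_opp la)).
      exact (filterlim_comp _ _ _ fst F _ Fa _ filterlim_fst Ha). }
  pose proof (Hlim P HP) as HPab. unfold filtermap in HPab. unfold filtermapi.
  generalize (filter_and _ _ filter_prod_segment HPab). apply filter_imp.
  intros ab [HD Hab]. eexists. split; [|exact Hab].
  apply is_RInt_derive; intros t Ht; [apply HF|apply Hf]; now apply HD.
Qed.

Lemma ex_RInt_D (W : CompleteNormedModule R_AbsRing) (f : R -> W) x y :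
  (forall t, D t -> continuous f t) -> D x -> D y -> ex_RInt f x y.
Proof.
  intros Hf Hx Hy. apply (@ex_RInt_continuous W). intros t Ht.
  now apply Hf, (D_contains_segment x y).
Qed.

Section Domination.

Variables (f : R -> V) (g : R -> R).
Hypothesis f_continuous : forall t, D t -> continuous f t.
Hypothesis g_continuous : forall t, D t -> continuous g t.
Hypothesis f_le_g : forall t, D t -> norm (f t) <= g t.

Let f_integrable x y : D x -> D y -> ex_RInt f x y := ex_RInt_D V f x y f_continuous.
Let g_integrable x y : D x -> D y -> ex_RInt g x y :=
  ex_RInt_D R_CompleteNormedModule g x y g_continuous.

Lemma norm_RInt_le_Rabs_RInt x y : D x -> D y -> norm (RInt f x y) <= Rabs (RInt g x y).
Proof.
  intros Hx Hy.
  assert (Hle : forall x y, D x -> D y -> x <= y -> norm (RInt f x y) <= Rabs (RInt g x y)).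
  { intros u v Hu Hv Huv. eapply Rle_trans; [|apply Rle_abs].
    apply (norm_RInt_le f g u v _ _ Huv).
    - intros t Ht. now apply f_le_g, (D_convex u v).
    - exact (@RInt_correct V f u v (f_integrable u v Hu Hv)).
    - exact (@RInt_correct R_CompleteNormedModule g u v (g_integrable u v Hu Hv)). }
  destruct (Rle_dec x y) as [Hxy|Hxy]; [now apply Hle|].
  replace (norm (RInt f x y)) with (norm (RInt f y x)).
  2: { rewrite <- (opp_RInt_swap f y x (f_integrable y x Hy Hx)).
       symmetry. exact (@norm_opp R_AbsRing V (RInt f y x)). }
  rewrite <- (opp_RInt_swap (V := R_CompleteNormedModule) g y x (g_integrable y x Hy Hx)).
  change (opp (RInt g y x)) with (- RInt g y x). rewrite Rabs_Ropp. apply Hle; [assumption..|lra].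
Qed.

(* Moving both endpoints changes the integral of [f] by at most the variations of that of [g]. *)
Lemma norm_RInt_difference_le x y x' y' l e :
  D x -> D y -> D x' -> D y' ->
  Rabs (RInt g x y - l) < e -> Rabs (RInt g x' y - l) < e -> Rabs (RInt g x y' - l) < e ->
  norm (minus (RInt f x' y') (RInt f x y)) < 4 * e.
Proof.
  intros Hx Hy Hx' Hy' H H' H''.
  assert (Eg : RInt g x' y = RInt g x' x + RInt g x y)
    by (symmetry; apply (@RInt_Chasles R_CompleteNormedModule g); now apply g_integrable).
  assert (Eg' : RInt g x y' = RInt g x y + RInt g y y')
    by (symmetry; apply (@RInt_Chasles R_CompleteNormedModule g); now apply g_integrable).
  assert (Ef : minus (RInt f x' y') (RInt f x y) = plus (RInt f x' x) (RInt f y y')).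
  { rewrite <- (RInt_Chasles f x' x y'), <- (RInt_Chasles f x y y') by now apply f_integrable.
    exact (minus_plus_plus (G := CompleteNormedModule.AbelianGroup R_AbsRing V) _ _ _). }
  rewrite Ef.
  eapply Rle_lt_trans; [exact (@norm_triangle R_AbsRing V (RInt f x' x) (RInt f y y'))|].
  pose proof (norm_RInt_le_Rabs_RInt x' x Hx' Hx) as B.
  pose proof (norm_RInt_le_Rabs_RInt y y' Hy Hy') as B'.
  apply Rabs_def2 in H, H', H''.
  assert (Rabs (RInt g x' x) < 2 * e) by (apply Rabs_def1; lra).
  assert (Rabs (RInt g y y') < 2 * e) by (apply Rabs_def1; lra). lra.
Qed.

Lemma ex_RInt_gen_dominated : ex_RInt_gen g Fa Fb -> ex_RInt_gen f Fa Fb.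
Proof.
  intros [l Hl].
  assert (Hcauchy : exists I,
    filterlim (fun ab => RInt f (fst ab) (snd ab)) (filter_prod Fa Fb) (locally I)).
  { apply filterlim_locally_cauchy. intros [e He]. assert (He4 : 0 < e / 4) by lra.
    destruct (Hl _ (locally_ball l (mkposreal _ He4))) as [Qa Qb HQa HQb HQ].
    assert (Hnear : forall x y, Qa x -> Qb y -> Rabs (RInt g x y - l) < e / 4).
    { intros x y Hx Hy. destruct (HQ x y Hx Hy) as [I [HI Hball]].
      rewrite (is_RInt_unique g x y I HI). exact Hball. }
    exists (fun ab => (D (fst ab) /\ Qa (fst ab)) /\ (D (snd ab) /\ Qb (snd ab))). split.
    - apply Filter_prod with (fun t => D t /\ Qa t) (fun t => D t /\ Qb t);
        [now apply filter_and..|now split].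
    - intros [x y] [x' y'] [[Dx Qx] [Dy Qy]] [[Dx' Qx'] [Dy' Qy']]. cbn [fst snd] in *.
      apply (@norm_compat1 R_AbsRing V). simpl. replace e with (4 * (e / 4)) by field.
      apply (norm_RInt_difference_le x y x' y' l); auto. }
  destruct Hcauchy as [I HI]. exists I. intros P HP.
  pose proof (HI P HP) as HIP. unfold filtermap in HIP. unfold filtermapi.
  generalize (filter_and _ _ filter_prod_segment HIP). apply filter_imp.
  intros [x y] [HD HPxy]. exists (RInt f x y). split; [|exact HPxy].
  apply RInt_correct, (@ex_RInt_continuous V). intros t Ht. now apply f_continuous, HD.
Qed.

End Domination.

End ImproperIntegrals.

Lemma is_RInt_gen_linear {U V : NormedModule R_AbsRing} {Fa Fb : (R -> Prop) -> Prop}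
    {FFa : Filter Fa} {FFb : Filter Fb} (L : U -> V) (f : R -> U) l :
  is_linear L -> is_RInt_gen f Fa Fb l -> is_RInt_gen (fun t => L (f t)) Fa Fb (L l).
Proof.
  intros HL Hf P HP.
  pose proof (Hf (fun y => P (L y)) (linear_cont L l HL P HP)) as HLP.
  unfold filtermapi in *. revert HLP. apply filter_imp.
  intros ab [I [HI HPI]]. exists (L I). split; [now apply is_RInt_linear|assumption].
Qed.

Lemma is_RInt_gen_le {Fa Fb : (R -> Prop) -> Prop} {PFa : ProperFilter Fa} {PFb : ProperFilter Fb}
    (f g : R -> R) (lf lg : R) :
  filter_prod Fa Fb (fun ab => fst ab <= snd ab) ->
  filter_prod Fa Fb (fun ab => forall t, fst ab <= t <= snd ab -> f t <= g t) ->
  is_RInt_gen f Fa Fb lf -> is_RInt_gen g Fa Fb lg -> lf <= lg.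
Proof.
  intros Hord Hle Hf Hg. pose proof (is_RInt_gen_minus g f lg lf Hg Hf) as Hd.
  assert (H : Rabs (lg - lf) <= lg - lf).
  { apply (RInt_gen_norm (V := R_CompleteNormedModule) _ _ _ _ Hord) with (2 := Hd) (3 := Hd).
    eapply filter_imp; [|exact Hle]. intros ab Hab t Ht. specialize (Hab t Ht).
    change (Rabs (g t - f t) <= g t - f t). rewrite Rabs_pos_eq; lra. }
  pose proof (Rabs_pos (lg - lf)). lra.
Qed.

Notation is_RInt_gen_C := (@is_RInt_gen C_R_NormedModule).
Notation ex_RInt_gen_C := (@ex_RInt_gen C_R_NormedModule).

Lemma RInt_gen_C_correct f Fa Fb {PFa : ProperFilter Fa} {PFb : ProperFilter Fb} :
  ex_RInt_gen_C f Fa Fb -> is_RInt_gen_C f Fa Fb (@RInt_gen C_R_CompleteNormedModule f Fa Fb).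
Proof. exact (@RInt_gen_correct C_R_CompleteNormedModule Fa Fb _ _ f). Qed.

Lemma is_RInt_gen_C_unique f Fa Fb {PFa : ProperFilter Fa} {PFb : ProperFilter Fb} l l' :
  is_RInt_gen_C f Fa Fb l -> is_RInt_gen_C f Fa Fb l' -> l = l'.
Proof.
  intros H H'. rewrite <- (@is_RInt_gen_unique C_R_CompleteNormedModule Fa Fb _ _ f l H).
  exact (@is_RInt_gen_unique C_R_CompleteNormedModule Fa Fb _ _ f l' H').
Qed.

Lemma is_RInt_gen_C_plus f g Fa Fb {FFa : Filter Fa} {FFb : Filter Fb} l m :
  is_RInt_gen_C f Fa Fb l -> is_RInt_gen_C g Fa Fb m ->
  is_RInt_gen_C (fun t => f t + g t)%C Fa Fb (l + m)%C.
Proof. exact (@is_RInt_gen_plus C_R_NormedModule Fa Fb _ _ f g l m). Qed.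

Lemma is_RInt_gen_C_Cmult (c : C) f Fa Fb {FFa : Filter Fa} {FFb : Filter Fb} l :
  is_RInt_gen_C f Fa Fb l -> is_RInt_gen_C (fun t => c * f t)%C Fa Fb (c * l)%C.
Proof. exact (is_RInt_gen_linear _ f l (is_linear_Cmult c)). Qed.

Lemma filterlim_at_point {V : UniformSpace} (f : R -> V) (a : R) :
  filterlim f (at_point a) (locally (f a)).
Proof. intros P HP. exact (locally_singleton _ _ HP). Qed.

Lemma filterlim_C_0_dominated (F : (R -> Prop) -> Prop) {FF : Filter F} (f : R -> C) (g : R -> R) :
  F (fun t => Cmod (f t) <= g t) -> filterlim g F (locally 0) ->
  filterlim f F (locally (T := C_R_NormedModule) (RtoC 0)).
Proof.
  intros Hfg Hg. apply (proj2 (filterlim_C_eps F f 0)). intros e He.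
  pose proof (proj1 (filterlim_locally g 0) Hg (mkposreal e He)) as Hsmall.
  generalize (filter_and _ _ Hfg Hsmall). apply filter_imp. intros t [H1 H2].
  replace (f t - 0)%C with (f t) by ring.
  change (Rabs (g t - 0) < e) in H2. apply Rabs_def2 in H2. lra.
Qed.

Lemma filterlim_Rmult_0 {T : Type} (F : (T -> Prop) -> Prop) (k : R) (g : T -> R) :
  filterlim g F (locally 0) -> filterlim (fun t => k * g t) F (locally 0).
Proof.
  intros Hg. rewrite <- (Rmult_0_r k).
  exact (filterlim_comp _ _ _ g (Rmult k) _ _ _ Hg
    (continuous_scal_r (V := R_NormedModule) k (fun y => y) 0 (continuous_id 0))).
Qed.

Lemma Rbar_locally_p_infty_gt a : Rbar_locally p_infty (fun t => a < t).
Proof. now exists a. Qed.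

Lemma Rbar_locally_p_infty_ge a : Rbar_locally p_infty (fun t => a <= t).
Proof. exists a. intros t Ht. lra. Qed.

Lemma at_right_0_between d : 0 < d -> at_right 0 (fun t => 0 < t <= d).
Proof.
  intros Hd. exists (mkposreal d Hd). intros t Ht Ht0.
  change (Rabs (t - 0) < d) in Ht. apply Rabs_def2 in Ht. lra.
Qed.

Lemma at_right_0_pos : at_right 0 (fun t => 0 < t).
Proof. generalize (at_right_0_between 1 Rlt_0_1). apply filter_imp. tauto. Qed.

Lemma at_right_0_le_p_infty :
  filter_prod (at_right 0) (Rbar_locally p_infty) (fun ab => fst ab <= snd ab).
Proof.
  apply Filter_prod with (fun t => 0 < t <= 1) (fun t => 1 < t).
  - apply at_right_0_between, Rlt_0_1.
  - apply Rbar_locally_p_infty_gt.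
  - simpl; intros; lra.
Qed.

Lemma filterlim_exp_decay d :
  0 < d -> filterlim (fun t => exp (- (d * t))) (Rbar_locally p_infty) (locally 0).
Proof.
  intros Hd. apply filterlim_locally. intros [e He]. exists (- ln e / d). intros t Ht.
  change (Rabs (exp (- (d * t)) - 0) < e). rewrite Rminus_0_r, Rabs_pos_eq by apply Rlt_le, exp_pos.
  rewrite <- (exp_ln e He). apply exp_increasing. apply Rlt_div_l in Ht; lra.
Qed.

Lemma is_RInt_gen_exp_decay M d a :
  0 < d ->
  is_RInt_gen (fun t => M * exp (- (d * t))) (at_point a) (Rbar_locally p_infty)
    (M / d * exp (- (d * a))).
Proof.
  intros Hd.
  replace (M / d * exp (- (d * a))) with (minus 0 (- (M / d) * exp (- (d * a))))
    by (unfold minus, plus, opp; simpl; ring).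
  apply (is_RInt_gen_derive (V := R_CompleteNormedModule) (at_point a) (Rbar_locally p_infty)
    (fun t => a <= t) ltac:(intros; lra) (Rle_refl a) (Rbar_locally_p_infty_ge a)
    (fun t => - (M / d) * exp (- (d * t)))).
  - intros t _. auto_derive; [exact I|]. field. lra.
  - intros t _. apply (@ex_derive_continuous R_AbsRing R_NormedModule). auto_derive. exact I.
  - apply (filterlim_at_point (fun t => - (M / d) * exp (- (d * t)))).
  - now apply (filterlim_Rmult_0 _ (- (M / d))), filterlim_exp_decay.
Qed.

(** * The Gamma function *)

Definition gamma_integrand (w : C) (t : R) : C :=
  (Cexp ((w - 1) * RtoC (ln t)) * RtoC (exp (- t)))%C.

Definition gamma_density (x t : R) : R := exp ((x - 1) * ln t - t).

Lemma gamma_integrand_polar (w : C) (t : R) :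
  gamma_integrand w t = circ (gamma_density (Re w) t) (Im w * ln t).
Proof.
  unfold gamma_integrand, gamma_density, circ, Cexp. destruct w as [x y].
  replace ((Re (x, y) - 1) * ln t - t) with ((x - 1) * ln t + - t) by (simpl; ring).
  rewrite exp_plus.
  replace (Re (((x, y) - 1) * RtoC (ln t))%C) with ((x - 1) * ln t) by (simpl; ring).
  replace (Im (((x, y) - 1) * RtoC (ln t))%C) with (y * ln t) by (simpl; ring).
  apply injective_projections; simpl; ring.
Qed.

Lemma Cmod_gamma_integrand w t : Cmod (gamma_integrand w t) = gamma_density (Re w) t.
Proof. rewrite gamma_integrand_polar. apply Cmod_circ, Rlt_le, exp_pos. Qed.

Lemma gamma_density_S x t : 0 < t -> gamma_density (x + 1) t = t * gamma_density x t.
Proof.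
  intros Ht. unfold gamma_density. rewrite <- (exp_ln t) at 3 by assumption.
  rewrite <- exp_plus. f_equal. ring.
Qed.

Lemma gamma_integrand_S w t :
  0 < t -> gamma_integrand (w + 1)%C t = (RtoC t * gamma_integrand w t)%C.
Proof.
  intros Ht. rewrite !gamma_integrand_polar, re_plus, im_plus, re_RtoC, im_RtoC.
  rewrite gamma_density_S, Rplus_0_r, circ_eq, (circ_eq (gamma_density _ _)), RtoC_mult
    by assumption.
  ring.
Qed.

Lemma is_derive_gamma_integrand w t :
  0 < t ->
  is_derive_RC (gamma_integrand (w + 1)%C) t
    (w * gamma_integrand w t - gamma_integrand (w + 1) t)%C.
Proof.
  intros Ht.
  apply (is_derive_ext (V := C_R_NormedModule)
    (fun t => circ (gamma_density (Re (w + 1)%C) t) (Im (w + 1)%C * ln t))).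
  { intros u. symmetry. apply gamma_integrand_polar. }
  rewrite gamma_integrand_S, gamma_integrand_polar by assumption. destruct w as [x y].
  assert (E : exp ((x + 1 - 1) * ln t - t) = t * exp ((x - 1) * ln t - t))
    by now apply gamma_density_S.
  apply is_derive_RC_pair. unfold circ, gamma_density. split; simpl.
  - auto_derive; [now repeat split|].
    replace ((x + 1 - 1) * ln t + - t) with ((x + 1 - 1) * ln t - t) by ring. rewrite E.
    rewrite !Rplus_0_r. field. lra.
  - auto_derive; [now repeat split|].
    replace ((x + 1 - 1) * ln t + - t) with ((x + 1 - 1) * ln t - t) by ring. rewrite E.
    rewrite !Rplus_0_r. field. lra.
Qed.

Lemma continuous_gamma_integrand w t : 0 < t -> continuous_RC (gamma_integrand w) t.
Proof.
  intros Ht. replace w with (w - 1 + 1)%C by ring.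
  exact (is_derive_RC_continuous _ _ _ (is_derive_gamma_integrand (w - 1) t Ht)).
Qed.

(* From [ln u <= u - 1] at [u = t / (2 x)]. *)
Lemma gamma_density_le x t :
  0 < x -> 0 < t -> gamma_density (x + 1) t <= exp (x * ln (2 * x) - x) * exp (- (/ 2 * t)).
Proof.
  intros Hx Ht. unfold gamma_density. rewrite <- exp_plus. apply exp_le_mono.
  pose proof (ln_le_sub_1 (t / (2 * x)) ltac:(apply Rdiv_lt_0_compat; lra)) as H.
  rewrite ln_div in H by lra. apply (Rmult_le_compat_l x) in H; [|lra].
  replace (x * (t / (2 * x) - 1)) with (t / 2 - x) in H by (field; lra). lra.
Qed.

Lemma ex_RInt_gen_gamma_0_1 w :
  0 < Re w -> ex_RInt_gen_C (gamma_integrand w) (at_right 0) (at_point 1).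
Proof.
  intros Hw.
  assert (Hconv : forall x y t, 0 < x <= 1 -> 0 < y <= 1 -> x <= t <= y -> 0 < t <= 1)
    by (intros; lra).
  assert (H0 : at_right 0 (fun t => 0 < t <= 1)) by apply at_right_0_between, Rlt_0_1.
  assert (H1 : at_point 1 (fun t => 0 < t <= 1)) by (unfold at_point; lra).
  assert (Hcont : forall t, 0 < t <= 1 -> continuous (fun t => Rpower t (Re w - 1)) t).
  { intros t Ht. apply (@ex_derive_continuous R_AbsRing R_NormedModule).
    unfold Rpower. auto_derive. lra. }
  apply (ex_RInt_gen_dominated (V := C_R_CompleteNormedModule) _ _ _ Hconv H0 H1 (gamma_integrand w)
    (fun t => Rpower t (Re w - 1))).
  - intros t Ht. now apply continuous_gamma_integrand.
  - exact Hcont.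
  - intros t Ht. rewrite C_R_norm, Cmod_gamma_integrand. apply exp_le_mono. lra.
  - eexists. apply (is_RInt_gen_derive (V := R_CompleteNormedModule) _ _ _ Hconv H0 H1
      (fun t => / Re w * Rpower t (Re w))) with (la := 0).
    + intros t Ht. unfold Rpower. auto_derive; [lra|].
      replace ((Re w - 1) * ln t) with (Re w * ln t + - ln t) by ring.
      rewrite exp_plus, exp_Ropp, exp_ln by lra. field. lra.
    + exact Hcont.
    + now apply (filterlim_Rmult_0 _ (/ Re w)), filterlim_Rpower_at_right_0.
    + apply (filterlim_at_point (fun t => / Re w * Rpower t (Re w))).
Qed.

Lemma ex_RInt_gen_gamma_1_infty w :
  0 < Re w -> ex_RInt_gen_C (gamma_integrand w) (at_point 1) (Rbar_locally p_infty).
Proof.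
  intros Hw. set (K := exp (Re w * ln (2 * Re w) - Re w)).
  apply (ex_RInt_gen_dominated (V := C_R_CompleteNormedModule) (at_point 1) (Rbar_locally p_infty)
    (fun t => 1 <= t) ltac:(intros; lra) (Rle_refl 1) (Rbar_locally_p_infty_ge 1)
    (gamma_integrand w) (fun t => K * exp (- (/ 2 * t)))).
  - intros t Ht. apply continuous_gamma_integrand. lra.
  - intros t _. apply (@ex_derive_continuous R_AbsRing R_NormedModule). auto_derive. exact I.
  - intros t Ht. rewrite C_R_norm, Cmod_gamma_integrand.
    eapply Rle_trans; [|apply gamma_density_le; lra].
    rewrite gamma_density_S by lra. rewrite <- (Rmult_1_l (gamma_density _ _)) at 1.
    apply Rmult_le_compat_r; [apply Rlt_le, exp_pos|assumption].
  - eexists. apply is_RInt_gen_exp_decay. lra.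
Qed.

Lemma Cgamma_correct w :
  0 < Re w -> is_RInt_gen_C (gamma_integrand w) (at_right 0) (Rbar_locally p_infty) (Cgamma w).
Proof.
  intros Hw. apply (RInt_gen_C_correct (gamma_integrand w) (at_right 0) (Rbar_locally p_infty)).
  apply (ex_RInt_gen_Chasles (V := C_R_NormedModule)) with 1.
  - now apply ex_RInt_gen_gamma_0_1.
  - now apply ex_RInt_gen_gamma_1_infty.
Qed.

Lemma is_RInt_gen_C_derive_pos (G g : R -> C) (l0 l1 : C) :
  (forall t, 0 < t -> is_derive_RC G t (g t)) -> (forall t, 0 < t -> continuous_RC g t) ->
  filterlim G (at_right 0) (locally (T := C_R_NormedModule) l0) ->
  filterlim G (Rbar_locally p_infty) (locally (T := C_R_NormedModule) l1) ->
  is_RInt_gen_C g (at_right 0) (Rbar_locally p_infty) (l1 - l0)%C.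
Proof.
  exact (is_RInt_gen_derive (V := C_R_CompleteNormedModule) (at_right 0) (Rbar_locally p_infty)
    (fun t => 0 < t)
    ltac:(intros; lra) at_right_0_pos (Rbar_locally_p_infty_gt 0) G g l0 l1).
Qed.

Lemma filterlim_gamma_integrand_0 w :
  0 < Re w ->
  filterlim (gamma_integrand (w + 1)%C) (at_right 0)
    (locally (T := C_R_NormedModule) (RtoC 0)).
Proof.
  intros Hw.
  apply (filterlim_C_0_dominated _ _ (fun t => Rpower t (Re w)));
    [|now apply filterlim_Rpower_at_right_0].
  generalize at_right_0_pos. apply filter_imp. intros t Ht.
  rewrite Cmod_gamma_integrand, re_plus, re_RtoC. apply exp_le_mono. lra.
Qed.

Lemma filterlim_gamma_integrand_p_infty w :
  0 < Re w ->
  filterlim (gamma_integrand (w + 1)%C) (Rbar_locally p_infty)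
    (locally (T := C_R_NormedModule) (RtoC 0)).
Proof.
  intros Hw. set (K := exp (Re w * ln (2 * Re w) - Re w)).
  apply (filterlim_C_0_dominated _ _ (fun t => K * exp (- (/ 2 * t)))).
  - generalize (Rbar_locally_p_infty_gt 0). apply filter_imp. intros t Ht.
    rewrite Cmod_gamma_integrand, re_plus, re_RtoC. now apply gamma_density_le.
  - apply (filterlim_Rmult_0 _ K), filterlim_exp_decay. lra.
Qed.

Lemma Cgamma_S w : 0 < Re w -> Cgamma (w + 1)%C = (w * Cgamma w)%C.
Proof.
  intros Hw.
  assert (Hw1 : 0 < Re (w + 1)%C) by (rewrite re_plus, re_RtoC; lra).
  pose proof (is_RInt_gen_C_derive_pos (gamma_integrand (w + 1)%C) _ _ _
    (is_derive_gamma_integrand w)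
    ltac:(intros t Ht; apply continuous_RC_minus;
          [apply continuous_RC_mult; [apply continuous_RC_const|]|];
          now apply continuous_gamma_integrand)
    (filterlim_gamma_integrand_0 w Hw) (filterlim_gamma_integrand_p_infty w Hw)) as Hparts.
  pose proof (is_RInt_gen_C_plus _ _ _ _ _ _ Hparts (Cgamma_correct _ Hw1)) as Hsum.
  apply (is_RInt_gen_ext (V := C_R_NormedModule) _ (fun t => w * gamma_integrand w t)%C) in Hsum.
  - rewrite <- (is_RInt_gen_C_unique _ _ _ _ _ Hsum
      (is_RInt_gen_C_Cmult w _ _ _ _ (Cgamma_correct _ Hw))). ring.
  - apply filter_forall. intros ab t _. cbv beta.
    change ((w * gamma_integrand w t - gamma_integrand (w + 1) t + gamma_integrand (w + 1) t)%C
      = (w * gamma_integrand w t)%C). ring.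
Qed.

Lemma Cgamma_1 : Cgamma 1 = 1.
Proof.
  assert (H : is_RInt_gen_C (gamma_integrand 1) (at_right 0) (Rbar_locally p_infty) (0 - - (1))%C).
  { assert (Hder : forall t, is_derive_RC (fun t => RtoC (- exp (- t))) t (RtoC (exp (- t)))).
    { intros t. apply is_derive_RC_RtoC. auto_derive; [exact I|ring]. }
    apply (is_RInt_gen_C_derive_pos (fun t => RtoC (- exp (- t)))).
    - intros t Ht. evar_last; [apply Hder|].
      rewrite gamma_integrand_polar. unfold gamma_density, circ. simpl.
      rewrite Rmult_0_l, cos_0, sin_0. apply injective_projections; simpl; [|ring].
      rewrite Rmult_1_r. f_equal. ring.
    - intros t Ht. now apply continuous_gamma_integrand.
    - replace (- (1))%C with (RtoC (- exp (- 0))).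
      + eapply filterlim_filter_le_1;
          [apply filter_le_within|exact (is_derive_RC_continuous _ _ _ (Hder 0))].
      + rewrite Ropp_0, exp_0. apply RtoC_opp.
    - apply (filterlim_C_0_dominated _ _ (fun t => exp (- (1 * t))));
        [|apply filterlim_exp_decay; lra].
      apply filter_forall. intros t. rewrite Cmod_R, Rabs_Ropp, Rabs_pos_eq, Rmult_1_l
        by apply Rlt_le, exp_pos. lra. }
  transitivity (0 - - (1))%C; [|ring].
  exact (@is_RInt_gen_unique C_R_CompleteNormedModule _ _ _ _ (gamma_integrand 1) _ H).
Qed.

Lemma Cgamma_fact n : Cgamma (RtoC (INR (S n))) = RtoC (INR (fact n)).
Proof.
  induction n as [|n IH]; [exact Cgamma_1|].
  rewrite S_INR, RtoC_plus, Cgamma_S, IH, fact_simpl, mult_INR, RtoC_mult; [reflexivity|].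
  rewrite re_RtoC. apply lt_0_INR. lia.
Qed.

Fixpoint Crising (w : C) (n : nat) : C :=
  match n with O => RtoC 1 | S m => (Crising w m * (w + RtoC (INR m)))%C end.

Lemma Re_plus_INR_pos w n : 0 < Re w -> 0 < Re (w + RtoC (INR n))%C.
Proof. intros Hw. rewrite re_plus, re_RtoC. pose proof (pos_INR n). lra. Qed.

Lemma Cgamma_plus_INR w n : 0 < Re w -> Cgamma (w + RtoC (INR n))%C = (Crising w n * Cgamma w)%C.
Proof.
  intros Hw. induction n as [|n IH].
  - simpl. rewrite Cplus_0_r. ring.
  - rewrite S_INR, RtoC_plus, Cplus_assoc, Cgamma_S, IH by now apply Re_plus_INR_pos.
    simpl. ring.
Qed.

Lemma Crising_neq_0 w n : 0 < Re w -> Crising w n <> 0.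
Proof.
  intros Hw. induction n as [|n IH]; [exact C1_nz|].
  apply Cmult_neq_0; [exact IH|]. now apply Re_pos_neq_0, Re_plus_INR_pos.
Qed.

Lemma Rrising_le_Cmod_Crising w n : 0 < Re w -> Rrising (Re w) n <= Cmod (Crising w n).
Proof.
  intros Hw. induction n as [|n IH]; simpl; [rewrite Cmod_1; lra|].
  rewrite Cmod_mult. apply Rmult_le_compat; [|pose proof (pos_INR n); lra|exact IH|].
  - now apply Rlt_le, Rrising_pos.
  - rewrite <- (re_RtoC (INR n)), <- re_plus. apply Re_le_Cmod.
Qed.

Lemma circ_mult r s t u : (circ r t * circ s u)%C = circ (r * s) (t + u).
Proof. unfold circ. rewrite cos_plus, sin_plus. apply injective_projections; simpl; ring. Qed.

Lemma is_RInt_gen_le_pos (f g : R -> R) (lf lg : R) :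
  (forall t, 0 < t -> f t <= g t) ->
  is_RInt_gen f (at_right 0) (Rbar_locally p_infty) lf ->
  is_RInt_gen g (at_right 0) (Rbar_locally p_infty) lg -> lf <= lg.
Proof.
  intros Hle. apply is_RInt_gen_le; [exact at_right_0_le_p_infty|].
  apply Filter_prod with (fun t => 0 < t) (fun _ => True);
    [exact at_right_0_pos|exact filter_true|].
  intros x y Hx _ t Ht. apply Hle. simpl in Ht. lra.
Qed.

Lemma is_RInt_gen_scal_minus {Fa Fb : (R -> Prop) -> Prop} {FFa : Filter Fa} {FFb : Filter Fb}
    (f g : R -> R) (k lf lg : R) :
  is_RInt_gen f Fa Fb lf -> is_RInt_gen g Fa Fb lg ->
  is_RInt_gen (fun t => f t - k * g t) Fa Fb (lf - k * lg).
Proof.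
  intros Hf Hg. apply (is_RInt_gen_minus (V := R_NormedModule) f (fun t => k * g t)); [assumption|].
  now apply (is_RInt_gen_scal (V := R_NormedModule)).
Qed.

Definition Rgamma (x : R) : R := Re (Cgamma (RtoC x)).

Lemma is_RInt_gen_gamma_density x :
  0 < x -> is_RInt_gen (gamma_density x) (at_right 0) (Rbar_locally p_infty) (Rgamma x).
Proof.
  intros Hx. eapply is_RInt_gen_ext;
    [|exact (is_RInt_gen_linear _ _ _ is_linear_Re (Cgamma_correct (RtoC x) Hx))].
  apply filter_forall. intros ab t _. rewrite gamma_integrand_polar. simpl.
  rewrite Rmult_0_l, cos_0. apply Rmult_1_r.
Qed.

Lemma Rgamma_S x : 0 < x -> Rgamma (x + 1) = x * Rgamma x.
Proof.
  intros Hx. unfold Rgamma. rewrite RtoC_plus, Cgamma_S by exact Hx. apply re_scal_l.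
Qed.

Lemma Rgamma_1 : Rgamma 1 = 1.
Proof. unfold Rgamma. now rewrite Cgamma_1. Qed.

(* The tangent line of [t -> t^(x-1)] at [t = 1] lies below the curve. *)
Lemma Rgamma_ge_1 x : 2 <= x -> 1 <= Rgamma x.
Proof.
  intros Hx.
  assert (H : is_RInt_gen (fun t => (x - 1) * gamma_density (1 + 1) t - (x - 2) * gamma_density 1 t)
    (at_right 0) (Rbar_locally p_infty) ((x - 1) * Rgamma (1 + 1) - (x - 2) * Rgamma 1)).
  { apply is_RInt_gen_scal_minus; [apply (is_RInt_gen_scal (V := R_NormedModule))|];
      apply is_RInt_gen_gamma_density; lra. }
  rewrite Rgamma_S, Rgamma_1 in H by lra.
  replace 1 with ((x - 1) * (1 * 1) - (x - 2) * 1) at 1 by ring.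
  apply (is_RInt_gen_le_pos _ _ _ _) with (2 := H) (3 := is_RInt_gen_gamma_density x ltac:(lra)).
  intros t Ht. rewrite gamma_density_S by assumption. unfold gamma_density.
  replace ((1 - 1) * ln t - t) with (- t) by ring.
  replace ((x - 1) * ln t - t) with ((x - 2) * ln t + ln t + - t) by ring.
  rewrite !exp_plus, exp_ln by assumption.
  replace ((x - 1) * (t * exp (- t)) - (x - 2) * exp (- t))
    with ((1 + (x - 2) * (1 - / t)) * t * exp (- t)) by (field; lra).
  apply Rmult_le_compat_r; [apply Rlt_le, exp_pos|].
  apply Rmult_le_compat_r; [lra|].
  eapply Rle_trans; [|apply exp_ineq1_le]. apply Rplus_le_compat_l, Rmult_le_compat_l; [lra|].
  now apply ln_ge_1_sub_inv.
Qed.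

Lemma two_sinh_ge q : 0 <= q -> 2 * q <= exp q - exp (- q).
Proof.
  intros [Hq|<-]; [|rewrite Ropp_0; lra].
  destruct (MVT_cor2 (fun q => exp q - exp (- q) - 2 * q) (fun q => exp q + exp (- q) - 2) 0 q Hq)
    as [c [E _]].
  - intros c _. apply is_derive_Reals. auto_derive; [exact I|ring].
  - rewrite Ropp_0, exp_0 in E.
    pose proof (exp_ineq1_le c). pose proof (exp_ineq1_le (- c)). nra.
Qed.

Lemma two_cosh_ge q : 2 + q ^ 2 <= exp q + exp (- q).
Proof.
  assert (Hpos : forall q, 0 <= q -> 2 + q ^ 2 <= exp q + exp (- q)).
  { clear q. intros q Hq. pose proof (two_sinh_ge (q / 2) ltac:(lra)) as H.
    replace q with (q / 2 + q / 2) at 2 3 by field. rewrite Ropp_plus_distr, !exp_plus.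
    assert (E : exp (q / 2) * exp (- (q / 2)) = 1)
      by (rewrite <- exp_plus, Rplus_opp_r; apply exp_0).
    nra. }
  destruct (Rle_dec 0 q) as [Hq|Hq]; [now apply Hpos|].
  specialize (Hpos (- q) ltac:(lra)). rewrite Ropp_involutive in Hpos. nra.
Qed.

Lemma ln_sqr_le u : 0 < u -> ln u ^ 2 <= u - 2 + / u.
Proof.
  intros Hu. pose proof (two_cosh_ge (ln u)) as H.
  rewrite exp_Ropp, exp_ln in H by assumption. lra.
Qed.

Lemma cos_ge_1_sub_sqr v : 1 - v ^ 2 / 2 <= cos v.
Proof.
  destruct (Rle_dec (v ^ 2) 4) as [Hv|Hv].
  - destruct (pre_cos_bound v 0) as [H _]; [nra..|].
    unfold cos_approx, cos_term in H. simpl in H. lra.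
  - pose proof (COS_bound v). lra.
Qed.

(* The mass of the density [t^(x-1) e^(-t)] concentrates near [t = x], where [t^(iy)] is close
   to [x^(iy)]; quantitatively, [cos (y ln (t/x)) >= 1 - y^2/2 (t/x - 2 + x/t)]. *)
Lemma Re_rotated_Cgamma_ge x y :
  1 < x ->
  (1 - y ^ 2 / 2 / (x - 1)) * Rgamma x <= Re (circ 1 (- (y * ln x)) * Cgamma (x, y))%C.
Proof.
  intros Hx. set (q := y ^ 2 / 2). assert (Hq : 0 <= q) by (unfold q; nra).
  assert (H : is_RInt_gen
    (fun t => (1 + 2 * q) * gamma_density x t - q / x * gamma_density (x + 1) t
              - q * x * gamma_density (x - 1) t) (at_right 0) (Rbar_locally p_infty)
    ((1 + 2 * q) * Rgamma x - q / x * Rgamma (x + 1) - q * x * Rgamma (x - 1))).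
  { do 2 (apply is_RInt_gen_scal_minus; [|apply is_RInt_gen_gamma_density; lra]).
    apply (is_RInt_gen_scal (V := R_NormedModule)), is_RInt_gen_gamma_density. lra. }
  assert (Hw : is_RInt_gen (fun t => Re (circ 1 (- (y * ln x)) * gamma_integrand (x, y) t)%C)
    (at_right 0) (Rbar_locally p_infty) (Re (circ 1 (- (y * ln x)) * Cgamma (x, y))%C)).
  { assert (Hxy : 0 < Re (x, y)) by (simpl; lra).
    exact (is_RInt_gen_linear _ _ _ is_linear_Re
      (is_RInt_gen_C_Cmult _ _ _ _ _ (Cgamma_correct (x, y) Hxy))). }
  pose proof (Rgamma_S (x - 1) ltac:(lra)) as Epred. replace (x - 1 + 1) with x in Epred by ring.
  rewrite Rgamma_S in H by lra.
  replace ((1 - q / (x - 1)) * Rgamma x) with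
    ((1 + 2 * q) * Rgamma x - q / x * (x * Rgamma x) - q * x * Rgamma (x - 1))
    by (rewrite Epred; field; lra).
  apply (is_RInt_gen_le_pos _ _ _ _) with (2 := H) (3 := Hw).
  intros t Ht. rewrite gamma_integrand_polar, circ_mult. cbn [Re Im fst snd circ].
  rewrite gamma_density_S by assumption.
  assert (Ed : gamma_density x t = t * gamma_density (x - 1) t)
    by (rewrite <- gamma_density_S by assumption; f_equal; ring).
  replace (gamma_density (x - 1) t) with (/ t * gamma_density x t) by (rewrite Ed; field; lra).
  replace ((1 + 2 * q) * gamma_density x t - q / x * (t * gamma_density x t)
    - q * x * (/ t * gamma_density x t))
    with (gamma_density x t * (1 - q * (t / x - 2 + / (t / x)))) by (field; lra).
  rewrite Rmult_1_l. apply Rmult_le_compat_l; [apply Rlt_le, exp_pos|].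
  eapply Rle_trans; [|apply cos_ge_1_sub_sqr].
  pose proof (ln_sqr_le (t / x) ltac:(apply Rdiv_lt_0_compat; lra)) as L.
  apply (Rmult_le_compat_l q) in L; [|assumption]. rewrite ln_div in L at 1 by lra.
  unfold q in *. lra.
Qed.

Lemma Cgamma_neq_0 w : 0 < Re w -> Cgamma w <> 0.
Proof.
  intros Hw E. destruct (INR_unbounded (2 + Im w ^ 2)) as [n Hn].
  set (x := Re w + INR n). set (y := Im w).
  assert (Exy : (x, y) = (w + RtoC (INR n))%C)
    by (unfold x, y; destruct w; apply injective_projections; simpl; ring).
  assert (Hy : 0 <= y ^ 2) by apply pow2_ge_0.
  assert (Hx : 2 + y ^ 2 < x) by (unfold x, y in *; lra).
  pose proof (Re_rotated_Cgamma_ge x y ltac:(lra)) as H.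
  rewrite Exy, Cgamma_plus_INR, E, !Cmult_0_r in H by assumption. simpl (Re 0) in H.
  pose proof (Rgamma_ge_1 x ltac:(lra)) as G.
  assert (y ^ 2 / 2 / (x - 1) < 1) by (apply Rlt_div_l; lra). nra.
Qed.

Lemma Cgamma_beta w n :
  0 < Re w ->
  (Cgamma w * Cgamma (RtoC (INR (S n))) / Cgamma (w + RtoC (INR (S n))))%C
  = (RtoC (INR (fact n)) / Crising w (S n))%C.
Proof.
  intros Hw. rewrite Cgamma_fact, Cgamma_plus_INR by assumption.
  field. split; [now apply Crising_neq_0|now apply Cgamma_neq_0].
Qed.

(** * Estimates for the pull-back by the logarithm *)

Lemma sin_ge_third w : 0 <= w <= PI / 2 -> w / 3 <= sin w.
Proof.
  intros Hw. pose proof PI_4. pose proof PI_RGT_0.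
  destruct (sin_bound w 0) as [H3 _]; [lra|lra|].
  unfold sin_approx, sin_term in H3. simpl in H3.
  assert (Htaylor : w - w * w * w / 6 <= sin w) by lra.
  assert (w * w <= 4) by nra. nra.
Qed.

Lemma Cmod_1p_circ_sqr al t :
  Cmod (1 + circ al t)%C ^ 2 = (1 - al) ^ 2 + 4 * al * sin (Rabs (t - PI) / 2) ^ 2.
Proof.
  assert (Ecos : cos t = - cos (Rabs (t - PI))).
  { unfold Rabs. destruct Rcase_abs; [|rewrite <- (cos_neg (t - PI))];
      replace (- (t - PI)) with (- t + PI) by ring; rewrite neg_cos, cos_neg; ring. }
  replace (Rabs (t - PI)) with (2 * (Rabs (t - PI) / 2)) in Ecos by field.
  rewrite cos_2a_sin in Ecos.
  rewrite Cmod2_alt.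
  transitivity (1 + 2 * al * cos t + al ^ 2 * (Rsqr (sin t) + Rsqr (cos t)));
    [unfold Rsqr; simpl; ring|].
  rewrite sin2_cos2, Ecos. ring.
Qed.

Lemma Cmod_1p_circ_ge al t :
  1 / 2 <= al < 1 -> 0 <= t <= 2 * PI ->
  (1 - al + Rabs (t - PI)) / 6 <= Cmod (1 + circ al t)%C.
Proof.
  intros Hal Ht. pose proof (Cmod_1p_circ_sqr al t) as Esqr.
  assert (Htau : Rabs (t - PI) <= PI) by (apply Rabs_le; lra).
  pose proof (Rabs_pos (t - PI)) as Htau0. set (tau := Rabs (t - PI)) in *.
  pose proof (sin_ge_third (tau / 2) ltac:(lra)) as Hsin.
  apply Rsqr_incr_0_var; [|apply Cmod_ge_0].
  rewrite !Rsqr_pow2, Esqr.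
  assert (Hsin2 : (tau / 6) ^ 2 <= sin (tau / 2) ^ 2) by (apply pow_incr; lra).
  assert (2 * (tau / 6) ^ 2 <= 4 * al * sin (tau / 2) ^ 2).
  { apply Rmult_le_compat; [lra|apply pow2_ge_0|lra|exact Hsin2]. }
  pose proof (pow2_ge_0 (1 - al - tau)). pose proof (pow2_ge_0 (1 - al)). lra.
Qed.

Lemma exp_Clog_circ_le b c al t :
  0 <= b <= c -> 1 / 2 <= al < 1 -> 0 <= t <= 2 * PI ->
  exp (b * Cmod (Clog (1 + circ al t)%C)) <=
  exp (c * (2 * ln 2 + ln 6 + 2)) * Rpower (1 - al + Rabs (t - PI)) (- c).
Proof.
  intros Hb Hal Ht. unfold Rpower. rewrite <- exp_plus. apply exp_le_mono.
  pose proof (Cmod_1p_circ_ge al t Hal Ht) as Hge.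
  set (q := 1 - al + Rabs (t - PI)) in *.
  assert (Hq : 0 < q) by (unfold q; pose proof (Rabs_pos (t - PI)); lra).
  set (u := (1 + circ al t)%C) in *. assert (Hu : 0 < Cmod u) by lra.
  assert (Hu2 : Cmod u <= 2).
  { unfold u. eapply Rle_trans; [apply Cmod_triangle|]. rewrite Cmod_1, Cmod_circ; lra. }
  assert (Hre : 0 < Re u).
  { pose proof (re_le_Cmod (circ al t)) as J. rewrite Cmod_circ in J by lra.
    apply Rabs_le_between in J. unfold u. rewrite re_plus, re_RtoC. lra. }
  pose proof ln_lt_2.
  assert (Lu : ln q - ln 6 <= ln (Cmod u)) by (rewrite <- ln_div by lra; apply ln_le; lra).
  assert (Lu2 : ln (Cmod u) <= ln 2) by now apply ln_le.
  assert (Hlog : Cmod (Clog u) <= 2 * ln 2 + ln 6 + 2 - ln q).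
  { eapply Rle_trans; [apply Cmod_le_Rabs_plus|].
    apply Rle_trans with ((2 * ln 2 - ln (Cmod u)) + 2); [|lra].
    unfold Clog; cbn [Re Im fst snd]. apply Rplus_le_compat; [apply Rabs_le; lra|].
    rewrite Carg_right by assumption. pose proof (atan_bound (Im u / Re u)). pose proof PI_4.
    apply Rabs_le; lra. }
  pose proof (Cmod_ge_0 (Clog u)).
  apply Rle_trans with (c * Cmod (Clog u)); [apply Rmult_le_compat_r; lra|].
  apply Rle_trans with (c * (2 * ln 2 + ln 6 + 2 - ln q)); [apply Rmult_le_compat_l; lra|].
  right. ring.
Qed.

Lemma is_RInt_Rabs_sub (g : R -> R) (p l I : R) :
  0 <= l -> is_RInt g 0 l I -> is_RInt (fun t => g (Rabs (t - p))) (p - l) (p + l) (2 * I).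
Proof.
  intros Hl Hg. replace (2 * I) with (I + I) by ring.
  apply (is_RInt_Chasles (V := R_NormedModule)) with p.
  - apply (is_RInt_ext (V := R_NormedModule) (fun t => - (-1 * g (-1 * t + p)))).
    { intros t Ht. rewrite Rmin_left, Rmax_right in Ht by lra.
      rewrite Rabs_left1 by lra. replace (- (t - p)) with (-1 * t + p) by ring.
      change (- (-1 * g (-1 * t + p)) = g (-1 * t + p)). ring. }
    replace I with (- - I) by ring.
    apply (is_RInt_opp (V := R_NormedModule)), (is_RInt_comp_lin (V := R_NormedModule) g (-1) p).
    replace (-1 * (p - l) + p) with l by ring. replace (-1 * p + p) with 0 by ring.
    exact (is_RInt_swap (V := R_NormedModule) g l 0 I Hg).
  - apply (is_RInt_ext (V := R_NormedModule) (fun t => 1 * g (1 * t + - p))).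
    { intros t Ht. rewrite Rmin_left, Rmax_right in Ht by lra.
      rewrite Rabs_pos_eq by lra. replace (t - p) with (1 * t + - p) by ring. apply Rmult_1_l. }
    apply (is_RInt_comp_lin (V := R_NormedModule) g 1 (- p)).
    replace (1 * p + - p) with 0 by ring. now replace (1 * (p + l) + - p) with l by ring.
Qed.

Lemma is_RInt_Rpower_shift d c l :
  0 < d -> 1 < c -> 0 <= l ->
  is_RInt (fun u => Rpower (d + u) (- c)) 0 l
    ((Rpower d (1 - c) - Rpower (d + l) (1 - c)) / (c - 1)).
Proof.
  intros Hd Hc Hl.
  replace ((Rpower d (1 - c) - Rpower (d + l) (1 - c)) / (c - 1))
    with (- / (c - 1) * Rpower (d + l) (1 - c) - - / (c - 1) * Rpower (d + 0) (1 - c))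
    by (rewrite Rplus_0_r; field; lra).
  apply (is_RInt_derive (V := R_CompleteNormedModule)
      (fun u => - / (c - 1) * Rpower (d + u) (1 - c)));
    rewrite Rmin_left, Rmax_right by lra; intros u Hu.
  - unfold Rpower. auto_derive; [lra|].
    replace ((1 - c) * ln (d + u)) with (- c * ln (d + u) + ln (d + u)) by ring.
    rewrite exp_plus, exp_ln by lra. field. lra.
  - apply (@ex_derive_continuous R_AbsRing R_NormedModule). unfold Rpower. auto_derive. lra.
Qed.

Lemma is_RInt_Rpower_Rabs_sub_PI_le d c :
  0 < d -> 1 < c ->
  exists m, is_RInt (fun t => Rpower (d + Rabs (t - PI)) (- c)) 0 (2 * PI) m
    /\ m <= 2 / (c - 1) * Rpower d (1 - c).
Proof.
  intros Hd Hc. pose proof PI_RGT_0 as Hpi. eexists. split.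
  - replace 0 with (PI - PI) by ring. replace (2 * PI) with (PI + PI) by ring.
    apply (is_RInt_Rabs_sub (fun u => Rpower (d + u) (- c))), is_RInt_Rpower_shift; lra.
  - pose proof (Rpower_pos (d + PI) (1 - c)).
    replace (2 / (c - 1) * Rpower d (1 - c)) with (2 * (Rpower d (1 - c) / (c - 1)))
      by (field; lra).
    apply Rmult_le_compat_l; [lra|]. apply Rmult_le_compat_r; [|lra].
    apply Rlt_le, Rinv_0_lt_compat. lra.
Qed.

Lemma unit_disc_Re_pos (s : C) : Cmod (s - 1)%C < 1 -> 0 < Re s.
Proof.
  intros H. pose proof (re_le_Cmod (s - 1)%C) as K.
  replace (Re (s - 1)%C) with (Re s - 1) in K by (simpl; unfold Re; ring).
  apply Rabs_le_between in K. lra.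
Qed.

Lemma unit_disc_scal (s : R) (v : C) :
  0 < s <= 1 -> Cmod v < 1 -> Cmod (RtoC s * (1 + v) - 1)%C < 1.
Proof.
  intros Hs Hv.
  replace (RtoC s * (1 + v) - 1)%C with (RtoC (s - 1) + RtoC s * v)%C
    by (rewrite RtoC_minus; ring).
  eapply Rle_lt_trans; [apply Cmod_triangle|].
  rewrite Cmod_mult, !Cmod_R, (Rabs_left1 (s - 1)), (Rabs_pos_eq s) by lra. nra.
Qed.

Definition log_pullback (F : C -> C) (lam : R) (s : C) : C := F (RtoC lam * - Clog s)%C.

Lemma Delta_lam_log lam (s : C) :
  Cmod (s - 1)%C < 1 -> Delta_lam lam (RtoC lam * - Clog s)%C.
Proof. intros H. exists (- Clog s)%C. split; [now exists s|reflexivity]. Qed.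

Lemma holomorphic_log_pullback F lam :
  holomorphic_on (Delta_lam lam) F ->
  holomorphic_on (fun s => Cmod (s - 1)%C < 1) (log_pullback F lam).
Proof.
  intros HF s Hs. destruct (HF _ (Delta_lam_log lam s Hs)) as [l Hl]. eexists.
  apply (is_derive_C_comp F (fun s => RtoC lam * - Clog s)%C); [exact Hl|].
  apply (is_derive_C_ext_ball (fun y => - RtoC lam * Clog y)%C _ _ _ 1); [lra|intros; ring|].
  apply is_derive_C_Cmult, is_derive_Clog, unit_disc_Re_pos, Hs.
Qed.

Lemma inv_pow_one_sub_le (N : R) (n : nat) :
  INR n + 1 <= N -> / (1 - / (2 * N)) ^ n <= exp 1.
Proof.
  intros HN. pose proof (pos_INR n) as Hn.
  replace (1 - / (2 * N)) with (/ (1 + / (2 * N - 1))) by (field; lra).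
  rewrite <- pow_inv, Rinv_inv.
  assert (Hpos : 0 < / (2 * N - 1)) by (apply Rinv_0_lt_compat; lra).
  apply Rle_trans with (exp (/ (2 * N - 1)) ^ n).
  - apply pow_incr. split; [lra|apply exp_ineq1_le].
  - rewrite exp_pow. apply exp_le_mono. apply Rle_div_l; lra.
Qed.

Lemma fact_Rpower_le_Rrising c n :
  1 <= c -> INR (fact n) * Rpower (INR n + c) (c - 1) <= Rpower c (c - 1) * Rrising c n.
Proof.
  intros Hc. pose proof (pos_INR n) as Hn. pose proof (Rrising_pos c n ltac:(lra)) as Pc.
  pose proof (Rpower_pos (INR n + c) (c - 1)) as Pp.
  pose proof (Rrising_ratio_le 1 c n ltac:(lra)) as H. rewrite Rrising_1 in H.
  apply Rle_div_l in H; [|assumption].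
  replace (Rpower c (c - 1)) with (Rpower (c / (c + INR n)) (c - 1) * Rpower (INR n + c) (c - 1)).
  - replace (Rpower (c / (c + INR n)) (c - 1) * Rpower (INR n + c) (c - 1) * Rrising c n)
      with (Rpower (c / (c + INR n)) (c - 1) * Rrising c n * Rpower (INR n + c) (c - 1)) by ring.
    apply Rmult_le_compat_r; lra.
  - rewrite Rpower_mult_distr by (try apply Rdiv_lt_0_compat; lra). f_equal. field. lra.
Qed.

Section PullbackEstimates.

Variables (F : C -> C) (lam A B : R).
Hypothesis Hlam : 0 < lam.
Hypothesis HA : 0 < A.
Hypothesis HB : 0 < B.
Hypothesis F_holomorphic : holomorphic_on (Delta_lam lam) F.
Hypothesis F_bound : forall zeta, Delta_lam lam zeta -> Cmod (F zeta) <= A * exp (B * Cmod zeta).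

Lemma Cmod_log_pullback_le (s : R) (v : C) :
  0 < s <= 1 -> Cmod v < 1 ->
  Cmod (log_pullback F lam (RtoC s * (1 + v))%C)
    <= A * Rpower s (- (lam * B)) * exp (lam * B * Cmod (Clog (1 + v)%C)).
Proof.
  intros Hs Hv. eapply Rle_trans; [now apply F_bound, Delta_lam_log, unit_disc_scal|].
  assert (Hre : 0 < Re (1 + v)%C).
  { apply unit_disc_Re_pos. now replace (1 + v - 1)%C with v by ring. }
  unfold Rpower. rewrite Rmult_assoc, <- exp_plus. apply Rmult_le_compat_l; [lra|].
  apply exp_le_mono.
  rewrite Clog_scal, Cmod_mult, Cmod_R, Cmod_opp, Rabs_pos_eq by (assumption || lra).
  assert (Hln : ln s <= 0) by (rewrite <- ln_1; apply ln_le; lra).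
  pose proof (Cmod_triangle (RtoC (ln s)) (Clog (1 + v)%C)) as T.
  rewrite Cmod_R, Rabs_left1 in T by assumption.
  assert (0 < lam * B) by now apply Rmult_lt_0_compat.
  replace (- (lam * B) * ln s + lam * B * Cmod (Clog (1 + v)%C)) with
    (lam * B * (- ln s + Cmod (Clog (1 + v)%C))) by ring.
  replace (B * (lam * Cmod (RtoC (ln s) + Clog (1 + v))%C)) with
    (lam * B * Cmod (RtoC (ln s) + Clog (1 + v))%C) by ring.
  apply Rmult_le_compat_l; lra.
Qed.

(* Cauchy's estimate on the circle of radius [al s] about [s]. *)
Lemma log_pullback_derive_n_le (s al : R) (n : nat) (g : R -> R) (m : R) :
  0 < s <= 1 -> 0 < al < 1 ->
  (forall t, 0 <= t <= 2 * PI -> exp (lam * B * Cmod (Clog (1 + circ al t)%C)) <= g t) ->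
  is_RInt g 0 (2 * PI) m ->
  s ^ n * Cmod (C_derive_n n (log_pullback F lam) (RtoC s)) <=
    INR (fact n) / al ^ n * (A * Rpower s (- (lam * B))) * (m / (2 * PI)).
Proof.
  intros Hs Hal Hg Hm. pose proof PI_RGT_0 as Hpi. set (Q := A * Rpower s (- (lam * B))).
  assert (HQ : 0 < Q) by (apply Rmult_lt_0_compat; [assumption|apply Rpower_pos]).
  assert (Hr : 0 < s * al) by (apply Rmult_lt_0_compat; lra).
  assert (Hhol : holomorphic_on (fun y => Cmod (y - RtoC s)%C <= s * al) (log_pullback F lam)).
  { intros y Hy. apply holomorphic_log_pullback; [assumption|].
    replace (y - 1)%C with ((y - RtoC s) + RtoC (s - 1))%C by (rewrite RtoC_minus; ring).
    eapply Rle_lt_trans; [apply Cmod_triangle|]. rewrite Cmod_R, Rabs_left1 by lra. nra. }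
  assert (Hbound : forall t, 0 <= t <= 2 * PI ->
    Cmod (log_pullback F lam (RtoC s + circ (s * al) t)%C) <= Q * g t).
  { intros t Ht.
    replace (RtoC s + circ (s * al) t)%C with (RtoC s * (1 + circ al t))%C
      by (apply injective_projections; simpl; ring).
    eapply Rle_trans; [apply Cmod_log_pullback_le; rewrite ?Cmod_circ; lra|].
    apply Rmult_le_compat_l; [lra|now apply Hg]. }
  pose proof (cauchy_estimate _ _ _ Hr Hhol n (fun t => Q * g t) (Q * m) Hbound
    (is_RInt_scal (V := R_NormedModule) g 0 (2 * PI) Q m Hm)) as H.
  apply (Rmult_le_compat_l (s ^ n)) in H; [|apply pow_le; lra].
  eapply Rle_trans; [exact H|]. right.
  pose proof (pow_lt s n ltac:(lra)). pose proof (pow_lt al n ltac:(lra)).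
  rewrite Rpow_mult_distr. field. repeat split; lra.
Qed.

Lemma log_pullback_derive_n_sup (s al : R) (n : nat) :
  0 < s <= 1 -> 0 < al < 1 ->
  s ^ n * Cmod (C_derive_n n (log_pullback F lam) (RtoC s)) <=
    INR (fact n) / al ^ n * (A * Rpower s (- (lam * B))) * Rpower (1 - al) (- (lam * B)).
Proof.
  intros Hs Hal. pose proof PI_RGT_0 as Hpi.
  set (q := Rpower (1 - al) (- (lam * B))).
  replace q with ((2 * PI - 0) * q / (2 * PI)) by (field; lra).
  apply log_pullback_derive_n_le with (fun _ => q); [assumption..| |].
  - intros t _. apply exp_le_mono.
    pose proof (Cmod_Clog_1p_le (circ al t)) as H. rewrite Cmod_circ in H by lra.
    specialize (H ltac:(lra)). assert (0 < lam * B) by now apply Rmult_lt_0_compat. nra.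
  - apply (is_RInt_const (V := R_NormedModule)).
Qed.

(* The radius is [al = 1 - 1 / (2 N)]. The pull-back is large only near [s = 0], so the mean
   over the circle beats the supremum by a factor [N]. *)
Lemma log_pullback_derive_n_mean (c s N : R) (n : nat) :
  1 < c -> lam * B <= c -> 0 < s <= 1 -> INR n + 1 <= N ->
  s ^ n * Cmod (C_derive_n n (log_pullback F lam) (RtoC s)) <=
    INR (fact n) * exp 1 * (A * Rpower s (- (lam * B)))
    * (exp (c * (2 * ln 2 + ln 6 + 2)) / (PI * (c - 1)) * Rpower (2 * N) (c - 1)).
Proof.
  intros Hc HBc Hs HN. pose proof PI_RGT_0 as Hpi. pose proof (pos_INR n) as Hn.
  assert (HlB : 0 < lam * B) by now apply Rmult_lt_0_compat.
  assert (HN2 : 0 < / (2 * N) <= / 2)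
    by (split; [apply Rinv_0_lt_compat|apply Rinv_le_contravar]; lra).
  pose proof (inv_pow_one_sub_le N n HN) as Hpow.
  set (al := 1 - / (2 * N)) in *. set (K := exp (c * (2 * ln 2 + ln 6 + 2))).
  assert (HK : 0 < K) by apply exp_pos.
  destruct (is_RInt_Rpower_Rabs_sub_PI_le (1 - al) c ltac:(unfold al; lra) Hc) as [m [Hm Hmle]].
  replace (Rpower (1 - al) (1 - c)) with (Rpower (2 * N) (c - 1)) in Hmle.
  2: { unfold al, Rpower. replace (1 - (1 - / (2 * N))) with (/ (2 * N)) by ring.
       rewrite ln_Rinv by lra. f_equal. ring. }
  eapply Rle_trans.
  { apply (log_pullback_derive_n_le s al n
        (fun t => K * Rpower (1 - al + Rabs (t - PI)) (- c)) (K * m));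
      [assumption|unfold al; lra| |exact (is_RInt_scal (V := R_NormedModule) _ 0 (2 * PI) K m Hm)].
    intros t Ht. apply exp_Clog_circ_le; unfold al; lra. }
  set (weight := A * Rpower s (- (lam * B))).
  assert (Hweight : 0 < weight) by (apply Rmult_lt_0_compat; [assumption|apply Rpower_pos]).
  pose proof (INR_fact_lt_0 n) as Hf.
  apply Rle_trans with (INR (fact n) / al ^ n * weight
    * (K / (2 * PI) * (2 / (c - 1) * Rpower (2 * N) (c - 1)))).
  - replace (K * m / (2 * PI)) with (K / (2 * PI) * m) by (field; lra).
    pose proof (pow_lt al n ltac:(unfold al; lra)).
    apply Rmult_le_compat_l; [apply Rmult_le_pos; [apply Rdiv_le_0_compat|]; lra|].
    apply Rmult_le_compat_l; [apply Rdiv_le_0_compat; lra|exact Hmle].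
  - replace (K / (2 * PI) * (2 / (c - 1) * Rpower (2 * N) (c - 1)))
      with (K / (PI * (c - 1)) * Rpower (2 * N) (c - 1)) by (field; lra).
    apply Rmult_le_compat_r.
    + apply Rmult_le_pos; [|apply Rlt_le, Rpower_pos]. apply Rdiv_le_0_compat; nra.
    + apply Rmult_le_compat_r; [lra|]. apply Rmult_le_compat_l; [lra|exact Hpow].
Qed.

Lemma log_pullback_derive_n_rising (c : R) :
  1 < c -> lam * B <= c ->
  exists M, 0 < M /\ forall n s, 0 < s <= 1 ->
    s ^ n * Cmod (C_derive_n n (log_pullback F lam) (RtoC s)) <=
    M * Rrising c n * Rpower s (- (lam * B)).
Proof.
  intros Hc HBc. pose proof PI_RGT_0 as Hpi.
  set (K := exp (c * (2 * ln 2 + ln 6 + 2)) / (PI * (c - 1)) * Rpower 2 (c - 1)).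
  assert (HK : 0 < K).
  { apply Rmult_lt_0_compat; [|apply Rpower_pos].
    apply Rdiv_lt_0_compat; [apply exp_pos|apply Rmult_lt_0_compat; lra]. }
  exists (exp 1 * A * K * Rpower c (c - 1)). split.
  { apply Rmult_lt_0_compat; [|apply Rpower_pos].
    do 2 (apply Rmult_lt_0_compat; [|assumption]). apply exp_pos. }
  intros n s Hs. pose proof (pos_INR n) as Hn.
  eapply Rle_trans; [apply (log_pullback_derive_n_mean c s (INR n + c)); lra|].
  rewrite <- Rpower_mult_distr by lra. set (weight := Rpower s (- (lam * B))).
  assert (Hweight : 0 < weight) by apply Rpower_pos. pose proof (exp_pos 1) as He.
  apply Rle_trans with (exp 1 * A * weight * K * (INR (fact n) * Rpower (INR n + c) (c - 1)));
    [right; unfold K; field; lra|].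
  apply Rle_trans with (exp 1 * A * weight * K * (Rpower c (c - 1) * Rrising c n)); [|right; ring].
  apply Rmult_le_compat_l; [|apply fact_Rpower_le_Rrising; lra].
  apply Rlt_le. do 3 (apply Rmult_lt_0_compat; [|assumption]). assumption.
Qed.

End PullbackEstimates.

(** * Stirling numbers and the coefficients [b_lam] *)

Lemma nth_padd p q k : nth k (padd p q) 0%Z = (nth k p 0 + nth k q 0)%Z.
Proof.
  revert q k. induction p as [|x p IH]; intros q k; [destruct k; reflexivity|].
  destruct q as [|y q]; [simpl; destruct k; lia|].
  destruct k as [|k]; simpl; [reflexivity|apply IH].
Qed.

Lemma nth_map_Zmult c p k : nth k (map (fun x => (c * x)%Z) p) 0%Z = (c * nth k p 0)%Z.
Proof. rewrite <- (Z.mul_0_r c) at 1. apply (map_nth (fun x => (c * x)%Z)). Qed.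

Lemma stirling1_S_0 n : stirling1 (S n) 0 = (- Z.of_nat n * stirling1 n 0)%Z.
Proof.
  unfold stirling1. cbn [falling_poly]. unfold mul_X_minus. now rewrite nth_padd, nth_map_Zmult.
Qed.

Lemma stirling1_S_S n k :
  stirling1 (S n) (S k) = (stirling1 n k - Z.of_nat n * stirling1 n (S k))%Z.
Proof.
  unfold stirling1. cbn [falling_poly]. unfold mul_X_minus. rewrite nth_padd, nth_map_Zmult.
  cbn [nth]. lia.
Qed.

Lemma stirling1_gt n k : (n < k)%nat -> stirling1 n k = 0%Z.
Proof.
  revert k. induction n as [|n IH]; intros k Hk.
  - destruct k as [|[|k]]; [lia|reflexivity|]. unfold stirling1. simpl. now destruct k.
  - destruct k as [|k]; [lia|]. rewrite stirling1_S_S, !IH by lia. lia.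
Qed.

Lemma csum_ext f g n : (forall k, (k <= n)%nat -> f k = g k) -> csum f n = csum g n.
Proof.
  induction n as [|n IH]; intros H; simpl; [apply H; lia|].
  rewrite IH by (intros; apply H; lia). f_equal. apply H. lia.
Qed.

Lemma csum_Cmult c f n : csum (fun k => c * f k)%C n = (c * csum f n)%C.
Proof. induction n as [|n IH]; simpl; [reflexivity|]. rewrite IH. ring. Qed.

Lemma csum_plus f g n : csum (fun k => f k + g k)%C n = (csum f n + csum g n)%C.
Proof. induction n as [|n IH]; simpl; [reflexivity|]. rewrite IH. ring. Qed.

Lemma csum_S_l f n : csum f (S n) = (f O + csum (fun k => f (S k)) n)%C.
Proof. induction n as [|n IH]; [reflexivity|]. simpl in *. rewrite IH. ring. Qed.

Lemma csum_telescope f n : csum (fun k => f k - f (S k))%C n = (f O - f (S n))%C.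
Proof. induction n as [|n IH]; simpl; [reflexivity|]. rewrite IH. ring. Qed.

Lemma sum_n_csum (f : nat -> C) n : sum_n (G := C_NormedModule) f n = csum f n.
Proof. induction n as [|n IH]; [now rewrite sum_O|]. rewrite sum_Sn, IH. reflexivity. Qed.

Definition stirling_sum (n : nat) (X : nat -> C) : C :=
  csum (fun k => RtoC (IZR (stirling1 n k)) * X k)%C n.

Lemma stirling_sum_S n X :
  stirling_sum (S n) X = (stirling_sum n (fun k => X (S k)) - RtoC (INR n) * stirling_sum n X)%C.
Proof.
  unfold stirling_sum.
  assert (E : csum (fun k => RtoC (IZR (stirling1 n k)) * X k)%C n
     = csum (fun k => RtoC (IZR (stirling1 n k)) * X k)%C (S n)).
  { simpl. rewrite (stirling1_gt n (S n)) by lia. ring. }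
  rewrite E, !csum_S_l, stirling1_S_0.
  rewrite (csum_ext _ (fun k => RtoC (IZR (stirling1 n k)) * X (S k)
    + - RtoC (INR n) * (RtoC (IZR (stirling1 n (S k))) * X (S k)))%C).
  - rewrite csum_plus, csum_Cmult, mult_IZR, opp_IZR, <- INR_IZR_INZ, RtoC_mult, RtoC_opp. ring.
  - intros k _. rewrite stirling1_S_S, minus_IZR, mult_IZR, <- INR_IZR_INZ, RtoC_minus, RtoC_mult.
    ring.
Qed.

Lemma is_derive_stirling_sum n (X : nat -> R -> C) (dX : nat -> C) t :
  (forall k, is_derive_RC (X k) t (dX k)) ->
  is_derive_RC (fun u => stirling_sum n (fun k => X k u)) t (stirling_sum n dX).
Proof.
  intros H. unfold stirling_sum. generalize n at 2 4 as m.
  induction m as [|m IH]; cbn [csum]; [|apply is_derive_RC_plus; [exact IH|]];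
    now apply is_derive_RC_Cmult.
Qed.

(* The identity [s^n (d/ds)^n = sum_k s(n,k) (s d/ds)^k], in the variable [t] with
   [s d/ds = mu d/dt] and with [E n] for [s^n (d/ds)^n] applied to a given function. *)
Lemma stirling_sum_iterated_derivative (E f : nat -> R -> C) (mu a b : R) :
  mu <> 0 ->
  (forall n t, a < t < b ->
     is_derive_RC (E n) t (RtoC (/ mu) * (E (S n) t + RtoC (INR n) * E n t))%C) ->
  (forall k t, a < t < b -> is_derive_RC (f k) t (f (S k) t)) ->
  (forall t, a < t < b -> E O t = f O t) ->
  forall n t, a < t < b -> E n t = stirling_sum n (fun k => RtoC (mu ^ k) * f k t)%C.
Proof.
  intros Hmu HE Hf H0. induction n as [|n IH]; intros t Ht.
  - rewrite H0 by assumption. unfold stirling_sum. cbn [csum pow].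
    change (stirling1 0 0) with 1%Z. ring.
  - assert (Hsum : is_derive_RC (E n) t (stirling_sum n (fun k => RtoC (mu ^ k) * f (S k) t)%C)).
    { apply (is_derive_ext_loc (V := C_R_NormedModule)
        (fun u => stirling_sum n (fun k => RtoC (mu ^ k) * f k u)%C)).
      - generalize (filter_and _ _ (open_gt a t (proj1 Ht)) (open_lt b t (proj2 Ht))).
        apply filter_imp. intros u Hu. symmetry. now apply IH.
      - apply (is_derive_stirling_sum n (fun k u => RtoC (mu ^ k) * f k u)%C). intros k.
        apply is_derive_RC_Cmult. now apply Hf. }
    pose proof (is_derive_RC_unique _ _ _ _ (HE n t Ht) Hsum) as Eq.
    assert (Emu : stirling_sum n (fun k => RtoC (mu ^ S k) * f (S k) t)%C
      = (RtoC mu * stirling_sum n (fun k => RtoC (mu ^ k) * f (S k) t))%C).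
    { unfold stirling_sum. rewrite <- csum_Cmult. apply csum_ext. intros k _.
      rewrite <- tech_pow_Rmult, RtoC_mult. ring. }
    rewrite stirling_sum_S, <- IH, Emu, <- Eq, Cmult_assoc, <- RtoC_mult, Rinv_r
      by assumption.
    ring.
Qed.

Lemma is_series_linear {K : AbsRing} {U V : NormedModule K} (L : U -> V) (u : nat -> U) (l : U) :
  is_linear L -> is_series u l -> is_series (fun n => L (u n)) (L l).
Proof.
  intros HL Hu.
  apply (filterlim_ext (fun n => L (sum_n u n)));
    [|exact (filterlim_comp _ _ _ (sum_n u) L _ _ _ Hu (linear_cont L l HL))].
  intros n. induction n as [|n IH]; [now rewrite !sum_O|].
  rewrite !sum_Sn, (linear_plus L HL), IH. reflexivity.
Qed.

Lemma CV_radius_gt (b : nat -> R) r :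
  (forall t, Rabs t < r -> ex_pseries b t) ->
  forall t, Rabs t < r -> Rbar_lt (Rabs t) (CV_radius b).
Proof.
  intros H t Ht. set (t' := (Rabs t + r) / 2). pose proof (Rabs_pos t).
  assert (Ht' : Rabs t' = t') by (apply Rabs_pos_eq; unfold t'; lra).
  apply Rbar_lt_le_trans with (Rabs t'); [simpl; rewrite Ht'; unfold t'; lra|].
  apply Rbar_not_lt_le. intros Hout. apply (CV_disk_outside _ _ Hout).
  apply (is_lim_seq_ext (fun n => scal (pow_n t' n) (b n))).
  { intros n. rewrite pow_n_pow. apply Rmult_comm. }
  apply ex_series_lim_0, H. rewrite Ht'. unfold t'. lra.
Qed.

Lemma is_derive_PSeries_derive_n k (b : nat -> R) t :
  Rbar_lt (Rabs t) (CV_radius b) ->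
  is_derive (PSeries (PS_derive_n k b)) t (PSeries (PS_derive_n (S k) b) t).
Proof.
  intros H. rewrite (PSeries_ext (PS_derive_n (S k) b) (PS_derive (PS_derive_n k b))).
  - apply is_derive_PSeries. now rewrite CV_radius_derive_n.
  - intros n. unfold PS_derive, PS_derive_n.
    replace (S n + k)%nat with (n + S k)%nat by lia.
    rewrite (fact_simpl n), mult_INR. field. split; [apply INR_fact_neq_0|].
    apply not_0_INR. lia.
Qed.

Section BorelDerivatives.

Variables (a : nat -> C) (F : C -> C) (r : R).
Hypothesis F_series : forall zeta : C, Cmod zeta < r ->
  @is_series C_AbsRing C_NormedModule (borel_term a zeta) (F zeta).

Definition borel_coef (L : C -> R) (n : nat) : R := L (a (S n)) / INR (fact n).

Lemma is_pseries_borel_coef (L : C -> R) t :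
  @is_linear R_AbsRing C_R_NormedModule R_NormedModule L -> Rabs t < r ->
  is_pseries (borel_coef L) t (L (F (RtoC t))).
Proof.
  intros HL Ht. rewrite <- Cmod_R in Ht.
  eapply is_series_ext;
    [|exact (is_series_linear (U := C_R_NormedModule) L _ _ HL (F_series (RtoC t) Ht))].
  intros n. unfold borel_term, borel_coef. pose proof (INR_fact_neq_0 n) as Hn.
  replace (a (S n) * RtoC t ^ n / RtoC (INR (fact n)))%C
    with (scal (t ^ n / INR (fact n)) (a (S n) : C_R_NormedModule)).
  - refine (eq_trans (linear_scal (U := C_R_NormedModule) (V := R_NormedModule) L HL _ _)
      (eq_trans _ (f_equal (fun y => y * (L (a (S n)) / INR (fact n))) (eq_sym (pow_n_pow t n))))).
    change (t ^ n / INR (fact n) * L (a (S n)) = t ^ n * (L (a (S n)) / INR (fact n))).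
    field. exact Hn.
  - rewrite scal_R_Cmult, RtoC_div, RtoC_pow by exact Hn.
    change ((RtoC t ^ n / RtoC (INR (fact n)) * a (S n))%C
      = (a (S n) * RtoC t ^ n / RtoC (INR (fact n)))%C). unfold Cdiv. ring.
Qed.

Definition borel_derive (k : nat) (t : R) : C :=
  (PSeries (PS_derive_n k (borel_coef Re)) t, PSeries (PS_derive_n k (borel_coef Im)) t).

Lemma is_derive_borel_derive k t :
  Rabs t < r -> is_derive_RC (borel_derive k) t (borel_derive (S k) t).
Proof.
  intros Ht. apply is_derive_RC_pair.
  split; apply is_derive_PSeries_derive_n, (CV_radius_gt _ r); try assumption;
    intros u Hu; eexists; apply is_pseries_borel_coef; try assumption.
  - exact is_linear_Re.
  - exact is_linear_Im.
Qed.

Lemma borel_derive_0 t : Rabs t < r -> borel_derive 0 t = F (RtoC t).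
Proof.
  intros Ht. unfold borel_derive.
  assert (E : forall b n, PS_derive_n 0 b n = b n).
  { intros b n. unfold PS_derive_n. rewrite Nat.add_0_r. field. apply INR_fact_neq_0. }
  rewrite !(PSeries_ext _ _ _ (E _)).
  rewrite (is_pseries_unique _ _ _ (is_pseries_borel_coef Re t is_linear_Re Ht)).
  rewrite (is_pseries_unique _ _ _ (is_pseries_borel_coef Im t is_linear_Im Ht)).
  symmetry. apply surjective_pairing.
Qed.

Lemma borel_derive_at_0 k : borel_derive k 0 = a (S k).
Proof.
  unfold borel_derive. rewrite !PSeries_0. unfold PS_derive_n, borel_coef. rewrite Nat.add_0_l.
  pose proof (INR_fact_neq_0 k). rewrite (surjective_pairing (a (S k))) at 3.
  f_equal; unfold Re, Im; simpl INR; field; assumption.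
Qed.

End BorelDerivatives.

Section PullbackTaylor.

Variables (F : C -> C) (lam : R).
Hypothesis Hlam : 0 < lam.
Hypothesis F_holomorphic : holomorphic_on (Delta_lam lam) F.

(* This is [s^n phi^(n)(s)] at [s = exp (- t / lam)], where [phi] is the pull-back of [F]. *)
Definition euler_derive (n : nat) (t : R) : C :=
  (RtoC (exp (- (t / lam)) ^ n) * C_derive_n n (log_pullback F lam) (RtoC (exp (- (t / lam)))))%C.

Lemma unit_disc_exp t : - (lam * ln 2) < t -> Cmod (RtoC (exp (- (t / lam))) - 1)%C < 1.
Proof.
  intros Ht. rewrite <- RtoC_minus, Cmod_R. pose proof (exp_pos (- (t / lam))).
  assert (exp (- (t / lam)) < 2); [|apply Rabs_def1; lra].
  rewrite <- (exp_ln 2) by lra. apply exp_increasing.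
  replace (- (t / lam)) with (- t / lam) by (field; lra). apply Rlt_div_l; lra.
Qed.

Lemma is_derive_euler_derive n t :
  - (lam * ln 2) < t ->
  is_derive_RC (euler_derive n) t
    (RtoC (/ - lam) * (euler_derive (S n) t + RtoC (INR n) * euler_derive n t))%C.
Proof.
  intros Ht. set (s := exp (- (t / lam))).
  assert (Hs : is_derive (fun t => exp (- (t / lam))) t (/ - lam * s)).
  { unfold s. auto_derive; [exact I|]. unfold Rdiv. field. lra. }
  assert (Hpow : is_derive (fun t => exp (- (t / lam)) ^ n) t (/ - lam * INR n * s ^ n)).
  { evar_last; [apply is_derive_pow, Hs|]. fold s.
    generalize (/ - lam). intros q. destruct n as [|n]; cbn [pow Nat.pred]; [simpl; ring|].
    cbv beta. fold s. ring. }
  evar_last.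
  - apply is_derive_RC_mult; [apply is_derive_RC_RtoC, Hpow|].
    apply (is_derive_RC_comp (C_derive_n n (log_pullback F lam))); [|apply is_derive_RC_RtoC, Hs].
    apply (is_derive_C_derive_n (log_pullback F lam) 1 1 n).
    + now apply holomorphic_log_pullback.
    + now apply unit_disc_exp.
  - unfold euler_derive. fold s. rewrite <- tech_pow_Rmult, !RtoC_mult.
    set (X := C_derive_n n _ _). set (Y := C_derive_n (S n) _ _).
    change ((RtoC (/ - lam) * RtoC (INR n) * RtoC (s ^ n) * X
        + RtoC (s ^ n) * (Y * (RtoC (/ - lam) * RtoC s)))%C
      = (RtoC (/ - lam) * (RtoC s * RtoC (s ^ n) * Y + RtoC (INR n) * (RtoC (s ^ n) * X)))%C).
    ring.
Qed.

Lemma euler_derive_0 t : euler_derive 0 t = F (RtoC t).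
Proof.
  unfold euler_derive. simpl. rewrite Cmult_1_l. unfold log_pullback.
  rewrite Clog_RtoC, ln_exp, <- RtoC_opp, <- RtoC_mult by apply exp_pos.
  do 2 f_equal. field. lra.
Qed.

Lemma euler_derive_at_0 n : euler_derive n 0 = C_derive_n n (log_pullback F lam) 1.
Proof.
  unfold euler_derive. replace (- (0 / lam)) with 0 by (field; lra).
  rewrite exp_0, pow1. apply Cmult_1_l.
Qed.

Lemma b_lam_derive_n (a : nat -> C) (r : R) n :
  0 < r ->
  (forall zeta : C, Cmod zeta < r ->
     @is_series C_AbsRing C_NormedModule (borel_term a zeta) (F zeta)) ->
  b_lam lam a n = (RtoC ((-1) ^ n / INR (fact n)) * C_derive_n n (log_pullback F lam) 1)%C.
Proof.
  intros Hr HF.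
  assert (Hln : 0 < lam * ln 2)
    by (pose proof ln_lt_2; apply Rmult_lt_0_compat; lra).
  set (d := Rmin r (lam * ln 2)). assert (Hd : 0 < d) by now apply Rmin_pos.
  assert (Hdr : d <= r) by apply Rmin_l. assert (Hdl : d <= lam * ln 2) by apply Rmin_r.
  rewrite <- euler_derive_at_0.
  rewrite (stirling_sum_iterated_derivative euler_derive (borel_derive a) (- lam) (- d) d); try lra.
  - unfold b_lam, stirling_sum. unfold Rdiv.
    rewrite Rmult_comm, RtoC_mult, RtoC_inv by apply INR_fact_neq_0.
    rewrite <- Cmult_assoc. f_equal. rewrite <- csum_Cmult. apply csum_ext. intros k Hk.
    rewrite borel_derive_at_0, !Cmult_assoc, <- !RtoC_mult. do 2 f_equal.
    replace ((-1) ^ n) with ((-1) ^ (n - k) * (-1) ^ k) by (rewrite <- pow_add; f_equal; lia).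
    replace (lam ^ k) with ((-1) ^ k * (- lam) ^ k) by (rewrite <- Rpow_mult_distr; f_equal; ring).
    ring.
  - intros m t Ht. apply is_derive_euler_derive. lra.
  - intros k t Ht. apply (is_derive_borel_derive a F r HF). apply Rabs_def1; lra.
  - intros t Ht. rewrite euler_derive_0. symmetry. apply (borel_derive_0 a F r HF).
    apply Rabs_def1; lra.
Qed.

End PullbackTaylor.

(** * Laplace transforms and factorial series *)

Lemma Cmod_Cexp w : Cmod (Cexp w) = exp (Re w).
Proof. exact (Cmod_circ (exp (Re w)) (Im w) (Rlt_le _ _ (exp_pos _))). Qed.

Definition laplace_kernel (z : C) (t : R) : C := Cexp (- (z * RtoC t))%C.

Lemma Cmod_laplace_kernel z t : Cmod (laplace_kernel z t) = exp (- (Re z * t)).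
Proof. unfold laplace_kernel. rewrite Cmod_Cexp. f_equal. destruct z. simpl. ring. Qed.

Lemma laplace_kernel_0 z : laplace_kernel z 0 = 1.
Proof.
  unfold laplace_kernel. replace (- (z * 0))%C with (RtoC 0) by ring.
  unfold Cexp. simpl. rewrite exp_0, cos_0, sin_0. apply injective_projections; simpl; ring.
Qed.

Lemma is_derive_laplace_kernel z t :
  is_derive_RC (laplace_kernel z) t (- z * laplace_kernel z t)%C.
Proof.
  destruct z as [x y]. apply is_derive_RC_pair.
  split; unfold laplace_kernel, Cexp; simpl; auto_derive; try exact I; unfold Rminus; ring.
Qed.

Lemma continuous_laplace_kernel z t : continuous_RC (laplace_kernel z) t.
Proof. exact (is_derive_RC_continuous _ _ _ (is_derive_laplace_kernel z t)). Qed.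

Definition laplace (f : R -> C) (z : C) : C :=
  @RInt_gen C_R_CompleteNormedModule (fun t => f t * laplace_kernel z t)%C
    (at_point 0) (Rbar_locally p_infty).

Section Laplace.

Variables (f : R -> C) (z : C) (M B : R).
Hypothesis Hz : B < Re z.
Hypothesis f_continuous : forall t, 0 <= t -> continuous_RC f t.
Hypothesis f_bound : forall t, 0 <= t -> Cmod (f t) <= M * exp (B * t).

Lemma continuous_laplace_integrand t :
  0 <= t -> continuous_RC (fun t => f t * laplace_kernel z t)%C t.
Proof.
  intros Ht. apply continuous_RC_mult; [now apply f_continuous|apply continuous_laplace_kernel].
Qed.

Lemma Cmod_laplace_integrand_le t :
  0 <= t -> Cmod (f t * laplace_kernel z t)%C <= M * exp (- ((Re z - B) * t)).
Proof.
  intros Ht. rewrite Cmod_mult, Cmod_laplace_kernel.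
  replace (- ((Re z - B) * t)) with (B * t + - (Re z * t)) by ring.
  rewrite exp_plus, <- Rmult_assoc.
  apply Rmult_le_compat_r; [apply Rlt_le, exp_pos|now apply f_bound].
Qed.

Lemma ex_laplace :
  ex_RInt_gen_C (fun t => f t * laplace_kernel z t)%C (at_point 0) (Rbar_locally p_infty).
Proof.
  apply (ex_RInt_gen_dominated (V := C_R_CompleteNormedModule) (at_point 0) (Rbar_locally p_infty)
    (fun t => 0 <= t) ltac:(intros; lra) (Rle_refl 0) (Rbar_locally_p_infty_ge 0) _
    (fun t => M * exp (- ((Re z - B) * t)))).
  - exact continuous_laplace_integrand.
  - intros t _. apply (@ex_derive_continuous R_AbsRing R_NormedModule). auto_derive. exact I.
  - intros t Ht. rewrite C_R_norm. now apply Cmod_laplace_integrand_le.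
  - eexists. apply is_RInt_gen_exp_decay. lra.
Qed.

Lemma laplace_correct :
  is_RInt_gen_C (fun t => f t * laplace_kernel z t)%C (at_point 0) (Rbar_locally p_infty)
    (laplace f z).
Proof. exact (RInt_gen_C_correct _ _ _ ex_laplace). Qed.

Lemma Cmod_laplace_le : Cmod (laplace f z) <= M / (Re z - B).
Proof.
  rewrite <- C_R_norm, <- (Rmult_1_r (M / _)), <- exp_0, <- Ropp_0, <- (Rmult_0_r (Re z - B)) at 1.
  refine (RInt_gen_norm (V := C_R_CompleteNormedModule) _ _ _ _ _ _ laplace_correct
    (is_RInt_gen_exp_decay M (Re z - B) 0 _)); [| |lra].
  - apply Filter_prod with (fun t => t = 0) (fun t => 0 <= t);
      [reflexivity|apply Rbar_locally_p_infty_ge|simpl; intros; lra].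
  - apply Filter_prod with (fun t => t = 0) (fun t => 0 <= t);
      [reflexivity|apply Rbar_locally_p_infty_ge|].
    cbn [fst snd]. intros u v -> Hv t Ht. rewrite C_R_norm. apply Cmod_laplace_integrand_le, Ht.
Qed.

Lemma is_RInt_gen_laplace_derive (df : R -> C) :
  (forall t, 0 <= t -> is_derive_RC f t (df t)) ->
  (forall t, 0 <= t -> continuous_RC df t) ->
  is_RInt_gen_C (fun t => df t * laplace_kernel z t)%C (at_point 0) (Rbar_locally p_infty)
    (z * laplace f z - f 0)%C.
Proof.
  intros Hdf Hcont.
  assert (Hparts : is_RInt_gen_C
    (fun t => df t * laplace_kernel z t + f t * (- z * laplace_kernel z t))%C
    (at_point 0) (Rbar_locally p_infty) (0 - f 0)%C).
  { replace (0 - f 0)%C with (0 - f 0 * laplace_kernel z 0)%C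
      by (rewrite laplace_kernel_0; ring).
    apply (is_RInt_gen_derive (V := C_R_CompleteNormedModule) (at_point 0) (Rbar_locally p_infty)
      (fun t => 0 <= t) ltac:(intros; lra) (Rle_refl 0) (Rbar_locally_p_infty_ge 0)
      (fun t => f t * laplace_kernel z t)%C).
    - intros t Ht. apply is_derive_RC_mult; [now apply Hdf|apply is_derive_laplace_kernel].
    - intros t Ht. apply continuous_RC_plus; apply continuous_RC_mult;
        auto using continuous_laplace_kernel.
      apply continuous_RC_mult; [apply continuous_RC_const|apply continuous_laplace_kernel].
    - apply (filterlim_at_point (V := C_R_NormedModule) (fun t => f t * laplace_kernel z t)%C).
    - apply (filterlim_C_0_dominated _ _ (fun t => M * exp (- ((Re z - B) * t)))).
      + generalize (Rbar_locally_p_infty_ge 0). apply filter_imp. exact Cmod_laplace_integrand_le.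
      + apply (filterlim_Rmult_0 _ M), filterlim_exp_decay. lra. }
  pose proof (is_RInt_gen_C_plus _ _ _ _ _ _ Hparts
    (is_RInt_gen_C_Cmult z _ _ _ _ laplace_correct)) as H.
  replace (z * laplace f z - f 0)%C with (0 - f 0 + z * laplace f z)%C by ring.
  revert H. apply is_RInt_gen_ext. apply filter_forall. intros ab t _.
  change ((df t * laplace_kernel z t + f t * (- z * laplace_kernel z t)
    + z * (f t * laplace_kernel z t))%C = (df t * laplace_kernel z t)%C). ring.
Qed.

End Laplace.

Section FactorialExpansion.

Variables (E : nat -> R -> C) (lam B : R) (z : C).
Hypothesis Hlam : 0 < lam.
Hypothesis HB : 0 < B.
Hypothesis Hz : B < Re z.
Hypothesis E_derive : forall n t, 0 <= t ->
  is_derive_RC (E n) t (RtoC (/ - lam) * (E (S n) t + RtoC (INR n) * E n t))%C.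
Hypothesis E_bound : forall n, exists M, forall t, 0 <= t -> Cmod (E n t) <= M * exp (B * t).

Let E_continuous n t (Ht : 0 <= t) : continuous_RC (E n) t :=
  is_derive_RC_continuous _ _ _ (E_derive n t Ht).

Lemma Re_lam_mult_pos : 0 < Re (RtoC lam * z)%C.
Proof.
  replace (Re (RtoC lam * z)%C) with (lam * Re z) by (destruct z; simpl; ring).
  apply Rmult_lt_0_compat; lra.
Qed.

Lemma laplace_recurrence n :
  laplace (E (S n)) z
  = (RtoC lam * E n 0 - (RtoC lam * z + RtoC (INR n)) * laplace (E n) z)%C.
Proof.
  destruct (E_bound n) as [M HM]. destruct (E_bound (S n)) as [M' HM'].
  pose proof (laplace_correct (E n) z M B Hz (E_continuous n) HM) as Hn.
  pose proof (laplace_correct (E (S n)) z M' B Hz (E_continuous (S n)) HM') as HSn.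
  assert (Hparts := is_RInt_gen_laplace_derive (E n) z M B Hz (E_continuous n) HM _ (E_derive n)).
  specialize (Hparts ltac:(intros t Ht; apply continuous_RC_mult; [apply continuous_RC_const|];
    apply continuous_RC_plus; [now apply E_continuous|apply continuous_RC_mult;
      [apply continuous_RC_const|now apply E_continuous]])).
  pose proof (is_RInt_gen_C_Cmult (RtoC (/ - lam)) _ _ _ _
    (is_RInt_gen_C_plus _ _ _ _ _ _ HSn (is_RInt_gen_C_Cmult (RtoC (INR n)) _ _ _ _ Hn))) as Hsum.
  assert (Eq : (z * laplace (E n) z - E n 0
    = RtoC (/ - lam) * (laplace (E (S n)) z + RtoC (INR n) * laplace (E n) z))%C).
  { apply (is_RInt_gen_C_unique _ _ _ _ _ Hparts). revert Hsum.
    apply is_RInt_gen_ext, filter_forall. intros ab t _.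
    change ((RtoC (/ - lam) * (E (S n) t * laplace_kernel z t
        + RtoC (INR n) * (E n t * laplace_kernel z t)))%C
      = (RtoC (/ - lam) * (E (S n) t + RtoC (INR n) * E n t) * laplace_kernel z t)%C). ring. }
  apply (f_equal (Cmult (RtoC (- lam)))) in Eq.
  rewrite (Cmult_assoc (RtoC (- lam)) (RtoC (/ - lam))), <- RtoC_mult, Rinv_r, RtoC_opp in Eq
    by lra.
  replace (laplace (E (S n)) z) with
    (- RtoC lam * (z * laplace (E n) z - E n 0) - RtoC (INR n) * laplace (E n) z)%C
    by (rewrite Eq; ring). ring.
Qed.

Lemma laplace_factorial_expansion N :
  csum (fun n => RtoC ((-1) ^ n) * (RtoC lam * E n 0) / Crising (RtoC lam * z) (S n))%C N
  = (laplace (E O) z - RtoC ((-1) ^ S N) * laplace (E (S N)) z / Crising (RtoC lam * z) (S N))%C.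
Proof.
  set (Q := fun n => (RtoC ((-1) ^ n) * laplace (E n) z / Crising (RtoC lam * z) n)%C).
  rewrite (csum_ext _ (fun n => Q n - Q (S n))%C).
  - rewrite csum_telescope. f_equal. unfold Q. cbn [pow Crising]. field.
  - intros n _. unfold Q. rewrite laplace_recurrence.
    replace (RtoC ((-1) ^ S n)) with (- RtoC ((-1) ^ n))%C
      by (rewrite <- RtoC_opp; f_equal; simpl; ring).
    pose proof (Crising_neq_0 _ n Re_lam_mult_pos) as Hn.
    pose proof (Re_pos_neq_0 _ (Re_plus_INR_pos _ n Re_lam_mult_pos)) as Hwn.
    cbn [Crising]. field. now split.
Qed.

End FactorialExpansion.

Section BorelSum.

Variables (a : nat -> C) (F : C -> C) (lam A B r : R).
Hypothesis Hlam : 0 < lam.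
Hypothesis HA : 0 < A.
Hypothesis HB : 0 < B.
Hypothesis Hr : 0 < r.
Hypothesis F_holomorphic : holomorphic_on (Delta_lam lam) F.
Hypothesis F_series : forall zeta : C, Cmod zeta < r ->
  @is_series C_AbsRing C_NormedModule (borel_term a zeta) (F zeta).
Hypothesis F_bound : forall zeta, Delta_lam lam zeta -> Cmod (F zeta) <= A * exp (B * Cmod zeta).

Notation E := (euler_derive F lam).

Lemma euler_derive_exp_bound n K :
  (forall s, 0 < s <= 1 ->
     s ^ n * Cmod (C_derive_n n (log_pullback F lam) (RtoC s)) <= K * Rpower s (- (lam * B))) ->
  forall t, 0 <= t -> Cmod (E n t) <= K * exp (B * t).
Proof.
  intros HK t Ht. pose proof (exp_pos (- (t / lam))) as Hs.
  unfold euler_derive. rewrite Cmod_mult, Cmod_R, Rabs_pos_eq by now apply Rlt_le, pow_lt.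
  replace (exp (B * t)) with (Rpower (exp (- (t / lam))) (- (lam * B)))
    by (unfold Rpower; rewrite ln_exp; f_equal; field; lra).
  apply HK. split; [assumption|]. rewrite <- exp_0. apply exp_le_mono.
  assert (0 <= t / lam) by (apply Rdiv_le_0_compat; lra). lra.
Qed.

(* The radius [n / (n + lam B)] is the one that minimizes Cauchy's estimate. *)
Lemma euler_derive_sup_bound m t :
  0 <= t ->
  Cmod (E (S m) t) <= A / Rpower (lam * B) (lam * B)
    * (Rpower (INR (S m) + lam * B) (INR (S m) + lam * B) / INR (S m) ^ m) * INR (fact m)
    * exp (B * t).
Proof.
  assert (Hbe : 0 < lam * B) by now apply Rmult_lt_0_compat. set (be := lam * B) in *.
  assert (Hm : 0 < INR (S m)) by (apply lt_0_INR; lia).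
  set (x := INR (S m)) in *. set (al := x / (x + be)).
  assert (Hal : 0 < al < 1)
    by (unfold al; split; [apply Rdiv_lt_0_compat; lra|apply Rlt_div_l; lra]).
  assert (Eal : Rpower (1 - al) (- be) = Rpower (x + be) be / Rpower be be).
  { replace (1 - al) with (be / (x + be)) by (unfold al; field; lra).
    unfold Rpower, Rdiv. rewrite ln_mult, ln_Rinv, <- exp_Ropp, <- exp_plus
      by (try apply Rinv_0_lt_compat; lra).
    f_equal. ring. }
  revert t. apply euler_derive_exp_bound. intros s Hs.
  eapply Rle_trans;
    [apply (log_pullback_derive_n_sup F lam A B Hlam HA HB F_holomorphic F_bound s al); assumption|].
  right. fold be. rewrite Eal, Rpower_plus. unfold x at 3.
  rewrite Rpower_pow, fact_simpl, mult_INR by lra. fold x.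
  unfold al, Rdiv. rewrite Rpow_mult_distr, pow_inv. cbn [pow].
  field. repeat split; try apply Rgt_not_eq, Rpower_pos; try (apply pow_nonzero; lra); lra.
Qed.

Lemma euler_derive_exp_bounded n : exists M, forall t, 0 <= t -> Cmod (E n t) <= M * exp (B * t).
Proof.
  eexists. apply euler_derive_exp_bound. intros s Hs.
  eapply Rle_trans;
    [apply (log_pullback_derive_n_sup F lam A B Hlam HA HB F_holomorphic F_bound s (/ 2)); lra|].
  right. set (p := Rpower s _). set (q := Rpower _ _). set (d := INR (fact n) / _).
  transitivity (d * A * q * p); [ring|reflexivity].
Qed.

Lemma is_derive_euler_derive_nonneg n t :
  0 <= t -> is_derive_RC (E n) t (RtoC (/ - lam) * (E (S n) t + RtoC (INR n) * E n t))%C.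
Proof.
  intros Ht. apply is_derive_euler_derive; [assumption..|].
  assert (0 < lam * ln 2)
    by (pose proof ln_lt_2; apply Rmult_lt_0_compat; lra). lra.
Qed.

Lemma fact_term_euler_derive z n :
  0 < Re (RtoC lam * z)%C ->
  fact_term lam a z n
  = (RtoC ((-1) ^ n) * (RtoC lam * E n 0) / Crising (RtoC lam * z) (S n))%C.
Proof.
  intros Hw. unfold fact_term.
  rewrite euler_derive_at_0, (b_lam_derive_n F lam Hlam F_holomorphic a r n Hr F_series)
    by assumption.
  set (X := C_derive_n n _ _). set (w := (RtoC lam * z)%C) in *.
  transitivity (RtoC lam * (RtoC ((-1) ^ n / INR (fact n)) * X)
    * (Cgamma w * Cgamma (RtoC (INR (S n))) / Cgamma (w + RtoC (INR (S n)))))%C;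
    [unfold Cdiv; ring|].
  pose proof (INR_fact_neq_0 n) as Hfact.
  assert (RtoC (INR (fact n)) <> 0) by (intros H; apply Hfact; now injection H).
  rewrite Cgamma_beta, RtoC_div by assumption. field. split; [now apply Crising_neq_0|assumption].
Qed.

Lemma ex_RInt_gen_laplace_integrand z :
  B < Re z -> ex_RInt_gen_C (laplace_integrand F z) (at_point 0) (Rbar_locally p_infty).
Proof.
  intros Hz. destruct (euler_derive_exp_bounded 0) as [M HM].
  generalize (ex_laplace (E 0) z M B Hz
    (fun t Ht => is_derive_RC_continuous _ _ _ (is_derive_euler_derive_nonneg 0 t Ht)) HM).
  apply ex_RInt_gen_ext_eq. intros t. now rewrite euler_derive_0.
Qed.

Lemma borel_sum_laplace z : B < Re z -> borel_sum a F z = (a O + laplace (E 0) z)%C.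
Proof.
  intros Hz. unfold borel_sum, laplace. apply (f_equal (Cplus (a O))).
  refine (RInt_gen_ext_eq (V := C_R_CompleteNormedModule) (laplace_integrand F z) _ _
    (ex_RInt_gen_laplace_integrand z Hz)).
  intros t. unfold laplace_integrand. now rewrite euler_derive_0.
Qed.

Lemma borel_sum_remainder z N :
  B < Re z ->
  (borel_sum a F z - (a O + csum (fact_term lam a z) N)
  = RtoC ((-1) ^ S N) * laplace (E (S N)) z / Crising (RtoC lam * z) (S N))%C.
Proof.
  intros Hz. rewrite borel_sum_laplace by assumption.
  rewrite (csum_ext _
    (fun n => RtoC ((-1) ^ n) * (RtoC lam * E n 0) / Crising (RtoC lam * z) (S n))%C).
  - rewrite (laplace_factorial_expansion E lam B) by
      auto using is_derive_euler_derive_nonneg, euler_derive_exp_bounded. ring.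
  - intros n _. apply fact_term_euler_derive. now apply (Re_lam_mult_pos lam B).
Qed.

Lemma Cmod_borel_sum_remainder_le z N K :
  B < Re z -> (forall t, 0 <= t -> Cmod (E (S N) t) <= K * exp (B * t)) ->
  Cmod (borel_sum a F z - (a O + csum (fact_term lam a z) N))%C
  <= K / (Re z - B) / Cmod (Crising (RtoC lam * z) (S N)).
Proof.
  intros Hz HK. rewrite borel_sum_remainder by assumption.
  assert (Hw : Crising (RtoC lam * z) (S N) <> 0)
    by (apply Crising_neq_0; now apply (Re_lam_mult_pos lam B)).
  rewrite Cmod_div, Cmod_mult, Cmod_R, pow_1_abs, Rmult_1_l by assumption.
  apply Rmult_le_compat_r; [apply Rlt_le, Rinv_0_lt_compat; now apply Cmod_gt_0|].
  apply (Cmod_laplace_le _ z K B Hz); [|assumption].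
  intros t Ht. exact (is_derive_RC_continuous _ _ _ (is_derive_euler_derive_nonneg _ t Ht)).
Qed.

Theorem borel_sum_remainder_le_R_fact z N :
  B < Re z ->
  Cmod (borel_sum a F z - (a O + csum (fact_term lam a z) N))%C <= R_fact lam A B N z.
Proof.
  intros Hz. pose proof (Re_lam_mult_pos lam B z Hlam HB Hz) as Hw.
  pose proof (Crising_neq_0 _ (S N) Hw) as Hrising.
  pose proof (Cgamma_beta _ N Hw) as Hbeta.
  eapply Rle_trans; [apply Cmod_borel_sum_remainder_le; [assumption|apply euler_derive_sup_bound]|].
  right. unfold R_fact. set (w := (RtoC lam * z)%C) in *.
  assert (Ez : RtoC (Re z - B) <> 0) by (intros H; injection H; lra).
  replace (Cgamma w * Cgamma (RtoC (INR (S N)))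
      / (Cgamma (w + RtoC (INR (S N))) * RtoC (Re z - B)))%C
    with (Cgamma w * Cgamma (RtoC (INR (S N))) / Cgamma (w + RtoC (INR (S N)))
      / RtoC (Re z - B))%C
    by (field; split; [exact Ez|apply Cgamma_neq_0, Re_plus_INR_pos, Hw]).
  rewrite Hbeta, !Cmod_div, !Cmod_R by assumption.
  rewrite (Rabs_pos_eq (INR (fact N))), (Rabs_pos_eq (Re z - B)) by (try apply pos_INR; lra).
  rewrite S_INR. replace (INR N + 1 + lam * B) with (INR N + lam * B + 1) by ring.
  field. repeat split; try apply Rgt_not_eq, Rpower_pos; try lra.
  - now apply Rgt_not_eq, Cmod_gt_0.
  - apply pow_nonzero. pose proof (pos_INR N). lra.
Qed.

Section Convergence.

Variables (z : C) (c M : R).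
Hypothesis Hz : B < Re z.
Hypothesis Hc : 0 < c < lam * Re z.
Hypothesis HM : 0 < M.
Hypothesis E_rising : forall n t, 0 <= t -> Cmod (E n t) <= M * Rrising c n * exp (B * t).

Lemma Rrising_div_le_Crising K n :
  0 <= K -> K / Cmod (Crising (RtoC lam * z) n) <= K / Rrising (lam * Re z) n.
Proof.
  intros HK. apply Rmult_le_compat_l; [assumption|].
  apply Rinv_le_contravar; [apply Rrising_pos; lra|].
  replace (lam * Re z) with (Re (RtoC lam * z)%C) by (destruct z; simpl; ring).
  apply Rrising_le_Cmod_Crising. now apply (Re_lam_mult_pos lam B).
Qed.

Lemma ex_series_Cmod_fact_term : ex_series (fun n => Cmod (fact_term lam a z n)).
Proof.
  apply (ex_series_le (V := R_CompleteNormedModule) _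
    (fun n => lam * M * (Rrising c n / Rrising (lam * Re z) (S n)))).
  - intros n. pose proof (Re_lam_mult_pos lam B z Hlam HB Hz) as Hw.
    change (Rabs (Cmod (fact_term lam a z n))
      <= lam * M * (Rrising c n / Rrising (lam * Re z) (S n))).
    rewrite Rabs_pos_eq, fact_term_euler_derive by (try apply Cmod_ge_0; assumption).
    rewrite Cmod_div, Cmod_mult, Cmod_mult, !Cmod_R, pow_1_abs, Rmult_1_l, Rabs_pos_eq
      by (try apply Crising_neq_0; lra).
    pose proof (E_rising n 0 (Rle_refl 0)) as HE. rewrite Rmult_0_r, exp_0, Rmult_1_r in HE.
    eapply Rle_trans; [apply Rrising_div_le_Crising, Rmult_le_pos; [lra|apply Cmod_ge_0]|].
    unfold Rdiv. rewrite <- Rmult_assoc. apply Rmult_le_compat_r.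
    + apply Rlt_le, Rinv_0_lt_compat, Rrising_pos. lra.
    + rewrite Rmult_assoc. apply Rmult_le_compat_l; lra.
  - apply (ex_series_scal (K := R_AbsRing) (V := R_NormedModule) (lam * M)).
    now apply ex_series_Rrising_ratio.
Qed.

Lemma is_series_fact_term :
  @is_series C_AbsRing C_NormedModule (fact_term lam a z) (borel_sum a F z - a O)%C.
Proof.
  apply (proj2 (filterlim_C_eps eventually _ _)). intros e He.
  assert (Hlim : is_lim_seq
    (fun n => M / (Re z - B) * (Rrising c (S n) / Rrising (lam * Re z) (S n))) 0).
  { rewrite <- (Rmult_0_r (M / (Re z - B))). apply (is_lim_seq_scal_l _ _ (Finite 0)).
    exact (proj1 (is_lim_seq_incr_1 (fun n => Rrising c n / Rrising (lam * Re z) n) 0)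
      (is_lim_seq_Rrising_ratio c _ Hc)). }
  generalize (proj1 (filterlim_locally _ _) Hlim (mkposreal e He)). apply filter_imp. intros n Hn.
  rewrite sum_n_csum, Cmod_minus_sym.
  replace (borel_sum a F z - a O - csum (fact_term lam a z) n)%C
    with (borel_sum a F z - (a O + csum (fact_term lam a z) n))%C by ring.
  eapply Rle_lt_trans; [apply (Cmod_borel_sum_remainder_le z n _ Hz (E_rising (S n)))|].
  apply Rabs_def2 in Hn as [Hn _]. rewrite Rminus_0_r in Hn.
  eapply Rle_lt_trans; [apply Rrising_div_le_Crising|].
  - apply Rlt_le, Rdiv_lt_0_compat; [|lra]. apply Rmult_lt_0_compat; [|apply Rrising_pos]; lra.
  - replace (M * Rrising c (S n) / (Re z - B) / Rrising (lam * Re z) (S n))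
      with (M / (Re z - B) * (Rrising c (S n) / Rrising (lam * Re z) (S n)))
      by (unfold Rdiv; ring). exact Hn.
Qed.

End Convergence.

Theorem factorial_series_converges z :
  Rmax B (/ lam) < Re z ->
  ex_series (fun n => Cmod (fact_term lam a z n))
  /\ @is_series C_AbsRing C_NormedModule (fact_term lam a z) (borel_sum a F z - a O)%C.
Proof.
  intros Hz. apply Rmax_Rlt in Hz as [HzB Hzl].
  assert (Hx : 1 < lam * Re z) by (rewrite <- (Rinv_r lam) by lra; now apply Rmult_lt_compat_l).
  assert (HxB : lam * B < lam * Re z) by now apply Rmult_lt_compat_l.
  set (c := (Rmax 1 (lam * B) + lam * Re z) / 2).
  pose proof (Rmax_l 1 (lam * B)). pose proof (Rmax_r 1 (lam * B)).
  pose proof (Rmax_lub_lt _ _ _ Hx HxB).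
  destruct (log_pullback_derive_n_rising F lam A B Hlam HA HB F_holomorphic F_bound c)
    as [M [HM Hder]]; [unfold c; lra..|].
  assert (E_rising : forall n t, 0 <= t -> Cmod (E n t) <= M * Rrising c n * exp (B * t))
    by (intros n; apply euler_derive_exp_bound; intros s; apply Hder).
  assert (Hc : 0 < c < lam * Re z) by (unfold c; lra).
  split; [now apply (ex_series_Cmod_fact_term z c M)|now apply (is_series_fact_term z c M)].
Qed.

End BorelSum.

Theorem theorem3p2 (a : nat -> C) (F : C -> C) (lam A B : R) :
  Gevrey1 a ->
  0 < lam -> 0 < A -> 0 < B ->
  (* F is holomorphic on Delta_lambda *)
  (forall zeta : C, Delta_lam lam zeta -> @ex_derive C_AbsRing C_NormedModule F zeta) ->
  (* F extends the Borel transform (agrees with its series near 0) *)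
  (exists r : R, 0 < r /\ forall zeta : C, Cmod zeta < r ->
      @is_series C_AbsRing C_NormedModule (borel_term a zeta) (F zeta)) ->
  (* exponential bound on Delta_lambda *)
  (forall zeta : C, Delta_lam lam zeta -> Cmod (F zeta) <= A * exp (B * Cmod zeta)) ->
  (* (i) *)
  (forall z : C, Rmax B (/ lam) < Re z ->
     @ex_RInt_gen C_R_NormedModule (laplace_integrand F z) (at_point 0) (Rbar_locally p_infty)
     /\ ex_series (fun n => Cmod (fact_term lam a z n))
     /\ @is_series C_AbsRing C_NormedModule (fact_term lam a z) (borel_sum a F z - a O)%C)
  /\
  (* (ii) *)
  (forall (N : nat) (z : C), B < Re z ->
     @ex_RInt_gen C_R_NormedModule (laplace_integrand F z) (at_point 0) (Rbar_locally p_infty)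
     /\ Cmod (borel_sum a F z - (a O + csum (fact_term lam a z) N))%C
          <= R_fact lam A B N z).
Proof.
  intros _ Hlam HA HB F_holomorphic [r [Hr F_series]] F_bound.
  assert (Hintegrable := ex_RInt_gen_laplace_integrand F lam A B Hlam HA HB F_holomorphic F_bound).
  split.
  - intros z Hz. split.
    + apply Hintegrable. now apply Rmax_Rlt in Hz.
    + now apply (factorial_series_converges a F lam A B r).
  - intros N z Hz. split.
    + now apply Hintegrable.
    + now apply (borel_sum_remainder_le_R_fact a F lam A B r).
Qed.
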